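(* Let $1/2<\alpha<2$, $d\in\mathbb{N}$, and let $\boldsymbol{\gamma}=(\gamma_1,\ldots,\gamma_d)$ be positive weights. Let $n$ be a prime and let $\boldsymbol{z}\in\{1,\ldots,n-1\}^d$ be the generating vector constructed by the component-by-component (CBC) algorithm described in the context with the rescaled weights $\Gamma_{j,\alpha}=\underline{\kappa}_\alpha^{-1/2}\gamma_j$. Then the worst-case integration error of the tent-transformed rank-1 lattice rule in the fractional Sobolev space $H_{\alpha,\boldsymbol{\gamma},d}^{\mathrm{sob}}$ satisfies $$e^{\mathrm{wor}}(H_{\alpha,\boldsymbol{\gamma},d}^{\mathrm{sob}};P^{\varphi}_{n,\boldsymbol{z}})\le\left[\frac{V_d(\alpha,\lambda,\boldsymbol{\gamma})-1}{n-1}\right]^{\lambda}\quad\text{with}\quad V_d(\alpha,\lambda,\boldsymbol{\gamma})=\prod_{j=1}^d\left(1+2\Gamma_{j,\alpha}^{1/\lambda}\zeta(\alpha/\lambda)\right),$$ for any $1/2\le\lambda<\alpha$, where $\zeta$ is the Riemann zeta function.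
   Context: **Spaces.** Functions are real-valued. Let $\phi_0(x)=1$, $\phi_k(x)=\sqrt2\cos(k\pi x)$ for $k\in\mathbb{N}$, and $\phi_{\boldsymbol{k}}(\boldsymbol{x})=\prod_{j=1}^d\phi_{k_j}(x_j)$ for $\boldsymbol{k}\in\mathbb{N}_0^d$; put $\widetilde f(\boldsymbol{k})=\int_{[0,1]^d}f\phi_{\boldsymbol{k}}$. For $\alpha>1/2$ and weights $\gamma_j>0$ let $r_{\alpha,\gamma}(0)=1$, $r_{\alpha,\gamma}(k)=\gamma^{-1}k^\alpha$ for $k\in\mathbb{N}$, $r_{\alpha,\boldsymbol{\gamma}}(\boldsymbol{k})=\prod_{j=1}^d r_{\alpha,\gamma_j}(k_j)$. The half-period cosine space $H_{\alpha,\boldsymbol{\gamma},d}^{\cos}$ consists of $f\in L_2([0,1]^d)$ with $(\|f\|_{\alpha,\boldsymbol{\gamma},d}^{\cos})^2=\sum_{\boldsymbol{k}\in\mathbb{N}_0^d}|\widetilde f(\boldsymbol{k})|^2r_{\alpha,\boldsymbol{\gamma}}^2(\boldsymbol{k})<\infty$. Let $\mathcal{P}^{\cos}=\operatorname{span}\{\phi_k\mid k\in\mathbb{N}_0\}$ on $[0,1]$. On $\mathcal{P}^{\cos}$ define, for $1/2<\alpha<1$, $$\langle f,g\rangle_{\alpha,\gamma,1}^{\mathrm{sob}}=\int_0^1 f\int_0^1 g+\frac{1}{\gamma^2}\cdot\frac{(1-\alpha)\pi^3}{8}\int_0^1\!\int_0^1(f(x)-f(y))(g(x)-g(y))\left(\frac{1}{|\sin\frac{\pi(x-y)}{2}|^{2\alpha+1}}+\frac{1}{|\sin\frac{\pi(x+y)}{2}|^{2\alpha+1}}\right)dx\,dy,$$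 and, for $1<\alpha<2$, $$\langle f,g\rangle_{\alpha,\gamma,1}^{\mathrm{sob}}=\int_0^1 f\int_0^1 g+\frac{1}{\gamma^2}\left(\int_0^1 f'g'+\mathcal{B}_\alpha(f',g')\right),$$ $$\mathcal{B}_\alpha(f',g')=\frac{(\alpha-1)(2-\alpha)\pi^3}{8}\int_0^1\!\int_0^1\left(\frac{(f'(x)-f'(y))(g'(x)-g'(y))}{|\sin\frac{\pi(x-y)}{2}|^{2\alpha-1}}+\frac{(f'(x)+f'(y))(g'(x)+g'(y))}{|\sin\frac{\pi(x+y)}{2}|^{2\alpha-1}}\right)dx\,dy.$$ For these $\alpha$, $H_{\alpha,\gamma,1}^{\mathrm{sob}}$ is the completion of $\mathcal{P}^{\cos}$ in the induced norm. For $\alpha=1$, $H_{1,\gamma,1}^{\mathrm{sob}}$ is the space of $f$ with weak derivative $f'\in L_2([0,1])$ and inner product $\int_0^1 f\int_0^1 g+\gamma^{-2}\int_0^1 f'g'$. For $d\ge1$, $H_{\alpha,\boldsymbol{\gamma},d}^{\mathrm{sob}}=\bigotimes_{j=1}^dH_{\alpha,\gamma_j,1}^{\mathrm{sob}}$ (Hilbert tensor product), with norm $\|\cdot\|_{\alpha,\boldsymbol{\gamma},d}^{\mathrm{sob}}$. The identity on finite cosine expansions extends to an isomorphism of $H_{\alpha,\boldsymbol{\gamma},d}^{\cos}$ onto $H_{\alpha,\boldsymbol{\gamma},d}^{\mathrm{sob}}$, through which the two spaces are identified; their elements are continuous functions on $[0,1]^d$ (given by absolutely and uniformly convergent cosine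 series). **Constants.** $\underline{\kappa}_\alpha=c_\alpha$ if $1/2<\alpha<1$, $\underline{\kappa}_1=\pi^2$, $\underline{\kappa}_\alpha=c'_\alpha$ if $1<\alpha<2$, where $$c_\alpha=2(1-\alpha)\pi^{2-2\alpha}\int_0^{1/2}\frac{\sin^2(\pi t)}{t^{2\alpha+1}}dt,\qquad c'_\alpha=2(\alpha-1)(2-\alpha)\pi^{6-2\alpha}\int_0^{1/2}\frac{\sin^2(\pi t)}{t^{2\alpha-1}}dt.$$ **Lattice rule and error.** For $\boldsymbol{z}\in\{0,\ldots,n-1\}^d$, $\boldsymbol{y}_i=(\{iz_1/n\},\ldots,\{iz_d/n\})$, $0\le i<n$, with $\{\cdot\}$ the fractional part. The tent transformation is $\varphi(x)=1-|2x-1|$, applied componentwise; $P^{\varphi}_{n,\boldsymbol{z}}=\{\boldsymbol{x}_i=\varphi(\boldsymbol{y}_i)\mid 0\le i<n\}$. With $I(f)=\int_{[0,1]^d}f(\boldsymbol{x})\,d\boldsymbol{x}$ and $I(f;P^{\varphi}_{n,\boldsymbol{z}})=\frac1n\sum_{i=0}^{n-1}f(\boldsymbol{x}_i)$, the worst-case error is $e^{\mathrm{wor}}(H;P^{\varphi}_{n,\boldsymbol{z}})=\sup_{f\in H,\ \|f\|_H\le1}|I(f)-I(f;P^{\varphi}_{n,\boldsymbol{z}})|$. **CBC algorithm.** Set $z_1=1$. For $s=2,\ldots,d$ successively, with $z_1,\ldots,z_{s-1}$ fixed, choose $z_s\in\{1,\ldots,n-1\}$ minimizing $$E^2_{n,s}(z_s\mid(z_1,\ldots,z_{s-1}))=-1+\frac1n\sum_{i=0}^{n-1}\prod_{j=1}^s\left(1+\Gamma_{j,\alpha}^2\,\omega_{2\alpha}\left(\left\{\frac{iz_j}{n}\right\}\right)\right),\qquad\omega_{2\alpha}(x)=\sum_{k\in\mathbb{Z}\setminus\{0\}}|k|^{-2\alpha}e^{2\pi\mathrm{i}kx}.$$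 *)

(* Defs.v *)
From mathcomp Require Import all_boot all_order all_algebra.
From mathcomp Require Import complex.
From mathcomp Require Import all_classical all_reals all_analysis.

Set Implicit Arguments.
Unset Strict Implicit.
Unset Printing Implicit Defensive.

Import Order.TTheory GRing.Theory Num.Theory.
Import numFieldNormedType.Exports.

Local Open Scope classical_set_scope.
Local Open Scope ring_scope.

(** * Pre-Hilbert spaces of functions and their completions *)

(** The data of a pre-Hilbert space of functions [T -> R]; the laws are not
    recorded.  Its vectors are the [u : rep] with [dom u], and [ev u] is the
    function that [u] represents.  Representatives are needed because the inner
    product of an algebraic tensor product is given on formal sums of pure
    tensors. *)
Record prehilbert (R : realType) (T : Type) := Prehilbert {
  rep : Type;
  dom : set rep;
  ev : rep -> T -> R;
  ip : rep -> rep -> R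
}.

Section Completion.
Variables (R : realType) (T : choiceType) (D : set T) (H : prehilbert R T).

(* [|u - v|^2], expanded by bilinearity *)
Definition dist2 (u v : rep H) : R := ip u u - 2 * ip u v + ip v v.

Definition cauchy_reps (p : nat -> rep H) : Prop :=
  forall e : R, 0 < e -> exists N : nat, forall m l : nat,
    (N <= m)%N -> (N <= l)%N -> dist2 (p m) (p l) < e.

Definition approximates (p : nat -> rep H) (f : T -> R) : Prop :=
  [/\ forall m, dom (p m),
      cauchy_reps p &
      {uniform D, (fun m => ev (p m)) @ \oo --> f}].

(* The value does not depend on the approximating sequences that are picked as
   soon as Cauchy sequences with uniform limit 0 have norms tending to 0. *)
Definition completion_ip (f g : T -> R) : R :=
  match pselect (exists p, approximates p f),
        pselect (exists q, approximates q g) with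
  | left hf, left hg =>
      limn (fun m => ip (projT1 (cid hf) m) (projT1 (cid hg) m))
  | _, _ => 0
  end.

(** The Hilbert completion of [H], realized as a space of functions on [D]: the
    class of a Cauchy sequence is identified with its uniform limit on [D]. *)
Definition completion : prehilbert R T := {|
  rep := T -> R;
  dom := [set f | exists p, approximates p f];
  ev := id;
  ip := completion_ip
|}.

End Completion.

Definition hnorm (R : realType) (T : Type) (H : prehilbert R T) (u : rep H) : R :=
  Num.sqrt (ip u u).

Definition cube (R : realType) (d : nat) : set 'rV[R]_d :=
  [set x | forall j, 0 <= x ord0 j <= 1].

Definition tensor_sum (R : realType) (d : nat) (H : 'I_d -> prehilbert R R) :=
  {N : nat & 'I_N -> forall j, rep (H j)}.

(** The algebraic tensor product: [existT _ N u] stands for the sum over [k < N]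
    of the pure tensors [u k 1 (x) ... (x) u k d]. *)
Definition alg_tensor (R : realType) (d : nat) (H : 'I_d -> prehilbert R R) :
    prehilbert R 'rV[R]_d := {|
  rep := tensor_sum H;
  dom := [set s : tensor_sum H | forall k j, dom (tagged s k j)];
  ev := fun s (x : 'rV[R]_d) =>
    \sum_(k < tag s) \prod_(j < d) ev (tagged s k j) (x ord0 j);
  ip := fun s t =>
    \sum_(k < tag s) \sum_(l < tag t)
      \prod_(j < d) ip (tagged s k j) (tagged t l j)
|}.

Definition hilbert_tensor (R : realType) (d : nat) (H : 'I_d -> prehilbert R R) :
    prehilbert R 'rV[R]_d :=
  completion (cube (R := R) (d := d)) (alg_tensor H).

(** * Fractional Sobolev spaces *)

Section Sobolev.
Variable R : realType.
Implicit Types (f g phi : R -> R) (a gamma x y t : R).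

Local Notation mu := (@lebesgue_measure R).

Definition cosine (k : nat) : R -> R :=
  fun x => if k is 0%N then 1 else Num.sqrt 2 * cos (k%:R * pi * x).

Definition cosine_span : set (R -> R) :=
  [set f : R -> R | exists (N : nat) (c : nat -> R),
     f = fun x => \sum_(k < N) c k * cosine k x].

Definition int01 f : R := \int[mu]_(x in `[0, 1]) f x.

Definition sob_ip_lt1 a gamma f g : R :=
  int01 f * int01 g +
  (gamma ^+ 2)^-1 * ((1 - a) * pi ^+ 3 / 8) *
  int01 (fun x => int01 (fun y =>
    (f x - f y) * (g x - g y) *
    ((`|sin (pi * (x - y) / 2)| `^ (2 * a + 1))^-1 +
     (`|sin (pi * (x + y) / 2)| `^ (2 * a + 1))^-1))).

Definition sob_B a f g : R :=
  ((a - 1) * (2 - a) * pi ^+ 3 / 8) *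
  int01 (fun x => int01 (fun y =>
    (f x - f y) * (g x - g y) / `|sin (pi * (x - y) / 2)| `^ (2 * a - 1) +
    (f x + f y) * (g x + g y) / `|sin (pi * (x + y) / 2)| `^ (2 * a - 1))).

Definition sob_ip_gt1 a gamma f g : R :=
  int01 f * int01 g +
  (gamma ^+ 2)^-1 *
  (int01 (fun x => derive1 f x * derive1 g x) + sob_B a (derive1 f) (derive1 g)).

Definition test_function phi : Prop :=
  (forall (n : nat) x, derivable (derive1n n phi) x 1) /\
  exists b c : R, [/\ 0 < b, c < 1 & forall x, phi x != 0 -> b <= x <= c].

Definition square_integrable01 g : Prop :=
  measurable_fun (`[0, 1] : set R) g /\
  mu.-integrable (`[0, 1] : set R) (fun x => (g x ^+ 2)%:E).

Definition L2_weak_derivative f g : Prop :=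
  square_integrable01 g /\
  forall phi, test_function phi ->
    int01 (fun x => f x * derive1 phi x) = - int01 (fun x => g x * phi x).

Definition weak_derive f : R -> R := xget (fun=> 0) [set g : R -> R | L2_weak_derivative f g].

(* Elements are represented by their continuous versions, as point evaluations
   are needed. *)
Definition sob_H1 gamma : prehilbert R R := {|
  rep := R -> R;
  dom := [set f : R -> R | {within `[0, 1], continuous f} /\
                  exists g, L2_weak_derivative f g];
  ev := id;
  ip := fun f g => int01 f * int01 g +
    (gamma ^+ 2)^-1 * int01 (fun x => weak_derive f x * weak_derive g x)
|}.

Definition sob_span a gamma : prehilbert R R := {|
  rep := R -> R;
  dom := cosine_span;
  ev := id;
  ip := if a < 1 then sob_ip_lt1 a gamma else sob_ip_gt1 a gamma
|}.

Definition sob1 a gamma : prehilbert R R :=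
  if a == 1 then sob_H1 gamma
  else completion (`[0, 1] : set R) (sob_span a gamma).

Definition sob a (d : nat) (gamma : 'I_d -> R) : prehilbert R 'rV[R]_d :=
  hilbert_tensor (fun j => sob1 a (gamma j)).

(** * Constants and special functions *)

Definition kappa_lt1 a : R :=
  2 * (1 - a) * pi `^ (2 - 2 * a) *
  \int[mu]_(t in `[0, 1/2]) (sin (pi * t) ^+ 2 / t `^ (2 * a + 1)).

Definition kappa_gt1 a : R :=
  2 * (a - 1) * (2 - a) * pi `^ (6 - 2 * a) *
  \int[mu]_(t in `[0, 1/2]) (sin (pi * t) ^+ 2 / t `^ (2 * a - 1)).

Definition kappa a : R :=
  if a < 1 then kappa_lt1 a else if a == 1 then pi ^+ 2 else kappa_gt1 a.

Definition rescaled_weight a gamma : R := kappa a `^ (- (1 / 2)) * gamma.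

(* for real [s > 1] *)
Definition zeta (s : R) : R := limn (series (fun k : nat => (k.+1%:R `^ s)^-1)).

Definition fracpart x : R := x - (Num.floor x)%:~R.

(* [|k|^-b * exp (2 pi i k x)] *)
Definition omega_term (b x : R) (k : int) : R[i] :=
  (`|k%:~R| `^ (- b))%:C%C *
  (cos (2 * pi * k%:~R * x) +i* sin (2 * pi * k%:~R * x))%C.

(* The sum over nonzero integers, taken along [|k| <= N]; these partial sums
   have zero imaginary part. *)
Definition omega (b x : R) : R :=
  limn (fun N : nat => complex.Re
    (\sum_(1 <= k < N.+1) (omega_term b x k%:Z + omega_term b x (- k%:Z)))).

(** * Quadrature *)

(* Iterated integral over the unit cube, which for continuous integrands is the
   Lebesgue integral by Fubini's theorem. *)
Fixpoint cube_int (d : nat) : ('rV[R]_d -> R) -> R :=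
  match d return ('rV[R]_d -> R) -> R with
  | 0%N => fun F => F 0
  | d'.+1 => fun F => int01 (fun t =>
      cube_int (fun x : 'rV[R]_d' => F (row_mx (const_mx t : 'rV_1) x)))
  end.

Definition quadrature (d n : nat) (x : nat -> 'rV[R]_d) (f : 'rV[R]_d -> R) : R :=
  n%:R^-1 * \sum_(0 <= i < n) f (x i).

Definition wce (d : nat) (H : prehilbert R 'rV[R]_d) (n : nat)
    (x : nat -> 'rV[R]_d) : \bar R :=
  ereal_sup [set (`|cube_int (ev u) - quadrature n x (ev u)|)%:E |
             u in [set u : rep H | dom u /\ hnorm u <= 1]].

Definition tent x : R := 1 - `|2 * x - 1|.

Definition tent_lattice (d n : nat) (z : 'I_d -> nat) (i : nat) : 'rV[R]_d :=
  \row_j tent (fracpart ((i * z j)%:R / n%:R)).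

(** * Component-by-component construction *)

Section CBC.
Variables (d n : nat) (a : R) (Gamma : 'I_d -> R).

(* The criterion for the first [s] components of [v]. *)
Definition cbc_E2 (s : nat) (v : 'I_d -> nat) : R :=
  - 1 + n%:R^-1 * \sum_(0 <= i < n) \prod_(j < d | (j < s)%N)
    (1 + Gamma j ^+ 2 * omega (2 * a) (fracpart ((i * v j)%:R / n%:R))).

(* Indices start at 0: component [j] is chosen in step [j.+1]. *)
Definition cbc_vector (z : 'I_d -> nat) : Prop :=
  forall j : 'I_d,
    (0 < z j < n)%N /\
    if j == 0%N :> nat then z j = 1%N
    else forall c : nat, (0 < c < n)%N ->
           cbc_E2 j.+1 z <= cbc_E2 j.+1 [eta z with j |-> c].

End CBC.

End Sobolev.

(* Main.v *)
(** Each of the univariate Sobolev inner products exceeds, in the sense of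
    positive semidefinite kernels, every partial sum of the cosine series with the
    rescaled weights: for [alpha != 1] the cosines diagonalize the seminorm and
    the eigenvalues are moments of the singular kernel, bounded below by kappa;
    for [alpha = 1] this is Bessel's inequality for the weak derivative tested
    against sines.  Uniform limits and, by Schur's product theorem, tensor
    products preserve this domination.  Since Fejer means of a continuous function
    converge pointwise, the error functional is a limit of its values on cosine
    polynomials, and Cauchy-Schwarz in the dominated form bounds its square by the
    sum, over the nonzero frequency vectors, of the squared quadrature values of
    the products of cosines divided by the weights.  The tent transform turns the
    frequency k pi into 2 k pi, so that, up to a factor sqrt 2 per nonzero
    frequency, such a quadrature value is a mean of a product of cosines over a
    lattice; it lies in [0, 1], its square is at most itself, and what remains is
    the CBC criterion.

    The criterion to the power [1 / (2 lambda)] is bounded by induction on the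
    number of components: the minimum over the candidates is at most their
    average, and subadditivity of the concave power together with averaging over
    the nonzero residues modulo the prime [n] gives the factor
    [1 + 2 Gamma^(1/lambda) zeta(alpha/lambda)]. *)

Require Import Defs.
From mathcomp Require Import all_boot all_order all_algebra.
From mathcomp Require Import complex.
From mathcomp Require Import all_classical all_reals all_analysis.
From mathcomp Require Import measurable_realfun.
From mathcomp Require Import ring lra.

Set Implicit Arguments.
Unset Strict Implicit.
Unset Printing Implicit Defensive.

Import Order.TTheory GRing.Theory Num.Theory.
Import numFieldNormedType.Exports.

Local Open Scope classical_set_scope.
Local Open Scope ring_scope.

(** * Positive semidefinite kernels *)

Section PositiveKernels.
Variable R : realType.

(** The record [prehilbert] carries no laws and no addition on its representatives, so
    Cauchy-Schwarz, Bessel's inequality and limits of norms are stated for finite quadratic forms,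
    that is, for positive semidefinite kernels on a bare type. Such inequalities involve finitely
    many points and survive the limits in [completion_ip]. Bounding the error from above only takes
    a lower bound on the inner products. For alpha other than 1 the constant kappa is what remains
    when the singular kernel is bounded below by a power and its moment at frequency k is restricted
    to [0, 1/k]: for every k this scales to the same integral over [0, 1/2]. In the CBC part the
    exponent q = 1/(2 lambda) turns the two conditions on lambda into q <= 1, for subadditivity, and
    2 alpha q > 1, for the zeta sum. The induction carries the sum of q-th powers of all Fourier
    coefficients of the partial product, because the increment of the criterion samples coefficients
    at nonzero residues. This is done with omega cut at N, uniformly in N, so that all sums are
    finite. *)

Definition psd (T : Type) (P : set T) (K : T -> T -> R) : Prop :=
  (forall x y, P x -> P y -> K x y = K y x) /\
  forall (n : nat) (x : 'I_n -> T) (t : 'I_n -> R), (forall i, P (x i)) ->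
    0 <= \sum_i \sum_j t i * t j * K (x i) (x j).

Section Kernel.
Variables (T : Type) (P : set T).
Implicit Types K : T -> T -> R.

Lemma psd_fin K (I : finType) (x : I -> T) (t : I -> R) :
  psd P K -> (forall i, P (x i)) ->
  0 <= \sum_i \sum_j t i * t j * K (x i) (x j).
Proof.
move=> [_ psdK] Px.
have := psdK _ (fun i : 'I_#|I| => x (enum_val i)) (fun i => t (enum_val i))
          (fun i => Px _).
congr (_ <= _); rewrite [RHS](reindex (enum_val : 'I_#|I| -> I)) /=; last exact/onW_bij/enum_val_bij.
apply: eq_bigr => i _.
by rewrite [RHS](reindex (enum_val : 'I_#|I| -> I)) //=; exact/onW_bij/enum_val_bij.
Qed.

Lemma psd_pair K x y (a b : R) : psd P K -> P x -> P y ->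
  0 <= a ^+ 2 * K x x + 2 * a * b * K x y + b ^+ 2 * K y y.
Proof.
move=> psdK Px Py.
have /= := @psd_fin K bool (fun c => if c then x else y)
  (fun c => if c then a else b) psdK (fun c => if c return P (if c then x else y) then Px else Py).
rewrite !big_bool /= (psdK.1 y x) //; congr (_ <= _); ring.
Qed.

Lemma psd_ge0 K x : psd P K -> P x -> 0 <= K x x.
Proof.
move=> psdK Px; have := psd_pair 1 0 psdK Px Px.
by congr (_ <= _); ring.
Qed.

Lemma psd_cauchy_schwarz K x y : psd P K -> P x -> P y ->
  K x y ^+ 2 <= K x x * K y y.
Proof.
move=> psdK Px Py.
have x0 := psd_ge0 psdK Px; have y0 := psd_ge0 psdK Py.
move: x0; rewrite le_eqVlt => /orP[/eqP x0|x0].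
  (* With [K x x = 0] the form at these weights equals [- (K y y + 2) * K x y ^+ 2], so [K x y] must
     vanish. *)
  have := psd_pair (- (K y y + 1)) (K x y) psdK Px Py; rewrite -x0 => h.
  have : 0 <= - (K y y + 2) * K x y ^+ 2 by apply: le_trans h _; nra.
  by rewrite mul0r mulNr oppr_ge0 pmulr_rle0// ltr_wpDl.
have := psd_pair (- K x y) (K x x) psdK Px Py.
rewrite (_ : _ + _ = K x x * (K x x * K y y - K x y ^+ 2)); last ring.
by rewrite pmulr_rge0// subr_ge0.
Qed.

(** A Schur complement: its form is that of [K] minimized over the coefficient of an extra point
    [x], the minimizer being [- b / K x x]. If [K x x = 0] nothing is subtracted, since division by
    0 gives 0. *)
Lemma psd_pivot K x : psd P K -> P x ->
  psd P (fun y z => K y z - K x y * K x z / K x x).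
Proof.
move=> psdK Px; split=> [y z Py Pz|n y t Py].
  by rewrite (psdK.1 y z)// (mulrC (K x y)).
set b := \sum_i t i * K x (y i).
have -> : \sum_i \sum_j t i * t j * (K (y i) (y j) - K x (y i) * K x (y j) / K x x) =
   \sum_i \sum_j t i * t j * K (y i) (y j) - b ^+ 2 / K x x.
  rewrite expr2 {1}/b !mulr_suml -sumrB; apply: eq_bigr => i _.
  rewrite /b mulr_sumr mulr_suml -sumrB; apply: eq_bigr => j _; ring.
have [x0|x0] := eqVneq (K x x) 0.
  by rewrite x0 invr0 mulr0 subr0; exact: psdK.2.
pose w (i : 'I_1 + 'I_n) := if i is inr i then y i else x.
pose v (i : 'I_1 + 'I_n) := if i is inr i then t i else - b / K x x.
have Pw i : P (w i) by case: i.
have := psd_fin v psdK Pw.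
rewrite big_sumType /= big_ord1 big_sumType /= big_ord1 /=.
have -> : \sum_(i < n) - b / K x x * t i * K x (y i) = - b ^+ 2 / K x x.
  under eq_bigr do rewrite -mulrA; rewrite -mulr_sumr -/b; ring.
under [X in _ <= _ + X]eq_bigr do rewrite big_sumType /= big_ord1 (psdK.1 _ x)//=.
rewrite big_split /=.
have -> : \sum_(i < n) t i * (- b / K x x) * K x (y i) = - b ^+ 2 / K x x.
  under eq_bigr do rewrite [X in X * _]mulrC -mulrA.
  rewrite -mulr_sumr -/b; ring.
move=> h; apply: le_trans h _; rewrite le_eqVlt; apply/orP; left; apply/eqP.
by field.
Qed.

(* Schur product theorem, by elimination of one point at a time *)
Lemma psd_mul K L : psd P K -> psd P L -> psd P (fun x y => K x y * L x y).
Proof.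
move=> psdK psdL; split=> [x y Px Py|n].
  by rewrite (psdK.1 x)// (psdL.1 x).
elim: n K psdK => [|n IH] K psdK x t Px; first by rewrite big_ord0.
set x0 := x ord0; have Px0 : P x0 := Px ord0.
have psdK' := psd_pivot psdK Px0.
set K' := (fun y z => _) in psdK'.
(* The pivoted kernel vanishes on the row of [x0]; when [K x0 x0 = 0] this is because Cauchy-Schwarz
   already annihilates that row of [K]. *)
have K'0 y : P y -> K' x0 y = 0.
  move=> Py; rewrite /K'; have [h|h] := eqVneq (K x0 x0) 0.
    have := psd_cauchy_schwarz psdK Px0 Py.
    by rewrite h mul0r le_eqVlt ltNge sqr_ge0 orbF sqrf_eq0 => /eqP ->; rewrite !mul0r subr0.
  by field.
(* [K] is a rank-one kernel plus [K']. The rank-one part merely rescales the coefficients in the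
   form of [L]; the rest lives on the other [n] points. *)
have -> : \sum_i \sum_j t i * t j * (K (x i) (x j) * L (x i) (x j)) =
  (K x0 x0)^-1 * (\sum_i \sum_j (t i * K x0 (x i)) * (t j * K x0 (x j)) * L (x i) (x j)) +
  \sum_i \sum_j t i * t j * (K' (x i) (x j) * L (x i) (x j)).
  rewrite mulr_sumr -big_split; apply: eq_bigr => i _ /=.
  rewrite mulr_sumr -big_split; apply: eq_bigr => j _ /=; rewrite /K'; ring.
apply: addr_ge0.
  by rewrite mulr_ge0 ?invr_ge0 ?(psd_ge0 psdK)//; apply: psdL.2.
rewrite big_ord_recl big1 => [|j _]; last by rewrite K'0// mul0r mulr0.
rewrite add0r.
under eq_bigr => i _ do rewrite big_ord_recl (psdK'.1 _ x0)// K'0// mul0r mulr0 add0r.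
exact: IH psdK' (fun i => x (lift ord0 i)) (fun i => t (lift ord0 i)) (fun i => Px _).
Qed.

Lemma psd_add K L : psd P K -> psd P L -> psd P (fun x y => K x y + L x y).
Proof.
move=> psdK psdL; split=> [x y Px Py|n x t Px].
  by rewrite (psdK.1 x)// (psdL.1 x).
have := addr_ge0 (psdK.2 n x t Px) (psdL.2 n x t Px).
rewrite -big_split; under eq_bigr do rewrite -big_split.
by congr (_ <= _); do 2 apply: eq_bigr => ? _; rewrite mulrDr.
Qed.

Lemma psd_eq K L : (forall x y, P x -> P y -> K x y = L x y) -> psd P K -> psd P L.
Proof.
move=> KL psdK; split=> [x y Px Py|n x t Px]; first by rewrite -!KL//; exact: psdK.1.
have := psdK.2 n x t Px; congr (_ <= _).
by do 2 (apply: eq_bigr => ? _); rewrite KL.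
Qed.

Lemma psd_rank1 (c : R) (v : T -> R) : 0 <= c -> psd P (fun x y => c * (v x * v y)).
Proof.
move=> c0; split=> [x y _ _|n x t _]; first by rewrite (mulrC (v x)).
rewrite (_ : \sum_i _ = c * (\sum_i t i * v (x i)) ^+ 2).
  by rewrite mulr_ge0// sqr_ge0.
rewrite expr2 mulr_suml mulr_sumr; apply: eq_bigr => i _.
by rewrite mulr_sumr mulr_sumr; apply: eq_bigr => j _; ring.
Qed.

Lemma psd0 : psd P (fun _ _ => 0).
Proof. by split=> // n x t _; rewrite big1// => i _; rewrite big1// => j _; rewrite mulr0. Qed.

Lemma psd_sum (I : Type) (r : seq I) (K : I -> T -> T -> R) :
  (forall i, psd P (K i)) -> psd P (fun x y => \sum_(i <- r) K i x y).
Proof.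
move=> psdK; elim: r => [|i r IH].
  by apply: psd_eq psd0 => x y _ _; rewrite big_nil.
by apply: psd_eq (psd_add (psdK i) IH) => x y _ _; rewrite big_cons.
Qed.

(* [s] stands for the formal combination of the points [x s k] with coefficients [c s k]. *)
Lemma psd_combinations K (S : Type) (Q : set S) (m : S -> nat)
    (x : forall s, 'I_(m s) -> T) (c : forall s, 'I_(m s) -> R) :
  psd P K -> (forall s, Q s -> forall k, P (x s k)) ->
  psd Q (fun s t => \sum_k \sum_l c s k * c t l * K (x s k) (x t l)).
Proof.
move=> psdK QP; split=> [s t Qs Qt|n s t Qs].
  rewrite exchange_big /=; apply: eq_bigr => k _; apply: eq_bigr => l _.
  by rewrite (psdK.1 (x s l)) ?(mulrC (c t k))//; exact: QP.
have := @psd_fin K {i : 'I_n & 'I_(m (s i))} (fun u => x _ (tagged u))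
  (fun u => t (tag u) * c _ (tagged u)) psdK (fun u => QP _ (Qs _) _).
rewrite (_ : \sum_i _ = \sum_(i < n) \sum_(j < n) t i * t j *
   \sum_k \sum_l c (s i) k * c (s j) l * K (x (s i) k) (x (s j) l))//.
rewrite [RHS](eq_bigr (fun i => \sum_k \sum_j \sum_l t i * t j *
    (c (s i) k * c (s j) l * K (x (s i) k) (x (s j) l)))); last first.
  move=> i _; rewrite exchange_big /=; apply: eq_bigr => j _.
  by rewrite mulr_sumr; apply: eq_bigr => k _; rewrite mulr_sumr.
rewrite [RHS](sig_big_dep (fun=> true) (fun _ _ => true)) /=; apply: eq_bigr => u _.
rewrite [RHS](sig_big_dep (fun=> true) (fun _ _ => true)) /=; apply: eq_bigr => v _.
by ring.
Qed.

End Kernel.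

Lemma psd_comp (S T : Type) (P : set T) (Q : set S) (f : S -> T) (K : T -> T -> R) :
  (forall s, Q s -> P (f s)) -> psd P K -> psd Q (fun s t => K (f s) (f t)).
Proof.
move=> QP psdK; split=> [s t Qs Qt|n s t Qs]; first by apply: psdK.1; exact: QP.
by apply: psdK.2 => i; exact: QP.
Qed.

Lemma psd_prod (T : Type) (P : set T) (I : Type) (r : seq I) (K : I -> T -> T -> R) :
  (forall i, psd P (K i)) -> psd P (fun x y => \prod_(i <- r) K i x y).
Proof.
move=> psdK; elim: r => [|i r IH].
  by apply: psd_eq (psd_rank1 P (fun=> 1) ler01) => x y _ _; rewrite big_nil !mulr1.
by apply: psd_eq (psd_mul (psdK i) IH) => x y _ _; rewrite big_cons.
Qed.

(** Telescoping: with A and B the products of [K] and [L] over the remaining indices, [K i] A -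
    [L i] B = ([K i] - [L i]) A + [L i] (A - B), a sum of products of positive semidefinite
    kernels. *)
Lemma psd_prod_sub (T : Type) (P : set T) (I : Type) (r : seq I) (K L : I -> T -> T -> R) :
  (forall i, psd P (L i)) -> (forall i, psd P (fun x y => K i x y - L i x y)) ->
  psd P (fun x y => \prod_(i <- r) K i x y - \prod_(i <- r) L i x y).
Proof.
move=> psdL psdKL.
have psdK i : psd P (K i).
  by apply: psd_eq (psd_add (psdL i) (psdKL i)) => x y _ _; ring.
elim: r => [|i r IH].
  by apply: psd_eq (psd0 P) => x y _ _; rewrite !big_nil subrr.
have := psd_add (psd_mul (psdKL i) (psd_prod r psdK)) (psd_mul (psdL i) IH).
by apply: psd_eq => x y _ _; rewrite !big_cons; ring.
Qed.

(** * Inner products along Cauchy sequences *)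

Section CauchySequences.
Variables (T : Type) (P : set T) (K : T -> T -> R).
Hypothesis psdK : psd P K.
Implicit Types p q : nat -> T.

(** Same expressions as [dist2] and [cauchy_reps], for an arbitrary kernel; they are convertible
    when the kernel is [ip]. *)
Definition sqdist x y : R := K x x - 2 * K x y + K y y.

Definition sqdist_cauchy p : Prop :=
  forall e : R, 0 < e -> exists N : nat, forall m l : nat,
    (N <= m)%N -> (N <= l)%N -> sqdist (p m) (p l) < e.

(* Cauchy-Schwarz for the formal difference [x - y] and [z] *)
Lemma psd_diff_cauchy_schwarz x y z : P x -> P y -> P z ->
  (K x z - K y z) ^+ 2 <= sqdist x y * K z z.
Proof.
move=> Px Py Pz.
pose Q : set (T * T * R) := [set u | P u.1.1 /\ P u.1.2].
pose w (u : T * T * R) (k : 'I_2) := if k == ord0 then u.1.1 else u.1.2.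
have Qw u : Q u -> forall k, P (w u k) by case=> ? ? k; rewrite /w; case: ifP.
have h := psd_combinations (fun u k => if k == ord0 then 1 else u.2) psdK Qw.
have := psd_cauchy_schwarz (x := (x, y, -1)) (y := (z, z, 0)) h
  (conj Px Py) (conj Pz Pz).
rewrite !big_ord_recl !big_ord0 /= !addr0 (psdK.1 y x Py Px) /sqdist.
by congr (_ <= _); ring.
Qed.

Lemma sqdist_ge0 x y : P x -> P y -> 0 <= sqdist x y.
Proof.
move=> Px Py; have := psd_pair 1 (-1) psdK Px Py.
by rewrite /sqdist; congr (_ <= _); ring.
Qed.

(** The inequality |p_m|^2 <= 2 |p_N|^2 + 2 |p_m - p_N|^2 is positivity at the formal vector p_m - 2
    p_N. *)
Lemma sqdist_cauchy_bounded p : (forall m, P (p m)) -> sqdist_cauchy p ->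
  exists B : R, exists N, forall m, (N <= m)%N -> K (p m) (p m) <= B.
Proof.
move=> Pp /(_ 1 ltr01)[N pN]; exists (2 * K (p N) (p N) + 2), N => m Nm.
have := pN m N Nm (leqnn N); have := psd_pair 1 (-2) psdK (Pp m) (Pp N).
rewrite /sqdist; lra.
Qed.

(** Guarantees that the [limn] in [completion_ip] is an actual limit. The arguments are varied one
    at a time, each variation being controlled by [psd_diff_cauchy_schwarz] and the bound on the
    norms. *)
Lemma cvg_kernel p q : (forall m, P (p m)) -> (forall m, P (q m)) ->
  sqdist_cauchy p -> sqdist_cauchy q -> cvgn (fun m => K (p m) (q m)).
Proof.
move=> Pp Pq Cp Cq.
have [B [N pB]] := sqdist_cauchy_bounded Pp Cp.
have [C [M qC]] := sqdist_cauchy_bounded Pq Cq.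
apply/cauchy_cvgP/cauchy_exP => e e0.
pose D := Num.max (Num.max B C) 1.
have D0 : 0 < D by rewrite lt_max ltr01 orbT.
have e2 : 0 < e / 2 by rewrite divr_gt0.
have d0 : 0 < (e / 2) ^+ 2 / D / 2 by rewrite !divr_gt0 ?exprn_gt0.
have [N1 pN1] := Cp _ d0; have [N2 qN2] := Cq _ d0.
pose l := maxn (maxn N M) (maxn N1 N2).
exists (K (p l) (q l)); exists l => //= m lm; rewrite /ball /= distrC.
have big k : (l <= k)%N -> [/\ N <= k, M <= k, N1 <= k & N2 <= k]%N.
  by rewrite !geq_max => /andP[/andP[? ?] /andP[? ?]].
have [Nm Mm N1m N2m] := big m lm; have [Nl Ml N1l N2l] := big l (leqnn l).
rewrite (_ : _ - _ = (K (p m) (q m) - K (p l) (q m)) + (K (q m) (p l) - K (q l) (p l))); last first.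
  by rewrite (psdK.1 (q m)) ?(psdK.1 (q l)) //; ring.
rewrite (le_lt_trans (ler_normD _ _))// [ltRHS](splitr e).
have sm (w v E : R) : 0 <= v -> v < (e / 2) ^+ 2 / D / 2 -> E <= D -> w ^+ 2 <= v * E -> `|w| < e / 2.
  move=> v0 vlt ED wvE; rewrite -(ltr_pXn2r (n := 2)) ?nnegrE ?(ltW e2)// real_normK ?num_real//.
  apply: (le_lt_trans wvE); apply: (le_lt_trans (ler_wpM2l v0 ED)).
  rewrite -ltr_pdivlMr//; apply: (lt_trans vlt); rewrite ltr_pdivrMr//.
  by rewrite ltr_pMr ?ltr1n// divr_gt0 ?exprn_gt0.
apply: ltrD.
- apply: (sm _ _ _ (sqdist_ge0 (Pp m) (Pp l)) (pN1 m l N1m N1l) _ (psd_diff_cauchy_schwarz (Pp m) (Pp l) (Pq m))).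
  by rewrite !le_max (qC m)// orbT.
- apply: (sm _ _ _ (sqdist_ge0 (Pq m) (Pq l)) (qN2 m l N2m N2l) _ (psd_diff_cauchy_schwarz (Pq m) (Pq l) (Pp l))).
  by rewrite !le_max (pB l)// orbT.
Qed.

End CauchySequences.

End PositiveKernels.

(** * Subadditivity of concave powers and the zeta function *)

Section PowersAndZeta.
Variable R : realType.
Implicit Types (x y p q : R) (N : nat).

(** With s = x + y, concavity enters only as u <= u^q on [0, 1], at u = x/s and u = y/s; multiplying
    by s^q and adding gives the claim. *)
Lemma powR_subadd x y q : 0 <= x -> 0 <= y -> 0 < q <= 1 ->
  (x + y) `^ q <= x `^ q + y `^ q.
Proof.
move=> x0 y0 /andP[q0 q1].
have [s0|s0] := eqVneq (x + y) 0.
  by rewrite s0 powR0 ?gt_eqF// addr_ge0 ?powR_ge0.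
have sp : 0 < x + y by rewrite lt_def s0 addr_ge0.
have le_pow u : 0 <= u <= x + y -> u / (x + y) * (x + y) `^ q <= u `^ q.
  move=> /andP[u0 us].
  rewrite -[in leRHS](@divfK _ (x + y) s0 u) powRM ?(ltW sp) ?divr_ge0 ?(ltW sp)//.
  rewrite ler_wpM2r ?powR_ge0//.
  move: u0; rewrite le_eqVlt => /orP[/eqP<-|u0]; first by rewrite mul0r powR_ge0.
  by rewrite ger1_powR// divr_gt0//= ler_pdivrMr ?mul1r.
rewrite -[leLHS]mul1r -(@divff _ (x + y) s0) [X in X * _]mulrDl mulrDl.
by rewrite lerD// le_pow// ?x0 ?y0 /= ?lerDl ?lerDr.
Qed.

Lemma powR_sum_subadd (I : Type) (r : seq I) (P : pred I) (F : I -> R) q :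
  (forall i, P i -> 0 <= F i) -> 0 < q <= 1 ->
  (\sum_(i <- r | P i) F i) `^ q <= \sum_(i <- r | P i) F i `^ q.
Proof.
move=> F0 /andP[q0 q1].
suff [] : 0 <= \sum_(i <- r | P i) F i /\
  (\sum_(i <- r | P i) F i) `^ q <= \sum_(i <- r | P i) F i `^ q by [].
elim/big_rec2: _ => [|i y s Pi [s0 IH]]; first by rewrite powR0 ?gt_eqF.
split; first by rewrite addr_ge0// F0.
by rewrite (le_trans (powR_subadd _ _ _))// ?F0 ?q0// lerD2l.
Qed.

Definition zeta_sum N p : R := \sum_(1 <= k < N.+1) k%:R `^ (- p).

Lemma zeta_sum_ge0 N p : 0 <= zeta_sum N p.
Proof. by apply: sumr_ge0 => k _; exact: powR_ge0. Qed.

Lemma zeta_sumE p N : series (fun k : nat => (k.+1%:R `^ p)^-1) N = zeta_sum N p.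
Proof.
by rewrite /series /zeta_sum /= big_add1 /=; apply: eq_bigr => k _; rewrite powRN.
Qed.

Lemma nondecreasing_zeta_sum p : {homo zeta_sum^~ p : M N / (M <= N)%N >-> M <= N}.
Proof.
move=> M N MN; rewrite /zeta_sum (big_cat_nat (n := M.+1) (p := N.+1))//=.
by rewrite lerDl sumr_ge0// => k _; exact: powR_ge0.
Qed.

(** Condensation: the term at 2k is 2^(-p) times the term at k, and the term at 2k + 1 is at most
    the one at 2k. As the sum up to N is at most the sum up to 2N + 1, this bounds the sums once 2 *
    2^(-p) < 1. *)
Lemma zeta_sum_double N p : 0 <= p ->
  zeta_sum N.*2.+1 p <= 1 + 2 * 2 `^ (- p) * zeta_sum N p.
Proof.
move=> p0; elim: N => [|N IH].
  by rewrite /zeta_sum/= big_nat1 big_geq// powR1 mulr0 addr0.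
rewrite /zeta_sum doubleS big_nat_recr //= big_nat_recr //=.
rewrite [in leRHS]big_nat_recr //= mulrDr addrA.
have -> : (1 + 2 * 2 `^ (- p) * \sum_(1 <= i < N.+1) i%:R `^ (- p) + 2 * 2 `^ (- p) * N.+1%:R `^ (- p)) =
  1 + 2 * 2 `^ (- p) * \sum_(1 <= i < N.+1) i%:R `^ (- p) + 2 `^ (- p) * N.+1%:R `^ (- p) + 2 `^ (- p) * N.+1%:R `^ (- p).
  by ring.
have pow2 : 2 `^ (- p) * N.+1%:R `^ (- p) = (N.*2.+2)%:R `^ (- p).
  by rewrite -powRM// -natrM mul2n.
rewrite pow2 lerD// ?lerD//.
by rewrite !powRN lef_pV2 ?posrE ?powR_gt0// ge0_ler_powR// ?nnegrE// ler_nat.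
Qed.

Lemma zeta_sum_bounded p N : 1 < p -> zeta_sum N p <= (1 - 2 * 2 `^ (- p))^-1.
Proof.
move=> p1; have p0 : 0 <= p by lra.
have c1 : 2 * 2 `^ (- p) < 1 :> R.
  rewrite -[X in X * _](@powRr1 R 2)// -powRD ?pnatr_eq0 ?implybT//.
  rewrite -[ltRHS](powRr0 2) /powR pnatr_eq0 /= ltr_expR ltr_pM2r ?ln_gt0 ?ltr1n//; lra.
have c0 : 0 < 1 - 2 * 2 `^ (- p) :> R by rewrite subr_gt0.
rewrite -[leRHS]mul1r ler_pdivlMr// mulrBr mulr1 lerBlDr.
have MN : (N <= N.*2.+1)%N by rewrite -addnn -addSn leq_addl.
apply: (le_trans (nondecreasing_zeta_sum p MN)).
by rewrite (mulrC (zeta_sum _ _)); exact: zeta_sum_double.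
Qed.

Lemma cvg_zeta_sum p : 1 < p -> zeta_sum N p @[N --> \oo] --> zeta p.
Proof.
move=> p1; rewrite /zeta (_ : (fun k => _) = series (fun k : nat => (k.+1%:R `^ p)^-1)); last first.
  by apply/funext => N; rewrite zeta_sumE.
apply: (nondecreasing_is_cvgn _ _).
  by move=> M N MN; rewrite !zeta_sumE; exact: nondecreasing_zeta_sum.
exists (1 - 2 * 2 `^ (- p))^-1 => _ [N _ <-].
by rewrite zeta_sumE; exact: zeta_sum_bounded.
Qed.

Lemma zeta_sum_le_zeta N p : 1 < p -> zeta_sum N p <= zeta p.
Proof.
move=> p1; rewrite -(cvg_lim _ (cvg_zeta_sum p1))//.
apply: nondecreasing_cvgn_le; first exact: nondecreasing_zeta_sum.
by apply/cvg_ex; exists (zeta p); exact: cvg_zeta_sum.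
Qed.

Lemma zeta_ge0 p : 1 < p -> 0 <= zeta p.
Proof. by move=> p1; exact: le_trans (zeta_sum_ge0 0 p) (zeta_sum_le_zeta 0 p1). Qed.

(** A multiple k = n m contributes n^(-p) m^(-p), and n^(-p) <= 1/n. This gain pays for the
    frequencies divisible by [n] when the increments are averaged over the candidates. *)
Lemma zeta_sum_dvdn (n N : nat) p : (0 < n)%N -> 1 <= p ->
  \sum_(1 <= k < N.+1 | (n %| k)%N) k%:R `^ (- p) <= zeta_sum N p / n%:R.
Proof.
move=> n0 p1.
have step k : (0 < k)%N -> (n %| k)%N -> k%:R `^ (- p) <= (k %/ n)%:R `^ (- p) / n%:R.
  move=> k0 /divnK{1}<-; rewrite natrM powRM// ler_wpM2l ?powR_ge0//.
  rewrite -[leRHS](powR_inv1 (ler0n R n)).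
  by rewrite ler_powR ?ler1n// lerN2.
apply: (@le_trans _ _ (\sum_(1 <= k < N.+1 | (n %| k)%N) (k %/ n)%:R `^ (- p) / n%:R)).
  rewrite big_nat_cond [leRHS]big_nat_cond ler_sum// => k /andP[/andP[k0 _] nk].
  exact: step.
rewrite -mulr_suml ler_wpM2r ?invr_ge0// /zeta_sum.
apply: (@le_trans _ _ (\sum_(1 <= m < (N %/ n).+1) m%:R `^ (- p))); last first.
  rewrite (big_cat_nat (n := (N %/ n).+1) (p := N.+1))//=; last by rewrite ltnS leq_div.
  by rewrite lerDl sumr_ge0// => k _; exact: powR_ge0.
elim: N => [|N IH]; first by rewrite div0n !big_geq.
rewrite big_mkcond big_nat_recr //= -big_mkcond /= divnS//.
by case: ifP => nN; rewrite ?addr0//= big_nat_recr//= nN add1n lerD.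
Qed.

End PowersAndZeta.

(** * Characters of a prime field *)

Section Characters.
Variables (R : realType) (n : nat).
Hypothesis n_prime : prime n.
Implicit Types r x : 'F_n.

Definition cosF r : R := cos (2 * pi * (nat_of_ord r)%:R / n%:R).
Definition sinF r : R := sin (2 * pi * (nat_of_ord r)%:R / n%:R).

Let n0 : n%:R != 0 :> R.
Proof. by rewrite pnatr_eq0 -lt0n prime_gt0. Qed.

Lemma cosDnat (k : nat) (x : R) : cos (x + 2 * pi * k%:R) = cos x.
Proof.
rewrite (_ : 2 * pi * k%:R = (pi *+ 2) *+ k) ?(periodicn (@cosD2pi R))//.
by rewrite mulr_natr mulr_natl.
Qed.

Lemma sinDnat (k : nat) (x : R) : sin (x + 2 * pi * k%:R) = sin x.
Proof.
rewrite (_ : 2 * pi * k%:R = (pi *+ 2) *+ k) ?(periodicn (@sinD2pi R))//.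
by rewrite mulr_natr mulr_natl.
Qed.

Let angle_mod (m : nat) :
  2 * pi * m%:R / n%:R = 2 * pi * (m %% n)%:R / n%:R + 2 * pi * (m %/ n)%:R :> R.
Proof. by rewrite {1}(divn_eq m n) natrD natrM; field. Qed.

Lemma cosF_nat (m : nat) : cosF m%:R = cos (2 * pi * m%:R / n%:R).
Proof. by rewrite /cosF val_Fp_nat// [in RHS]angle_mod cosDnat. Qed.

Lemma sinF_nat (m : nat) : sinF m%:R = sin (2 * pi * m%:R / n%:R).
Proof. by rewrite /sinF val_Fp_nat// [in RHS]angle_mod sinDnat. Qed.

Lemma cosFD r x : cosF (r + x) = cosF r * cosF x - sinF r * sinF x.
Proof.
rewrite -{1}[r]natr_Zp -{1}[x]natr_Zp -natrD cosF_nat natrD mulrDr mulrDl cosD.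
by [].
Qed.

Lemma sinFD r x : sinF (r + x) = sinF r * cosF x + cosF r * sinF x.
Proof.
rewrite -{1}[r]natr_Zp -{1}[x]natr_Zp -natrD sinF_nat natrD mulrDr mulrDl sinD.
by [].
Qed.

Lemma cosF0 : cosF 0 = 1. Proof. by rewrite /cosF mulr0 mul0r cos0. Qed.

Lemma sinF0 : sinF 0 = 0. Proof. by rewrite /sinF mulr0 mul0r sin0. Qed.

Lemma cosF2DsinF2 r : cosF r ^+ 2 + sinF r ^+ 2 = 1.
Proof. exact: cos2Dsin2. Qed.

(** The representative of [- r] is not the negative of that of [r]; the value is obtained by
    inverting the rotation in the addition formulas for [r + (- r) = 0]. *)
Lemma cosFN r : cosF (- r) = cosF r.
Proof.
have := cosFD r (- r); have := sinFD r (- r); have := cosF2DsinF2 r.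
rewrite subrr cosF0 sinF0 => sq1 s0 c1.
rewrite -[LHS]mul1r -sq1 (_ : _ * _ = cosF r * (cosF r * cosF (- r) - sinF r * sinF (- r)) +
  sinF r * (sinF r * cosF (- r) + cosF r * sinF (- r))); last ring.
by rewrite -s0 -c1 mulr0 addr0 mulr1.
Qed.

Lemma sinFN r : sinF (- r) = - sinF r.
Proof.
have := cosFD r (- r); have := sinFD r (- r); have := cosF2DsinF2 r.
rewrite subrr cosF0 sinF0 => sq1 s0 c1.
rewrite -[LHS]mul1r -sq1 (_ : _ * _ = cosF r * (sinF r * cosF (- r) + cosF r * sinF (- r)) -
  sinF r * (cosF r * cosF (- r) - sinF r * sinF (- r))); last ring.
by rewrite -s0 -c1 mulr0 mulr1 add0r.
Qed.

Lemma cosF_prod r x : 2 * (cosF r * cosF x) = cosF (r - x) + cosF (r + x).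
Proof. by rewrite !cosFD cosFN sinFN; ring. Qed.

Lemma cosF_neq1 r : r != 0 -> cosF r != 1.
Proof.
move=> r0; have rn : (r < n)%N by rewrite -[X in (_ < X)%N](Fp_cast n_prime); exact: ltn_ord.
have rp : (0 < r)%N by rewrite lt0n.
rewrite /cosF (_ : 2 * pi * _ / _ = (pi * (nat_of_ord r)%:R / n%:R) *+ 2); last first.
  by rewrite -[RHS]mulr_natl !mulrA.
rewrite cos_mulr2n cos2sin2.
have : 0 < sin (pi * (nat_of_ord r)%:R / n%:R) :> R.
  have np : 0 < n%:R :> R by rewrite ltr0n prime_gt0.
  rewrite sin_gt0_pi// -mulrA pmulr_rgt0 ?pi_gt0// divr_gt0// ?ltr0n//=.
  by rewrite gtr_pMr ?pi_gt0// ltr_pdivrMr// mul1r ltr_nat.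
move=> s0; set s := (X in 0 < X) in s0; rewrite -/s; rewrite -subr_eq0 (_ : _ - 1 - 1 = - (2 * s ^+ 2)); last ring.
by rewrite oppr_eq0 mulf_neq0 ?pnatr_eq0// expf_neq0// gt_eqF.
Qed.

(** For [r != 0] the sine sum vanishes by oddness, so translating the index by 1 multiplies the
    cosine sum by [cosF r], which differs from 1. *)
Lemma sum_cosF r : \sum_(i : 'F_n) cosF (i * r) = n%:R * (r == 0)%:R.
Proof.
have [->|r0] := eqVneq r 0.
  rewrite mulr1; under eq_bigr do rewrite mulr0 cosF0.
  by rewrite sumr_const card_Fp.
rewrite mulr0.
have S0 : \sum_(i : 'F_n) sinF (i * r) = 0.
  suff : \sum_(i : 'F_n) sinF (i * r) = - \sum_(i : 'F_n) sinF (i * r) by lra.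
  rewrite {1}(reindex_inj oppr_inj) -sumrN /=; apply: eq_bigr => i _.
  by rewrite mulNr sinFN.
have : \sum_(i : 'F_n) cosF (i * r) = \sum_(i : 'F_n) cosF (i * r) * cosF r.
  rewrite {1}(reindex_inj (addIr 1)) /=.
  under eq_bigr do rewrite mulrDl mul1r cosFD.
  by rewrite sumrB -!mulr_suml S0 mul0r subr0.
rewrite -mulr_suml => h; apply/eqP; have := cosF_neq1 r0; apply: contraNT => c0.
by apply/eqP; apply: (mulfI c0); rewrite mulr1 -h.
Qed.

Lemma sum_Fp (F : nat -> R) : \sum_(0 <= i < n) F i = \sum_(i : 'F_n) F (nat_of_ord i).
Proof. by rewrite -{1}(Fp_cast n_prime) big_mkord. Qed.

(* Fourier coefficients of functions on the field; the CBC criterion is an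
   instance at [r = 0]. *)
Definition wavg (g : 'F_n -> R) r : R := n%:R^-1 * \sum_i cosF (i * r) * g i.

Lemma eq_wavg (g h : 'F_n -> R) : g =1 h -> wavg g =1 wavg h.
Proof. by move=> gh r; congr (_ * _); apply: eq_bigr => i _; rewrite gh. Qed.

Lemma wavg0 g : wavg g 0 = n%:R^-1 * \sum_i g i.
Proof. by congr (_ * _); apply: eq_bigr => i _; rewrite mulr0 cosF0 mul1r. Qed.

Lemma wavgN g r : wavg g (- r) = wavg g r.
Proof. by congr (_ * _); apply: eq_bigr => i _; rewrite mulrN cosFN. Qed.

Lemma wavg1 r : wavg (fun=> 1) r = (r == 0)%:R.
Proof.
rewrite /wavg; under eq_bigr do rewrite mulr1.
by rewrite sum_cosF mulrA mulVf// mul1r.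
Qed.

Lemma wavg_cos g (b r : 'F_n) :
  2 * wavg (fun i => g i * cosF (i * b)) r = wavg g (r - b) + wavg g (r + b).
Proof.
rewrite /wavg mulrCA -mulrDr; congr (_ * _).
rewrite mulr_sumr -big_split; apply: eq_bigr => i _ /=.
rewrite mulrBr mulrDr -mulrDl -cosF_prod; ring.
Qed.

(** Starting from the indicator of 0, each further cosine replaces the coefficient at [r] by the
    mean of those at [r - b j] and [r + b j]; this is why the bounds are carried for all [r]. *)
Lemma wavg_cos_prod (J : Type) (s : seq J) (b : J -> 'F_n) r :
  0 <= wavg (fun i => \prod_(j <- s) cosF (i * b j)) r <= 1.
Proof.
elim: s r => [|j s IH] r.
  rewrite (@eq_wavg _ (fun=> 1)) => [|i]; last by rewrite big_nil.
  by rewrite wavg1 ler0n lern1 leq_b1.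
rewrite (@eq_wavg _ (fun i => \prod_(j <- s) cosF (i * b j) * cosF (i * b j))) => [|i]; last first.
  by rewrite big_cons mulrC.
have := wavg_cos (fun i => \prod_(j <- s) cosF (i * b j)) (b j) r.
have /andP := IH (r - b j); have /andP := IH (r + b j); lra.
Qed.

Section Step.
Variables (g : 'F_n -> R) (J : Type) (s : seq J) (rho : J -> R) (k : J -> 'F_n).

(** Multiplying by a cosine series convolves the Fourier coefficients; [rho j] are the coefficients
    of the series and [k j] its frequencies, scaled by the generator [b]. *)
Lemma wavg_step b r :
  wavg (fun i => g i * (1 + \sum_(j <- s) rho j * (2 * cosF (i * (k j * b))))) r =
  wavg g r + \sum_(j <- s) rho j * (wavg g (r - k j * b) + wavg g (r + k j * b)).
Proof.
under [in RHS]eq_bigr do rewrite -wavg_cos.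
rewrite /wavg [X in _ = _ + X](eq_bigr (fun j => n%:R^-1 *
  (\sum_i rho j * (2 * (cosF (i * r) * (g i * cosF (i * (k j * b)))))))) => [|j _]; last first.
  by rewrite !mulr_sumr; apply: eq_bigr => i _; ring.
rewrite -mulr_sumr -mulrDr; congr (_ * _).
rewrite exchange_big -big_split; apply: eq_bigr => i _ /=.
rewrite mulrDr mulr1 mulrDr; congr (_ + _); rewrite !mulr_sumr.
by apply: eq_bigr => j _; ring.
Qed.

Hypotheses (g0 : forall r, 0 <= wavg g r) (rho0 : forall j, 0 <= rho j).

Lemma wavg_step_ge0 b r :
  0 <= wavg (fun i => g i * (1 + \sum_(j <- s) rho j * (2 * cosF (i * (k j * b))))) r.
Proof.
rewrite wavg_step addr_ge0// sumr_ge0// => j _.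
by rewrite mulr_ge0// addr_ge0.
Qed.

(** Subadditivity splits the power over the terms of the convolution, and the sum over all [r]
    absorbs the shifts. Each frequency occurs with both signs, hence the factor 2. *)
Lemma sum_powR_wavg_step q b : 0 < q <= 1 ->
  \sum_r wavg (fun i => g i * (1 + \sum_(j <- s) rho j * (2 * cosF (i * (k j * b))))) r `^ q <=
  (1 + 2 * \sum_(j <- s) rho j `^ q) * \sum_r wavg g r `^ q.
Proof.
move=> q01; have t0 j r : 0 <= rho j * (wavg g (r - k j * b) + wavg g (r + k j * b)).
  by rewrite mulr_ge0// addr_ge0.
apply: (@le_trans _ _ (\sum_r (wavg g r `^ q + \sum_(j <- s) rho j `^ q *
    (wavg g (r - k j * b) `^ q + wavg g (r + k j * b) `^ q)))).
  apply: ler_sum => r _; rewrite wavg_step.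
  rewrite (le_trans (powR_subadd _ _ q01))// ?sumr_ge0// lerD2l.
  rewrite (le_trans (powR_sum_subadd _ _ q01))// ler_sum// => j _.
  rewrite powRM ?addr_ge0// ler_wpM2l ?powR_ge0//.
  exact: powR_subadd.
rewrite big_split /= exchange_big /= mulrDl mul1r lerD2l -mulrA mulr_suml mulr_sumr.
rewrite le_eqVlt; apply/orP; left; apply/eqP/eq_bigr => j _.
rewrite -mulr_sumr big_split /=.
have shift c : \sum_r wavg g (r + c) `^ q = \sum_r wavg g r `^ q.
  by rewrite [RHS](reindex_inj (addIr c)).
rewrite !shift; ring.
Qed.

(* Average over the generator [c] of the increment of the CBC criterion; the
   frequencies divisible by [n] are bounded separately as they see only
   [wavg g 0]. *)
Lemma sum_powR_increment q (A : R) : 0 < q <= 1 ->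
  A = \sum_(j <- s | k j == 0) rho j `^ q ->
  A <= (\sum_(j <- s) rho j `^ q) / n%:R ->
  \sum_(c | c != 0) (\sum_(j <- s) rho j * (2 * wavg g (k j * c))) `^ q <=
  2 * (\sum_(j <- s) rho j `^ q) * \sum_r wavg g r `^ q.
Proof.
move=> q01 Adef Ale; have n1 : (1 < n)%N := prime_gt1 n_prime.
have q0 := (andP q01).1.
set W0 := wavg g 0 `^ q; set W := \sum_r _; set tot := \sum_(j <- s) _.
have W00 : 0 <= W0 by exact: powR_ge0.
have WE : W = W0 + \sum_(c | c != 0) wavg g c `^ q.
  by rewrite /W (bigD1 0).
have WW0 : W0 <= W by rewrite WE lerDl sumr_ge0// => c _; exact: powR_ge0.
have tot0 : 0 <= tot by rewrite sumr_ge0// => j _; exact: powR_ge0.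
have card0 : \sum_(c : 'F_n | c != 0) W0 = (n%:R - 1) * W0.
  have : \sum_(c : 'F_n) W0 = n%:R * W0 by rewrite sumr_const card_Fp// mulr_natl.
  rewrite (bigD1 0)//= => h; rewrite mulrBl mul1r -h; ring.
have inner j : \sum_(c : 'F_n | c != 0) (rho j * (2 * wavg g (k j * c))) `^ q <=
    2 * (rho j `^ q * (if k j == 0 then (n%:R - 1) * W0 else W - W0)).
  apply: (@le_trans _ _ (\sum_(c : 'F_n | c != 0) 2 * (rho j `^ q * wavg g (k j * c) `^ q))).
    apply: ler_sum => c _; move: (wavg g (k j * c)) (g0 (k j * c)) => w w0.
    rewrite powRM ?rho0 ?mulr_ge0// [leRHS]mulrCA ler_wpM2l ?powR_ge0//.
    by rewrite powRM// ler_wpM2r ?powR_ge0// ler1_powR ?ler1n// (andP q01).2.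
  (* If [k j = 0], all [n - 1] candidates see [wavg g 0]; otherwise multiplication by [k j] permutes
     the nonzero residues, which is where primality enters. *)
  rewrite -!mulr_sumr; case: eqP => [->|/eqP kj0].
    by under eq_bigr do rewrite mul0r -/W0; rewrite card0.
  rewrite WE addrAC subrr add0r [X in _ <= _ * (_ * X)](reindex_inj (mulfI kj0)) /=.
  rewrite le_eqVlt; apply/orP; left; apply/eqP; do 2 congr (_ * _).
  by apply: eq_bigl => c; rewrite mulf_eq0 negb_or kj0.
apply: (@le_trans _ _ (2 * (A * ((n%:R - 1) * W0) + (tot - A) * (W - W0)))).
  apply: (@le_trans _ _ (\sum_(c : 'F_n | c != 0) \sum_(j <- s) (rho j * (2 * wavg g (k j * c))) `^ q)).
    apply: ler_sum => c _; apply: powR_sum_subadd => // j _.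
    by apply: mulr_ge0 => //; apply: mulr_ge0.
  rewrite exchange_big /= (le_trans (ler_sum _ (fun j _ => inner j)))//.
  rewrite -mulr_sumr ler_wpM2l//.
  rewrite (bigID (fun j => k j == 0)) /= Adef mulr_suml.
  have -> : tot - \sum_(j <- s | k j == 0) rho j `^ q = \sum_(j <- s | k j != 0) rho j `^ q.
    by rewrite /tot (bigID (fun j => k j == 0)) /= addrAC subrr add0r.
  rewrite mulr_suml lerD// le_eqVlt; apply/orP; left; apply/eqP; apply: eq_bigr => j.
    by move=> ->.
  by move=> /negPf ->.
rewrite -mulrA ler_wpM2l//.
rewrite (_ : _ + _ = A * (n%:R * W0 - W) + tot * (W - W0)); last ring.
(* The bound is affine in [A] with slope [n%:R * W0 - W]; the sign of the slope decides whether
   [A >= 0] or [A <= tot / n%:R] is the bound to use. *)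
have [h|h] := leP (n%:R * W0) W.
  have A0 : 0 <= A by rewrite Adef sumr_ge0// => j _; exact: powR_ge0.
  have : A * (n%:R * W0 - W) <= 0 by rewrite mulr_ge0_le0// subr_le0.
  have : 0 <= tot * W0 by rewrite mulr_ge0.
  lra.
apply: (@le_trans _ _ (tot / n%:R * (n%:R * W0 - W) + tot * (W - W0))).
  by rewrite lerD2r ler_wpM2r// subr_ge0 ltW.
rewrite (_ : _ + _ = tot * W - tot * W / n%:R); last by field.
by rewrite gerBl divr_ge0// mulr_ge0// (le_trans W00).
Qed.

End Step.

End Characters.

(** * The component-by-component construction *)

Section FiniteLimits.
Variables (R : realType) (T : Type) (F : set_system T).
Context {FF : Filter F}.

Lemma cvg_bigsum (I : Type) (r : seq I) (P : pred I) (f : I -> T -> R) (l : I -> R) :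
  (forall i, P i -> f i x @[x --> F] --> l i) ->
  \sum_(i <- r | P i) f i x @[x --> F] --> \sum_(i <- r | P i) l i.
Proof.
move=> fl; elim: r => [|i r IH].
  by rewrite big_nil; under eq_cvg do rewrite big_nil; exact: cvg_cst.
rewrite big_cons; under eq_cvg do rewrite big_cons.
by case: ifP => // Pi; apply: cvgD => //; exact: fl.
Qed.

Lemma cvg_bigprod (I : Type) (r : seq I) (P : pred I) (f : I -> T -> R) (l : I -> R) :
  (forall i, P i -> f i x @[x --> F] --> l i) ->
  \prod_(i <- r | P i) f i x @[x --> F] --> \prod_(i <- r | P i) l i.
Proof.
move=> fl; elim: r => [|i r IH].
  by rewrite big_nil; under eq_cvg do rewrite big_nil; exact: cvg_cst.
rewrite big_cons; under eq_cvg do rewrite big_cons.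
by case: ifP => // Pi; apply: cvgM => //; exact: fl.
Qed.

End FiniteLimits.

Lemma cvgn_ge (R : realType) (u : R ^nat) (l x : R) :
  u n @[n --> \oo] --> l -> (forall n, x <= u n) -> x <= l.
Proof.
move=> ul xu; rewrite -(cvg_lim _ ul)//; apply: limr_ge; last by near=> n.
by apply/cvg_ex; exists l.
Unshelve. all: by end_near. Qed.

Section FractionalParts.
Variable R : realType.

Lemma fracpart_div (m n : nat) : (0 < n)%N ->
  fracpart (m%:R / n%:R) = (m %% n)%:R / n%:R :> R.
Proof.
move=> n0; have nR : 0 < n%:R :> R by rewrite ltr0n.
rewrite /fracpart (@floor_def _ _ ((m %/ n)%N : int)).
  rewrite {1}(divn_eq m n) natrD natrM mulrDl mulfK ?gt_eqF//.
  by rewrite addrAC subrr add0r.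
rewrite intrD -!pmulrn; apply/andP; split.
  by rewrite ler_pdivlMr// -natrM ler_nat leq_trunc_div.
by rewrite ltr_pdivrMr// natr1 -natrM ltr_nat ltn_ceil.
Qed.

End FractionalParts.

(** * Truncations of omega at lattice points *)

Section Omega.
Variables (R : realType) (n : nat).
Hypothesis n_prime : prime n.

(** The series cut at [N], as a function of the residue: a finite cosine series on the prime field,
    to which [wavg_step] applies. The limit in [N] is taken afterwards. *)
Definition omega_sum (N : nat) (b : R) (x : 'F_n) : R :=
  \sum_(1 <= k < N.+1) k%:R `^ (- b) * (2 * cosF R (k%:R * x)).

Lemma Re_omega_sum (N : nat) (b : R) (m : nat) :
  complex.Re (\sum_(1 <= k < N.+1)
     (omega_term b (fracpart (m%:R / n%:R)) k%:Z +
      omega_term b (fracpart (m%:R / n%:R)) (- k%:Z))) = omega_sum N b m%:R.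
Proof.
have n0 : (0 < n)%N := prime_gt0 n_prime.
have nR : n%:R != 0 :> R by rewrite pnatr_eq0 -lt0n.
have ReD (u v : R[i]) : complex.Re (u + v) = complex.Re u + complex.Re v.
  by case: u; case: v.
rewrite (big_morph (id1 := 0) _ ReD)//; apply: eq_bigr => k _.
rewrite /omega_term ReD mulrNz normrN !pmulrn.
rewrite /= !mul0r !subr0 mulrN mulNr cosN normr_nat -mulrDr; congr (_ * _).
rewrite -mulr2n -mulr_natl; congr (_ * _).
rewrite -!pmulrn -(Fp_nat_mod n_prime m) -natrM cosF_nat// fracpart_div// natrM.
by congr cos; field.
Qed.

Lemma cvg_omega_sum (b : R) (m : nat) : 1 < b ->
  omega_sum N b m%:R @[N --> \oo] --> omega b (fracpart (m%:R / n%:R)).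
Proof.
move=> b1; rewrite /omega (_ : (fun N : nat => complex.Re _) = (fun N => omega_sum N b m%:R)); last first.
  by apply/funext => N; exact: Re_omega_sum.
pose u (k : nat) : R := k.+1%:R `^ (- b) * (2 * cosF R (k.+1%:R * (m%:R : 'F_n))).
have uE : (fun N => omega_sum N b m%:R) = series u.
  by apply/funext => N; rewrite /omega_sum /series /= big_add1.
rewrite uE; apply: (normed_cvg (u_ := u)).
apply: (@series_le_cvg _ _ (2 *: (fun k : nat => (k.+1%:R `^ b)^-1))) => [k|k|k|].
- exact: normr_ge0.
- by rewrite /= mulr_ge0// invr_ge0 powR_ge0.
- rewrite /u /= powRN normrM ger0_norm ?invr_ge0 ?powR_ge0// mulrC.
  by rewrite ler_wpM2r ?invr_ge0 ?powR_ge0// normrM ger0_norm// ler_piMr// cos_max.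
apply: is_cvg_seriesZ; apply/cvg_ex; exists (zeta b).
have := cvg_zeta_sum b1; under eq_cvg do rewrite -zeta_sumE.
by [].
Qed.

End Omega.

(** * Induction over the components of the generating vector *)

Section CbcBound.
Variables (R : realType) (n d : nat) (a : R) (Gamma : 'I_d -> R).
Hypotheses (n_prime : prime n) (a_gt : 1 / 2 < a) (Gamma0 : forall j, 0 <= Gamma j).
Implicit Types (v : 'I_d -> nat) (s N : nat).

Definition cbc_prod s v (i : 'F_n) : R := \prod_(j < d | (j < s)%N)
  (1 + Gamma j ^+ 2 * omega (2 * a) (fracpart ((i * v j)%:R / n%:R))).

Definition cbc_prod_sum N s v (i : 'F_n) : R := \prod_(j < d | (j < s)%N)
  (1 + Gamma j ^+ 2 * omega_sum N (2 * a) ((i * v j)%:R : 'F_n)).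

Lemma cbc_E2_wavg s v : cbc_E2 n a Gamma s v = -1 + wavg (cbc_prod s v) 0.
Proof. by rewrite /cbc_E2 wavg0 (sum_Fp n_prime). Qed.

Let a2 : 1 < 2 * a. Proof. by rewrite mulrC -ltr_pdivrMr. Qed.

Lemma cvg_wavg (g : nat -> 'F_n -> R) (l : 'F_n -> R) r :
  (forall i, g N i @[N --> \oo] --> l i) -> wavg (g N) r @[N --> \oo] --> wavg l r.
Proof.
move=> gl; apply: cvgM; first exact: cvg_cst.
apply: cvg_bigsum => i _; apply: cvgM; [exact: cvg_cst | exact: gl].
Qed.

Lemma cvg_cbc_prod_sum s v i : cbc_prod_sum N s v i @[N --> \oo] --> cbc_prod s v i.
Proof.
apply: cvg_bigprod => j _; apply: cvgD; first exact: cvg_cst.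
by apply: cvgM; [exact: cvg_cst | exact: cvg_omega_sum].
Qed.

Lemma prod_ord_recr (F : 'I_d -> R) (j : 'I_d) :
  \prod_(i < d | (i < j.+1)%N) F i = (\prod_(i < d | (i < j)%N) F i) * F j.
Proof.
rewrite (bigD1 j) ?ltnS//= mulrC; congr (_ * _); apply: eq_bigl => i.
by rewrite ltnS ltn_neqAle -val_eqE andbC.
Qed.

Let weight (j : 'I_d) (k : nat) : R := Gamma j ^+ 2 * k%:R `^ (- (2 * a)).

Let weight0 j k : 0 <= weight j k.
Proof. by rewrite mulr_ge0 ?sqr_ge0 ?powR_ge0. Qed.

Lemma omega_sum_weight N j (c i : 'F_n) :
  1 + Gamma j ^+ 2 * omega_sum N (2 * a) (i * c) =
  1 + \sum_(k <- index_iota 1 N.+1) weight j k * (2 * cosF R (i * (k%:R * c))).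
Proof.
congr (_ + _); rewrite /omega_sum mulr_sumr; apply: eq_bigr => k _.
by rewrite /weight -mulrA (mulrCA i).
Qed.

Lemma cbc_prod_sum_recr N (j : 'I_d) v : cbc_prod_sum N j.+1 v =1 fun i =>
  cbc_prod_sum N j v i * (1 + \sum_(k <- index_iota 1 N.+1)
    weight j k * (2 * cosF R (i * (k%:R * (v j)%:R)))).
Proof.
move=> i; rewrite /cbc_prod_sum prod_ord_recr -omega_sum_weight.
by rewrite natrM natr_Zp.
Qed.

(** Subadditivity of powers requires nonnegative Fourier coefficients. They persist because every
    factor is 1 plus a cosine series with nonnegative coefficients. *)
Lemma wavg_cbc_prod_sum_ge0 N s v r : (s <= d)%N -> 0 <= wavg (cbc_prod_sum N s v) r.
Proof.
elim: s r => [|s IH] r sd.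
  rewrite (eq_wavg (h := fun=> 1)) => [|i]; last by rewrite /cbc_prod_sum big_pred0.
  by rewrite wavg1// ler0n.
rewrite (eq_wavg (cbc_prod_sum_recr N (Ordinal sd) v)).
by apply: wavg_step_ge0 => // r'; exact: IH (ltnW sd).
Qed.

Variable q : R.
Hypotheses (q01 : 0 < q <= 1) (aq : 1 < 2 * a * q).

Definition cbc_volume s : R :=
  \prod_(j < d | (j < s)%N) (1 + 2 * (Gamma j ^+ 2) `^ q * zeta (2 * a * q)).

Lemma cbc_factor_ge1 j : 1 <= 1 + 2 * (Gamma j ^+ 2) `^ q * zeta (2 * a * q).
Proof. by rewrite lerDl mulr_ge0 ?zeta_ge0// mulr_ge0 ?powR_ge0. Qed.

Lemma sum_powR_weight N j : \sum_(k <- index_iota 1 N.+1) weight j k `^ q =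
  (Gamma j ^+ 2) `^ q * zeta_sum N (2 * a * q).
Proof.
rewrite mulr_sumr; apply: eq_bigr => k _.
by rewrite /weight powRM ?sqr_ge0 ?powR_ge0// -powRrM mulNr.
Qed.

(** A bound independent of [N]: the empty product has the indicator of 0 as coefficients, with power
    sum 1, and each component multiplies the sum by at most one factor of the volume. *)
Lemma sum_powR_wavg_cbc N s v : (s <= d)%N ->
  \sum_r wavg (cbc_prod_sum N s v) r `^ q <= cbc_volume s.
Proof.
elim: s => [|s IH] sd.
  rewrite (eq_bigr (fun r => (r == 0)%:R)) => [|r _]; last first.
    rewrite (eq_wavg (h := fun=> 1)) => [|i]; last by rewrite /cbc_prod_sum big_pred0.
    by rewrite wavg1//; case: eqP; rewrite ?powR1// powR0// gt_eqF// (andP q01).1.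
  by rewrite (bigD1 0)//= big1 => [|r /negPf->//]; rewrite addr0 /cbc_volume big_pred0.
have W0 r : 0 <= wavg (cbc_prod_sum N s v) r by exact: wavg_cbc_prod_sum_ge0 (ltnW sd).
have := sum_powR_wavg_step n_prime (index_iota 1 N.+1) (fun k : nat => k%:R) W0
  (weight0 (Ordinal sd)) (v (Ordinal sd))%:R q01.
rewrite (eq_bigr (fun r => wavg (cbc_prod_sum N s.+1 v) r `^ q)) => [/le_trans|r _]; last first.
  by congr (_ `^ q); symmetry; apply: eq_wavg; exact: (cbc_prod_sum_recr N (Ordinal sd) v).
apply.
have -> : cbc_volume s.+1 = cbc_volume s *
    (1 + 2 * (Gamma (Ordinal sd) ^+ 2) `^ q * zeta (2 * a * q)).
  exact: (prod_ord_recr _ (Ordinal sd)).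
rewrite [leRHS]mulrC ler_pM ?IH 1?ltnW//.
- rewrite addr_ge0// mulr_ge0// sumr_ge0// => k _; exact: powR_ge0.
- by rewrite sumr_ge0// => r _; exact: powR_ge0.
- rewrite lerD2l -mulrA ler_wpM2l// sum_powR_weight ler_wpM2l ?powR_ge0//.
  exact: zeta_sum_le_zeta.
Qed.

(** The frequencies divisible by [n] carry at most the fraction 1/n of the total that
    [sum_powR_increment] asks for, by [zeta_sum_dvdn] with exponent [2 * a * q]. *)
Lemma sum_powR_cbc_increment N (j : 'I_d) v :
  \sum_(c : 'F_n | c != 0) (\sum_(k <- index_iota 1 N.+1)
     weight j k * (2 * wavg (cbc_prod_sum N j v) (k%:R * c))) `^ q <=
  2 * (Gamma j ^+ 2) `^ q * zeta (2 * a * q) * cbc_volume j.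
Proof.
have W0 r : 0 <= wavg (cbc_prod_sum N j v) r by exact: wavg_cbc_prod_sum_ge0 (ltnW _).
apply: (le_trans (sum_powR_increment n_prime _ _ q01 erefl _)) => //.
  rewrite sum_powR_weight (eq_bigl (fun k => (n %| k)%N)) => [|k]; last first.
    by rewrite (GRing.dvdn_pcharf (pchar_Fp n_prime)).
  rewrite (eq_bigr (fun k : nat => (Gamma j ^+ 2) `^ q * k%:R `^ (- (2 * a * q)))) => [|k _]; last first.
    by rewrite /weight powRM ?sqr_ge0 ?powR_ge0// -powRrM mulNr.
  rewrite -mulr_sumr -[leRHS]mulrA ler_wpM2l ?powR_ge0//.
  exact: zeta_sum_dvdn (prime_gt0 n_prime) (ltW aq).
apply: ler_pM.
- by rewrite mulr_ge0// sumr_ge0// => k _; exact: powR_ge0.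
- by rewrite sumr_ge0// => k _; exact: powR_ge0.
- rewrite -mulrA ler_wpM2l// sum_powR_weight ler_wpM2l ?powR_ge0//.
  exact: zeta_sum_le_zeta.
- exact: sum_powR_wavg_cbc (ltnW _).
Qed.

Lemma wavg_cbc_increment N (j : 'I_d) v c :
  wavg (fun i => cbc_prod_sum N j v i * (1 + Gamma j ^+ 2 * omega_sum N (2 * a) (i * c))) 0 -
    wavg (cbc_prod_sum N j v) 0 =
  \sum_(k <- index_iota 1 N.+1) weight j k * (2 * wavg (cbc_prod_sum N j v) (k%:R * c)).
Proof.
rewrite (@eq_wavg _ _ _ (fun i => cbc_prod_sum N j v i * (1 + \sum_(k <- index_iota 1 N.+1)
  weight j k * (2 * cosF R (i * (k%:R * c)))))) => [|i]; last by rewrite omega_sum_weight.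
rewrite wavg_step// addrAC subrr add0r; apply: eq_bigr => k _.
by rewrite !add0r wavgN//; ring.
Qed.

Definition cbc_increment (j : 'I_d) v (c : nat) : R :=
  wavg (fun i => cbc_prod j v i *
    (1 + Gamma j ^+ 2 * omega (2 * a) (fracpart ((i * c)%:R / n%:R)))) 0 -
  wavg (cbc_prod j v) 0.

Lemma cvg_cbc_increment (j : 'I_d) v (c : nat) :
  \sum_(k <- index_iota 1 N.+1) weight j k * (2 * wavg (cbc_prod_sum N j v) (k%:R * c%:R))
    @[N --> \oo] --> cbc_increment j v c.
Proof.
under eq_cvg do rewrite -wavg_cbc_increment.
apply: cvgB; last by apply: cvg_wavg => i; exact: cvg_cbc_prod_sum.
apply: cvg_wavg => i; apply: cvgM; first exact: cvg_cbc_prod_sum.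
apply: cvgD; first exact: cvg_cst.
apply: cvgM; first exact: cvg_cst.
rewrite (_ : i * c%:R = (nat_of_ord i * c)%:R); [exact: cvg_omega_sum | by rewrite natrM natr_Zp].
Qed.

Lemma cbc_E2_recr (j : 'I_d) v :
  cbc_E2 n a Gamma j.+1 v = cbc_E2 n a Gamma j v + cbc_increment j v (v j).
Proof.
rewrite !cbc_E2_wavg /cbc_increment (@eq_wavg _ _ (cbc_prod j.+1 v) (fun i => cbc_prod j v i *
  (1 + Gamma j ^+ 2 * omega (2 * a) (fracpart ((i * v j)%:R / n%:R))))) => [|i].
  ring.
by rewrite /cbc_prod prod_ord_recr.
Qed.

Lemma cbc_increment_ge0 (j : 'I_d) v c : 0 <= cbc_increment j v c.
Proof.
apply: (cvgn_ge (@cvg_cbc_increment j v c)) => N; rewrite sumr_ge0// => k _; apply: mulr_ge0 => //; apply: mulr_ge0 => //.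
exact: wavg_cbc_prod_sum_ge0 (ltnW _).
Qed.

(** The averaging bound is known for truncations only. If [B] were too large, then for one large [N]
    the truncated increments of the finitely many candidates would all exceed what their average
    permits. *)
Lemma cbc_increment_le_min (j : 'I_d) v (B : R) : 0 <= B ->
  (forall c : nat, (0 < c < n)%N -> B <= cbc_increment j v c) ->
  B `^ q <= 2 * (Gamma j ^+ 2) `^ q * zeta (2 * a * q) * cbc_volume j / (n%:R - 1).
Proof.
move=> B0 minB; have n1 := prime_gt1 n_prime; have [q0 q1] := andP q01.
have n1R : 0 < n%:R - 1 :> R by rewrite subr_gt0 ltr1n.
set C := _ / _; rewrite leNgt; apply/negP => CB.
have C0 : 0 <= C.
  rewrite divr_ge0 ?(ltW n1R)// mulr_ge0 ?prodr_ge0// ?mulr_ge0 ?powR_ge0 ?zeta_ge0// => i _.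
  by rewrite (le_trans ler01)// cbc_factor_ge1.
have CqB : C `^ q^-1 < B.
  rewrite -[ltRHS](@powRr1 _ B)// -(@mulfV _ q) ?gt_eqF// powRrM.
  by rewrite gt0_ltr_powR ?invr_gt0 ?nnegrE ?powR_ge0.
have CE : C = (C `^ q^-1) `^ q by rewrite -powRrM mulVf ?powRr1 ?gt_eqF.
have ev (c : 'F_n) : c != 0 -> \forall N \near \oo,
    C < (\sum_(k <- index_iota 1 N.+1) weight j k * (2 * wavg (cbc_prod_sum N j v) (k%:R * c))) `^ q.
  move=> c0; have cn : (0 < c < n)%N.
    by rewrite lt0n c0 -[X in (_ < X)%N](Fp_cast n_prime) ltn_ord.
  have lt := lt_le_trans CqB (minB _ cn).
  have := cvgr_gt _ (@cvg_cbc_increment j v c) _ lt.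
  case=> N0 _ H; exists N0 => // N N0N; have /= := H N N0N.
  rewrite natr_Zp => h; rewrite CE (gt0_ltr_powR q0) ?nnegrE ?powR_ge0//.
  exact: le_trans (powR_ge0 _ _) (ltW h).
have : \forall N \near \oo, forall c : 'F_n, c != 0 ->
    C < (\sum_(k <- index_iota 1 N.+1) weight j k * (2 * wavg (cbc_prod_sum N j v) (k%:R * c))) `^ q.
  apply: filter_forall => c; case: (eqVneq c 0) => [_|c0]; first by exists 0%N.
  by case: (ev c c0) => N0 _ H; exists N0 => // N N0N _; exact: H N N0N.
case=> N _ /(_ N (leqnn N)) /= h.
have := sum_powR_cbc_increment N j v; rewrite leNgt => /negP; apply.
rewrite -[ltLHS](@divfK _ (n%:R - 1)) ?gt_eqF// -/C.
have -> : C * (n%:R - 1) = \sum_(c : 'F_n | c != 0) C.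
  have : \sum_(c : 'F_n) C = n%:R * C by rewrite sumr_const card_Fp// mulr_natl.
  by rewrite (bigD1 0)//= => e; rewrite mulrBr mulr1 mulrC -e; ring.
apply: ltr_sum; [apply/hasP; exists 1; rewrite ?mem_index_enum ?oner_neq0// | exact: h].
Qed.

Variable z : 'I_d -> nat.
Hypothesis cbc : cbc_vector n a Gamma z.

(** The first component is prescribed to be 1, but it is also a minimizer: the preceding product is
    1, so the increment collects the frequencies [k] for which [k * c] vanishes modulo [n], the same
    ones for every nonzero [c]. *)
Lemma cbc_increment_min (j : 'I_d) (c : nat) : (0 < c < n)%N ->
  cbc_increment j z (z j) <= cbc_increment j z c.
Proof.
move=> c0n; have [zj] := cbc j; case: eqP => [j0 _|_ /(_ c c0n)].
  have nz m : (0 < m < n)%N -> (m%:R : 'F_n) != 0.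
    move=> /andP[m0 mn]; rewrite -(GRing.dvdn_pcharf (pchar_Fp n_prime)).
    by apply/negP => /(dvdn_leq m0); rewrite leqNgt mn.
  suff E m : (0 < m < n)%N -> cbc_increment j z m = cbc_increment j z 1 by rewrite !E.
  move=> m0n; have := @cvg_cbc_increment j z m.
  rewrite [X in X @ _ --> _](_ : _ = (fun N => \sum_(k <- index_iota 1 N.+1)
    weight j k * (2 * wavg (cbc_prod_sum N j z) (k%:R * 1%:R)))) => [h|].
    rewrite -(cvg_lim (@norm_hausdorff _ _) h)//.
    exact: (cvg_lim (@norm_hausdorff _ _) (@cvg_cbc_increment j z 1)).
  apply/funext => N; apply: eq_bigr => k _; do 2 congr (_ * _).
  have g1 : cbc_prod_sum N j z =1 fun=> 1.
    by move=> i; rewrite /cbc_prod_sum j0 big_pred0.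
  by rewrite !(eq_wavg g1) !wavg1// mulf_eq0 (negPf (nz _ m0n)) orbF mulr1.
rewrite !cbc_E2_recr /= eqxx.
have same i : cbc_prod j [eta z with j |-> c] i = cbc_prod j z i.
  apply: eq_bigr => l lj /=; case: eqP => [lj'|//]; by rewrite lj' ltnn in lj.
have -> : cbc_E2 n a Gamma j [eta z with j |-> c] = cbc_E2 n a Gamma j z.
  by rewrite !cbc_E2_wavg (eq_wavg same).
rewrite lerD2l; congr (_ <= _); rewrite /cbc_increment (eq_wavg same).
by congr (_ - _); apply: eq_wavg => i; rewrite same.
Qed.

Lemma cbc_E2_ge0 s : (s <= d)%N -> 0 <= cbc_E2 n a Gamma s z.
Proof.
elim: s => [|s IH] sd.
  rewrite cbc_E2_wavg (eq_wavg (h := fun=> 1)) => [|i]; last by rewrite /cbc_prod big_pred0.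
  by rewrite wavg1// eqxx addNr.
by rewrite (cbc_E2_recr (Ordinal sd)) addr_ge0 ?cbc_increment_ge0//= IH// ltnW.
Qed.

(** With V the volume and 1 + u its next factor, the old bound and the new increment add up as (V -
    1) + u V = V (1 + u) - 1. *)
Lemma cbc_error_bound s : (s <= d)%N ->
  cbc_E2 n a Gamma s z `^ q <= (cbc_volume s - 1) / (n%:R - 1).
Proof.
have [q0 q1] := andP q01.
elim: s => [|s IH] sd.
  rewrite cbc_E2_wavg (eq_wavg (h := fun=> 1)) => [|i]; last by rewrite /cbc_prod big_pred0.
  by rewrite wavg1// eqxx addNr powR0 ?gt_eqF// /cbc_volume big_pred0// subrr mul0r.
pose j := Ordinal sd.
rewrite (cbc_E2_recr j) (le_trans (powR_subadd _ _ q01))//.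
- exact: cbc_E2_ge0 (ltnW sd).
- exact: cbc_increment_ge0.
have := cbc_increment_le_min (cbc_increment_ge0 j z (z j)) (cbc_increment_min j).
move=> h; apply: (le_trans (lerD (IH (ltnW sd)) h)).
rewrite -mulrDl (_ : cbc_volume s.+1 = cbc_volume s *
  (1 + 2 * (Gamma j ^+ 2) `^ q * zeta (2 * a * q))); last exact: (prod_ord_recr _ j).
rewrite /=; set u := 2 * _ * _; rewrite le_eqVlt; apply/orP; left; apply/eqP.
by congr (_ / _); ring.
Qed.

End CbcBound.

(** * Integrals over the unit interval *)

Section UnitIntegral.
Variable R : realType.
Implicit Types (f g : R -> R) (c : R).
Local Notation mu := (@lebesgue_measure R).

Definition integrable01 f : Prop := mu.-integrable (`[0, 1] : set R) (EFin \o f).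

Lemma in01 (x : R) : (x \in (`[0, 1]%classic : set R)) = (0 <= x <= 1).
Proof. by rewrite mem_setE in_itv. Qed.

Lemma continuous01_integrable f : {within `[0, 1], continuous f} -> integrable01 f.
Proof. by move=> fc; apply: continuous_compact_integrable => //; exact: segment_compact. Qed.

Lemma continuous_integrable01 f : continuous f -> integrable01 f.
Proof. by move=> fc; apply: continuous01_integrable; exact: continuous_subspaceT. Qed.

Lemma integrable01D f g : integrable01 f -> integrable01 g -> integrable01 (fun x => f x + g x).
Proof.
move=> fi gi; exact: (@integrableD _ _ _ mu `[0, 1]%classic (measurable_itv _) _ _ fi gi).
Qed.

Lemma integrable01Z c f : integrable01 f -> integrable01 (fun x => c * f x).
Proof.
move=> fi; exact: (@integrableZl _ _ _ mu `[0, 1]%classic (measurable_itv _) c _ fi).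
Qed.

Lemma integrable01_cst c : integrable01 (fun=> c).
Proof. by apply: continuous_integrable01 => x; exact: cvg_cst. Qed.

Lemma integrable01B f g : integrable01 f -> integrable01 g -> integrable01 (fun x => f x - g x).
Proof.
move=> fi gi; have := integrable01D fi (integrable01Z (-1) gi).
by under eq_fun do rewrite mulN1r.
Qed.

Lemma integrable01_sum (I : Type) (r : seq I) (F : I -> R -> R) :
  (forall i, integrable01 (F i)) -> integrable01 (fun x => \sum_(i <- r) F i x).
Proof.
move=> Fi; elim: r => [|i r IH].
  by under eq_fun do rewrite big_nil; exact: integrable01_cst.
by under eq_fun do rewrite big_cons; exact: integrable01D.
Qed.

Lemma eq_integrable01 f g : (forall x, 0 <= x <= 1 -> f x = g x) ->
  integrable01 f -> integrable01 g.
Proof.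
move=> fg; apply: eq_integrable => // x; rewrite in01 => x01 /=.
by rewrite fg.
Qed.

Lemma integrable01_measurable f : integrable01 f -> measurable_fun (`[0, 1] : set R) f.
Proof. by move=> /integrableP[/measurable_EFinP]. Qed.

Lemma integrable01_mul_continuous f g :
  {within `[0, 1], continuous f} -> integrable01 g -> integrable01 (fun x => f x * g x).
Proof.
move=> fc gi; have fi := continuous01_integrable fc.
have := @integrableMr _ _ _ mu _ (measurable_itv _) f (EFin \o g) (integrable01_measurable fi) _ gi.
apply.
have /= := compact_bounded (continuous_compact fc (@segment_compact R 0 1)).
by move=> [M [Mr h]]; exists M; split => // x Mx y /= y01; apply: h => //=; exists y.
Qed.

Lemma eq_int01 f g : (forall x, 0 <= x <= 1 -> f x = g x) -> int01 f = int01 g.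
Proof. by move=> fg; apply: eq_Rintegral => x; rewrite in01; exact: fg. Qed.

Lemma int01_cst c : int01 (fun=> c) = c.
Proof.
have mu01 : mu `[0, 1]%classic = 1%E.
  have := @lebesgue_measure_itv R `[0, 1]; rewrite /= lte_fin ltr01 => ->.
  by rewrite oppr0 adde0.
rewrite /int01 Rintegral_cst// -[RHS]mulr1; congr (_ * _).
by rewrite -[RHS]/(fine 1%E); congr fine; exact: mu01.
Qed.

Lemma int01D f g : integrable01 f -> integrable01 g ->
  int01 (fun x => f x + g x) = int01 f + int01 g.
Proof. by move=> fi gi; exact: RintegralD. Qed.

Lemma int01B f g : integrable01 f -> integrable01 g ->
  int01 (fun x => f x - g x) = int01 f - int01 g.
Proof. by move=> fi gi; exact: RintegralB. Qed.

Lemma int01Z c f : integrable01 f -> int01 (fun x => c * f x) = c * int01 f.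
Proof. by move=> fi; exact: RintegralZl. Qed.

Lemma int01_sum (I : Type) (r : seq I) (F : I -> R -> R) :
  (forall i, integrable01 (F i)) ->
  int01 (fun x => \sum_(i <- r) F i x) = \sum_(i <- r) int01 (F i).
Proof.
move=> Fi; elim: r => [|i r IH].
  by rewrite big_nil -[RHS](int01_cst 0); apply: eq_int01 => x _; rewrite big_nil.
rewrite big_cons -IH -int01D//; last exact: integrable01_sum.
by apply: eq_int01 => x _; rewrite big_cons.
Qed.

Lemma ler_int01 f g : integrable01 f -> integrable01 g ->
  (forall x, 0 <= x <= 1 -> f x <= g x) -> int01 f <= int01 g.
Proof. by move=> fi gi fg; apply: le_Rintegral => // x; rewrite /= in_itv; exact: fg. Qed.

Lemma int01_ge0 f : (forall x, 0 <= x <= 1 -> 0 <= f x) -> 0 <= int01 f.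
Proof. by move=> f0; apply: Rintegral_ge0 => x; rewrite /= in_itv; exact: f0. Qed.

Lemma int01_norm_le f g : integrable01 f -> integrable01 g ->
  (forall x, 0 <= x <= 1 -> `|f x| <= g x) -> `|int01 f| <= int01 g.
Proof.
move=> fi gi fg; rewrite ler_norml; apply/andP; split.
  rewrite -mulN1r -int01Z//; apply: ler_int01 => //; first exact: integrable01Z.
  by move=> x x01; have := fg x x01; rewrite mulN1r ler_norml => /andP[].
by apply: ler_int01 => // x x01; exact: le_trans (ler_norm _) (fg x x01).
Qed.

Lemma int01_norm_bound f c : integrable01 f ->
  (forall x, 0 <= x <= 1 -> `|f x| <= c) -> `|int01 f| <= c.
Proof.
move=> fi fc; rewrite -[leRHS]int01_cst; apply: int01_norm_le => //.
exact: integrable01_cst.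
Qed.

Lemma int01_FTC f (F : R -> R) : continuous f -> (forall x : R, is_derive x 1 F (f x)) ->
  int01 f = F 1 - F 0.
Proof.
move=> fc dF; have Fd (x : R) : derivable F x 1 by [].
have Fc : continuous F by move=> x; apply: differentiable_continuous; exact/derivable1_diffP.
rewrite /int01 /Rintegral (@continuous_FTC2 _ f F)//.
- exact: continuous_subspaceT.
- split => // [|].
    by apply: cvg_at_right_filter; exact: Fc.
  by apply: cvg_at_left_filter; exact: Fc.
- by move=> x _; rewrite derive1E derive_val.
Qed.

End UnitIntegral.

(** * Trigonometric integrals and estimates *)

Section Trigonometry.
Variable R : realType.
Implicit Types (x t u : R) (m : int).

Lemma is_derive_mull (c x : R) : is_derive x 1 (fun x : R => c * x) c.
Proof.
have := @is_deriveZ R R R id c x 1 1 (is_derive_id _ _).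
by rewrite /GRing.scale /= mulr1.
Qed.

Lemma is_derive_cos_lin (c x : R) : is_derive x 1 (fun x : R => cos (c * x)) (- (c * sin (c * x))).
Proof.
apply: is_derive_eq (is_derive1_comp (is_derive_cos (c * x)) (is_derive_mull c x)) _.
by rewrite mulNr mulrC.
Qed.

Lemma is_derive_sin_lin (c x : R) : is_derive x 1 (fun x : R => sin (c * x)) (c * cos (c * x)).
Proof.
apply: is_derive_eq (is_derive1_comp (is_derive_sin (c * x)) (is_derive_mull c x)) _.
by rewrite mulrC.
Qed.

Lemma continuous_mull c : continuous (fun x : R => c * x).
Proof. by move=> x; apply: cvgM; [exact: cvg_cst | exact: cvg_id]. Qed.

Lemma continuous_cos_lin c : continuous (fun x : R => cos (c * x)).
Proof.
move=> x; apply: (@continuous_comp _ _ _ (fun x => c * x) (@cos R)); first exact: continuous_mull.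
exact: continuous_cos.
Qed.

Lemma continuous_sin_lin c : continuous (fun x : R => sin (c * x)).
Proof.
move=> x; apply: (@continuous_comp _ _ _ (fun x => c * x) (@sin R)); first exact: continuous_mull.
exact: continuous_sin.
Qed.

Lemma sin_nat_pi (k : nat) : sin (k%:R * pi) = 0 :> R.
Proof.
elim: k => [|k IH]; first by rewrite mul0r sin0.
by rewrite -natr1 mulrDl mul1r sinDpi IH oppr0.
Qed.

Lemma sin_int_pi m : sin (m%:~R * pi) = 0 :> R.
Proof.
case: m => k; first exact: sin_nat_pi.
by rewrite NegzE mulrNz mulNr sinN sin_nat_pi oppr0.
Qed.

Lemma int01_cos m : int01 (fun x : R => cos (m%:~R * pi * x)) = (m == 0)%:R.
Proof.
have [->|m0] := eqVneq m 0.
  by rewrite -[RHS](int01_cst 1); apply: eq_int01 => x _; rewrite mul0r mul0r cos0.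
have mp : m%:~R * pi != 0 :> R by rewrite mulf_neq0 ?intr_eq0// gt_eqF ?pi_gt0.
have dF (x : R) : is_derive x 1 (fun x : R => (m%:~R * pi)^-1 * sin (m%:~R * pi * x)) (cos (m%:~R * pi * x)).
  apply: is_derive_eq (is_deriveZ (m%:~R * pi)^-1 (is_derive_sin_lin (m%:~R * pi) x)) _.
  by rewrite /GRing.scale /= mulrA mulVf// mul1r.
rewrite (int01_FTC (@continuous_cos_lin _) dF).
by rewrite mulr1 mulr0 sin0 sin_int_pi mulr0 subrr.
Qed.

Lemma cosM2 u t : 2 * (cos u * cos t) = cos (u - t) + cos (u + t) :> R.
Proof. rewrite cosB cosD; ring. Qed.

Lemma sinM2 u t : 2 * (sin u * sin t) = cos (u - t) - cos (u + t) :> R.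
Proof. rewrite cosB cosD; ring. Qed.

(** The signs [e = 1] and [e = -1] serve products of cosines and of sines. *)
Let int01_two_cos (e : R) (k l : nat) :
  int01 (fun x : R => 2^-1 * (cos ((k%:Z - l%:Z)%:~R * pi * x) + e * cos ((k%:Z + l%:Z)%:~R * pi * x))) =
  2^-1 * ((k == l)%:R + e * ((k == 0) && (l == 0))%N%:R).
Proof.
have ci m : integrable01 (fun x => cos (m%:~R * pi * x) : R).
  by apply: continuous_integrable01; exact: continuous_cos_lin.
rewrite int01Z ?int01D ?int01Z//; try by [exact: integrable01Z | apply: integrable01D => //; exact: integrable01Z].
rewrite !int01_cos subr_eq0 eqz_nat; congr (_ * (_ + _ * _)).
by case: k l => [|k] [|l].
Qed.

Lemma int01_coscos (k l : nat) :
  int01 (fun x : R => cos (k%:R * pi * x) * cos (l%:R * pi * x)) =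
  2^-1 * ((k == l)%:R + ((k == 0) && (l == 0))%N%:R).
Proof.
have := int01_two_cos 1 k l; rewrite mul1r => <-; apply: eq_int01 => x _.
by rewrite intrB intrD !mulrDl mulNr mulNr mul1r -cosM2 -!pmulrn mulKf.
Qed.

Lemma int01_sinsin (k l : nat) :
  int01 (fun x : R => sin (k%:R * pi * x) * sin (l%:R * pi * x)) =
  2^-1 * ((k == l)%:R - ((k == 0) && (l == 0))%N%:R).
Proof.
have := int01_two_cos (-1) k l; rewrite mulN1r => <-; apply: eq_int01 => x _.
by rewrite intrB intrD !mulrDl mulNr mulNr mulN1r -sinM2 -!pmulrn mulKf.
Qed.

Lemma cosineE (k : nat) x : cosine k x = (if k == 0%N then 1 else Num.sqrt 2) * cos (k%:R * pi * x) :> R.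
Proof. by case: k => //=; rewrite mul0r mul0r cos0 mulr1. Qed.

Lemma cosineM2 (k : nat) x t : cosine k x * cosine k t =
  (if k == 0%N then 1 else 2) * (cos (k%:R * pi * x) * cos (k%:R * pi * t)) :> R.
Proof.
rewrite !cosineE mulrACA; congr (_ * _); case: eqP; rewrite ?mulr1//.
by rewrite -expr2 sqr_sqrtr.
Qed.

Lemma continuous_cosine (k : nat) : continuous (@cosine R k).
Proof.
rewrite (_ : cosine k = fun x => (if k == 0%N then 1 else Num.sqrt 2) * cos (k%:R * pi * x)).
  by move=> x; apply: cvgM; [exact: cvg_cst | exact: continuous_cos_lin].
by apply/funext => x; exact: cosineE.
Qed.

Lemma int01_cosine2 (k l : nat) : int01 (fun x => cosine k x * cosine l x : R) = (k == l)%:R.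
Proof.
under eq_fun do rewrite !cosineE mulrACA.
rewrite int01Z; last first.
  apply: continuous_integrable01 => x; apply: cvgM; exact: continuous_cos_lin.
rewrite int01_coscos; case: k l => [|k] [|l] /=.
- by rewrite !mul1r -mulr2n mulVf.
- by rewrite addr0 !mulr0.
- by rewrite addr0 !mulr0.
- rewrite -expr2 sqr_sqrtr// addr0 mulrA mulfV ?mul1r//.
Qed.

Lemma sin_le x : 0 <= x -> sin x <= x.
Proof.
move=> x0; have [c _] := @MVT_segment R (@sin R) (@cos R) 0 x x0 (fun y _ => is_derive_sin y)
  (continuous_subspaceT (@continuous_sin R)).
rewrite sin0 !subr0 => ->; rewrite ler_piMl// cos_le1.
Qed.

Lemma norm_sin_le x : `|sin x| <= `|x|.
Proof.
wlog x0 : x / 0 <= x => [h|].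
  have [/h//|xn] := leP 0 x.
  by rewrite -normrN -sinN -[leRHS]normrN h// oppr_ge0 ltW.
rewrite (ger0_norm x0) ler_norml sin_le// andbT.
have [xpi|xpi] := leP x pi.
  by rewrite (@le_trans _ _ 0) ?oppr_le0// sin_ge0_pi// x0.
 rewrite (le_trans _ (sin_geN1 x))// lerN2 (le_trans _ (ltW xpi))//.
by rewrite (le_trans _ (pi_ge2 R))// ler1n.
Qed.

(** With u = pi t / 4, sin (2u) = 2 sin u cos u and the mean value theorem gives sin u >= u cos u;
    as cos^2 u >= 1/2 on this range, sin (2u) >= u >= t / 2. *)
Lemma sin_half_pi_ge t : 0 <= t <= 1 -> t / 2 <= sin (pi * t / 2).
Proof.
move=> /andP[t0 t1]; pose u := pi * t / 4 : R.
have pi0 := pi_gt0 R; have u0 : 0 <= u by rewrite divr_ge0// mulr_ge0// pi_ge0.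
have u2 : 2 * u <= pi / 2.
  rewrite (_ : 2 * u = pi / 2 * t); last by rewrite /u; field.
  by rewrite ler_piMr// divr_ge0// pi_ge0.
rewrite (_ : pi * t / 2 = u *+ 2); last by rewrite /u -mulr_natl; field.
have cu : 2^-1 <= cos u ^+ 2.
  have : 0 <= cos (u *+ 2).
    rewrite cos_ge0_pihalf// -[u *+ 2]mulr_natl u2 andbT (@le_trans _ _ 0)//.
      by rewrite oppr_le0 divr_ge0// pi_ge0.
    by rewrite mulr_ge0.
  rewrite cos_mulr2n; lra.
have cu0 : 0 <= cos u.
  by rewrite cos_ge0_pihalf//; apply/andP; split; lra.
have [c cin] := @MVT_segment R (@sin R) (@cos R) 0 u u0 (fun y _ => is_derive_sin y)
  (continuous_subspaceT (@continuous_sin R)).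
move: cin; rewrite in_itv /= => /andP[c0 cu'].
rewrite sin0 !subr0 sin_mulr2n => ->.
have ccu : cos u <= cos c.
  by rewrite leNgt ltr_cos ?in_itv /= -?leNgt//; apply/andP; split => //; lra.
rewrite -[leRHS]mulr_natl (@le_trans _ _ (2 * (u * cos u ^+ 2)))//.
  apply: (@le_trans _ _ u); last by rewrite mulrCA ler_peMr// -ler_pdivrMl// mulr1.
  rewrite /u (_ : pi * t / 4 = t / 2 * (pi / 2)); last by field.
  by rewrite ler_peMr ?divr_ge0// ler_pdivlMr// mul1r pi_ge2.
rewrite ler_wpM2l// expr2 mulrCA ler_wpM2l// mulrC ler_wpM2r//.
Qed.

End Trigonometry.

(** * Fejer means of cosine series *)

Section Fejer.
Variable R : realType.
Implicit Types (f : R -> R) (x y t u : R) (k N : nat).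

Definition cosine_coef f k : R := int01 (fun y => f y * cosine k y).

(* The natural subtraction truncates at 0, so that the weights vanish for [k > N]. *)
Definition fejer_weight N k : R := (N.+1 - k)%:R / N.+1%:R.

Lemma fejer_weight0 N : fejer_weight N 0 = 1.
Proof. by rewrite /fejer_weight subn0 divff. Qed.

Lemma fejer_weight_ge0 N k : 0 <= fejer_weight N k.
Proof. by rewrite divr_ge0. Qed.

Lemma fejer_weight_le1 N k : fejer_weight N k <= 1.
Proof. by rewrite ler_pdivrMr// mul1r ler_nat leq_subr. Qed.

Definition fejer_mean N f x : R :=
  \sum_(k < N.+1) fejer_weight N k * cosine_coef f k * cosine k x.

Definition fejer_kernel N x y : R :=
  \sum_(k < N.+1) fejer_weight N k * (cosine k x * cosine k y).

Let mult k : R := if k == 0%N then 1 else 2.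

(** The left side is the squared modulus of the sum of the exp (i k u), that is, [N] times the Fejer
    kernel. A new exponential adds 1 and twice its real correlation with the earlier ones; [mult]
    counts [k] and [- k]. *)
Lemma fejer_square N u :
  (\sum_(k < N) cos (k%:R * u)) ^+ 2 + (\sum_(k < N) sin (k%:R * u)) ^+ 2 =
  \sum_(k < N) (N - k)%:R * (mult k * cos (k%:R * u)).
Proof.
elim: N => [|N IH]; first by rewrite !big_ord0 expr0n addr0.
rewrite big_ord_recr [X in _ + X ^+ 2]big_ord_recr /=.
set C := \sum_(k < N) _; set S := \sum_(k < N) _.
have -> : \sum_(k < N.+1) (N.+1 - k)%:R * (mult k * cos (k%:R * u)) =
    \sum_(k < N) (N - k)%:R * (mult k * cos (k%:R * u)) + \sum_(k < N.+1) mult k * cos (k%:R * u).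
  rewrite big_ord_recr [X in _ + X]big_ord_recr /= subSnn mul1r addrA; congr (_ + _).
  rewrite -big_split; apply: eq_bigr => k _ /=.
  by rewrite subSn ?(ltnW (ltn_ord _))// -natr1 mulrDl mul1r.
rewrite -IH big_ord_recl /= /mult mul0r cos0 mulr1.
have -> : \sum_(k < N) 2 * cos ((bump 0 k)%:R * u) = 2 * (C * cos (N%:R * u) + S * sin (N%:R * u)).
  rewrite -mulr_sumr; congr (_ * _); rewrite !mulr_suml -big_split /=.
  rewrite (reindex_inj rev_ord_inj) /=; apply: eq_bigr => k _.
  rewrite -cosB -[RHS]cosN opprB -mulrBl; congr (cos (_ * _)).
  by rewrite /bump /= add1n -subSn ?ltn_ord// subSS natrB// ltnW.
have := cos2Dsin2 (N%:R * u); set c := cos _; set s := sin _ => cs.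
rewrite (_ : _ + _ = C ^+ 2 + S ^+ 2 + ((c ^+ 2 + s ^+ 2) + 2 * (C * c + S * s))); last ring.
by rewrite cs.
Qed.

(** By the product formula for cosines the kernel is half the sum of two classical Fejer kernels, at
    [x - y] and [x + y]. *)
Lemma fejer_kernel_ge0 N x y : 0 <= fejer_kernel N x y.
Proof.
have half t : 0 <= \sum_(k < N.+1) fejer_weight N k * (mult k * cos (k%:R * (pi * t))).
  rewrite /fejer_weight; under eq_bigr do rewrite mulrAC.
  by rewrite -mulr_suml -fejer_square divr_ge0// addr_ge0// sqr_ge0.
have := addr_ge0 (half (x - y)) (half (x + y)); rewrite -big_split /=.
rewrite -[X in _ -> 0 <= X](@mulKf _ 2)// mulrC => h.
apply: mulr_ge0 => //; move: h; congr (_ <= _); rewrite /fejer_kernel mulr_sumr.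
apply: eq_bigr => k _; rewrite cosineM2 -/(mult k).
have := cosM2 (k%:R * pi * x) (k%:R * pi * y); rewrite -mulrBr -mulrDr -!(mulrA k%:R pi) => E.
transitivity (fejer_weight N k * mult k *
  (2 * (cos (k%:R * (pi * x)) * cos (k%:R * (pi * y))))); last ring.
rewrite E (mulrC (x - y)); ring.
Qed.

Lemma fejer_meanE N f x : integrable01 f ->
  fejer_mean N f x = int01 (fun y => f y * fejer_kernel N x y).
Proof.
move=> fi; have fci k : integrable01 (fun y => f y * cosine k y).
  apply: eq_integrable01 (integrable01_mul_continuous (continuous_subspaceT (@continuous_cosine R k)) fi).
  by move=> y _; rewrite mulrC.
rewrite (@eq_int01 _ _ (fun y => \sum_(k < N.+1) fejer_weight N k * cosine k x * (f y * cosine k y))); last first.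
  by move=> y _; rewrite mulr_sumr; apply: eq_bigr => k _; ring.
rewrite int01_sum; last by move=> k; exact: integrable01Z.
by apply: eq_bigr => k _; rewrite int01Z// mulrAC.
Qed.

Lemma continuous_fejer_kernel N x : continuous (fejer_kernel N x).
Proof.
move=> y; apply: cvg_bigsum => k _; apply: cvgM; first exact: cvg_cst.
apply: cvgM; [exact: cvg_cst | exact: continuous_cosine].
Qed.

Lemma int01_fejer_kernel N x : int01 (fejer_kernel N x) = 1.
Proof.
have := fejer_meanE N x (integrable01_cst 1).
under [in RHS]eq_fun do rewrite mul1r.
move=> <-; rewrite /fejer_mean (bigD1 ord0)//= big1 => [|k k0].
  rewrite fejer_weight0 /cosine_coef mul1r mulr1 addr0.
  by rewrite -[RHS](int01_cst 1); apply: eq_int01 => y _; rewrite mul1r.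
rewrite /cosine_coef (@eq_int01 _ _ (fun y => cosine 0 y * cosine k y))//.
by rewrite int01_cosine2 eq_sym (negPf k0 : (k == 0%N :> nat) = false) mulr0 mul0r.
Qed.

(** The squared difference is a cosine polynomial of degree 2 in [y], with coefficients [a], which
    vanishes at [y = x]; its Fejer mean at [x] is therefore due to the damping 1 - k/(N + 1)
    alone. *)
Lemma fejer_moment2 N x : (1 < N)%N ->
  int01 (fun y => (cos (pi * y) - cos (pi * x)) ^+ 2 * fejer_kernel N x y) = N.+1%:R^-1.
Proof.
case: N => [|[|N]]// _; pose c := cos (pi * x); pose r := Num.sqrt 2 : R.
have r2 : r ^+ 2 = 2 by rewrite sqr_sqrtr.
have r0 : r != 0 by rewrite gt_eqF// sqrtr_gt0.
pose a (k : nat) : R := match k with 0 => 2^-1 + c ^+ 2 | 1 => - (2 * c) / r | 2 => (2 * r)^-1 | _ => 0 end.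
have gE y : (cos (pi * y) - c) ^+ 2 = \sum_(k < 3) a k * cosine k y.
  rewrite !big_ord_recl big_ord0 /= mul1r.
  rewrite (_ : 2 * pi * y = (pi * y) *+ 2) -?[RHS]mulr_natl ?mulrA// cos_mulr2n.
  rewrite -/r; by move: (cos (pi * y)) => e; field.
have ci k : integrable01 (@cosine R k) by apply: continuous_integrable01; exact: continuous_cosine.
have gi : integrable01 (fun y => (cos (pi * y) - c) ^+ 2).
  by under eq_fun do rewrite gE; apply: integrable01_sum => k; exact: integrable01Z.
rewrite -fejer_meanE//.
have coefE k : cosine_coef (fun y => (cos (pi * y) - c) ^+ 2) k = \sum_(l < 3) a l * (l == k :> nat)%:R.
  rewrite /cosine_coef (@eq_int01 _ _ (fun y => \sum_(l < 3) a l * (cosine l y * cosine k y))); last first.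
    by move=> y _; rewrite gE mulr_suml; apply: eq_bigr => l _; rewrite mulrA.
  have cci l : integrable01 (fun y => cosine l y * cosine k y : R).
    by apply: continuous_integrable01 => y; apply: cvgM; exact: continuous_cosine.
  rewrite int01_sum => [|l]; last exact: integrable01Z.
  by apply: eq_bigr => l _; rewrite int01Z// int01_cosine2.
have coef3 k : (2 < k)%N -> cosine_coef (fun y => (cos (pi * y) - c) ^+ 2) k = 0.
  move=> k2; rewrite coefE big1// => l _; case: eqP => [lk|]; last by rewrite mulr0.
  by move: k2; rewrite -lk ltnNge -ltnS ltn_ord.
have ext : fejer_mean N.+2 (fun y => (cos (pi * y) - c) ^+ 2) x =
   \sum_(k < 3) fejer_weight N.+2 k * a k * cosine k x.
  have w2 k : fejer_weight N.+2 k * cosine_coef (fun y => (cos (pi * y) - c) ^+ 2) k * cosine k x =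
     fejer_weight N.+2 k * a k * cosine k x.
    have [k2|k2] := ltnP 2 k.
      by rewrite coef3//; case: k k2 => [|[|[|k]]].
    congr (_ * _ * _); rewrite coefE (bigD1 (Ordinal (k2 : (k < 3)%N)))//= eqxx mulr1 big1 ?addr0// => l.
    by rewrite -val_eqE /= => /negPf ->; rewrite mulr0.
  rewrite /fejer_mean; under eq_bigr do rewrite w2.
  rewrite -!(big_mkord xpredT (fun k => fejer_weight N.+2 k * a k * cosine k x)).
  rewrite (big_cat_nat (n := 3))//= [X in _ + X](_ : _ = 0) ?addr0//.
  rewrite big_nat_cond big1// => k /andP[/andP[k2 _] _].
  by case: k k2 => [|[|[|k]]]//= _; rewrite mulr0 mul0r.
rewrite ext !big_ord_recl big_ord0 /= fejer_weight0 mulr1 mul1r addr0.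
rewrite (_ : 2 * pi * x = (pi * x) *+ 2) -?[RHS]mulr_natl ?mulrA// cos_mulr2n -/c -/r.
rewrite mul1r -/c /fejer_weight /bump /= !add1n subSS subn0 subSS.
have -> : (N.+2 - 1)%:R = N.+1%:R :> R by rewrite subSS subn0.
have n0 : N.+3%:R != 0 :> R by rewrite pnatr_eq0.
move: n0; rewrite -[N.+3%:R]natr1 -[N.+2%:R]natr1; move: (N.+1%:R) => m m0.
by field; rewrite m0 r0.
Qed.

(** The difference of cosines factors into the sines of pi (x + y) / 2 and pi (y - x) / 2. Both t =
    x + y and t = |y - x| satisfy d <= t <= 2 - d, where sin (pi t / 2) >= d / 2. *)
Lemma cos_separation x y d : 0 <= x <= 1 -> 0 <= y <= 1 -> 0 < d -> d <= `|y - x| ->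
  d ^+ 4 / 4 <= (cos (pi * y) - cos (pi * x)) ^+ 2.
Proof.
move=> /andP[x0 x1] /andP[y0 y1] d0 dxy.
have d1 : d <= 1 by apply: (le_trans dxy); rewrite ler_norml; apply/andP; split; lra.
have sge t : d <= t -> t <= 2 - d -> d / 2 <= sin (pi * t / 2).
  move=> dt td; have [t1|t1] := leP t 1.
    by apply: (@le_trans _ _ (t / 2)); [lra | apply: sin_half_pi_ge; apply/andP; split; lra].
  rewrite (_ : pi * t / 2 = - (pi * (2 - t) / 2) + pi); last by field.
  rewrite sinDpi sinN opprK.
  by apply: (@le_trans _ _ ((2 - t) / 2)); [lra | apply: sin_half_pi_ge; apply/andP; split; lra].
have s1 : d / 2 <= sin (pi * (x + y) / 2).
  move: dxy; rewrite ler_normr => /orP[] h; apply: sge; lra.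
have s2 : d / 2 <= `|sin (pi * (y - x) / 2)|.
  wlog yx : y x {s1} x0 x1 y0 y1 dxy / x <= y => [h|].
    have [/h|xy] := leP x y; first exact.
    rewrite -normrN -sinN (_ : - _ = pi * (x - y) / 2); last by field.
    by apply: h => //; [rewrite distrC | rewrite ltW].
  rewrite (le_trans _ (ler_norm _))// sge//; last by lra.
  by rewrite (le_trans dxy)// ger0_norm// subr_ge0.
have -> : (cos (pi * y) - cos (pi * x)) ^+ 2 =
    (2 * (sin (pi * (x + y) / 2) * `|sin (pi * (y - x) / 2)|)) ^+ 2.
  rewrite !exprMn real_normK ?num_real// -!exprMn -[X in _ = X](sqrrN) sinM2 opprB; congr (_ ^+ 2).
  by congr (cos _ - cos _); field.
rewrite (_ : d ^+ 4 / 4 = (2 * (d / 2 * (d / 2))) ^+ 2); last by field.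
rewrite ler_pXn2r ?nnegrE//.
- by rewrite ler_wpM2l// ler_pM// divr_ge0// ltW.
- by rewrite mulr_ge0// mulr_ge0// divr_ge0// ltW.
- by rewrite mulr_ge0// mulr_ge0// (le_trans _ s1)// divr_ge0// ltW.
Qed.

Lemma continuous01_bounded f : {within `[0, 1], continuous f} ->
  exists M : R, forall y, 0 <= y <= 1 -> `|f y| <= M.
Proof.
move=> fc; have := compact_bounded (continuous_compact fc (@segment_compact R 0 1)).
move=> [M [Mr h]]; exists (M + 1) => y y01.
by apply: (h (M + 1)); [rewrite ltrDl | exists y; rewrite //= in_itv].
Qed.

Lemma continuous01_dist f x : {within `[0, 1], continuous f} -> 0 <= x <= 1 ->
  forall e : R, 0 < e -> exists2 d : R, 0 < d &
    forall y, 0 <= y <= 1 -> `|y - x| < d -> `|f y - f x| < e.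
Proof.
move=> /subspace_continuousP fc x01 e e0.
have xin : (`[0, 1]%classic : set R) x by rewrite /= in_itv.
have /cvgrPdist_lt /(_ e e0) := fc x xin.
rewrite /within /= => /nbhs_ballP[d /= d0 h]; exists d => // y y01 yx.
rewrite distrC; apply: (h y); last by rewrite /= in_itv.
by rewrite /ball /= distrC.
Qed.

(* Korovkin's argument: [|f y - f x| <= e + C (cos (pi y) - cos (pi x))^2]. *)
Lemma cvg_fejer_mean f x : {within `[0, 1], continuous f} -> 0 <= x <= 1 ->
  fejer_mean N f x @[N --> \oo] --> f x.
Proof.
move=> fc x01; apply/cvgrPdist_lt => e e0.
have [M fM] := continuous01_bounded fc.
have M0 : 0 <= M by rewrite (le_trans _ (fM x x01)).
have e2 : 0 < e / 2 by rewrite divr_gt0.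
have [d d0 fd] := continuous01_dist fc x01 e2.
have fi := continuous01_integrable fc.
(* At distance at least [d] from [x] the difference of values is at most [2 * M], while the squared
   cosine difference is at least [d ^+ 4 / 4]. *)
pose C := 2 * M / (d ^+ 4 / 4).
have m0 : 0 < d ^+ 4 / 4 by rewrite divr_gt0// exprn_gt0.
have C0 : 0 <= C by apply: divr_ge0; [exact: mulr_ge0 | exact: ltW].
have key y : 0 <= y <= 1 -> `|f y - f x| <= e / 2 + C * (cos (pi * y) - cos (pi * x)) ^+ 2.
  move=> y01; have [dxy|dxy] := ltP `|y - x| d.
    by rewrite (le_trans (ltW (fd y y01 dxy)))// lerDl mulr_ge0// sqr_ge0.
  rewrite (@le_trans _ _ (2 * M))//.
    by rewrite (le_trans (ler_normB _ _))// mulr_natl mulr2n lerD// fM.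
  rewrite -[leLHS](@divfK _ (d ^+ 4 / 4)) ?gt_eqF// -/C.
  apply: (@le_trans _ _ (C * (cos (pi * y) - cos (pi * x)) ^+ 2)); last by rewrite lerDr ltW.
  by rewrite ler_wpM2l// cos_separation.
have kc N : {within `[0, 1], continuous (fejer_kernel N x)}.
  exact: continuous_subspaceT (@continuous_fejer_kernel N x).
have ki N : integrable01 (fejer_kernel N x) := continuous01_integrable (kc N).
have gi N : integrable01 (fun y => (cos (pi * y) - cos (pi * x)) ^+ 2 * fejer_kernel N x y).
  apply: continuous_integrable01 => y; apply: cvgM; last exact: continuous_fejer_kernel.
  rewrite expr2; apply: cvgM; apply: cvgB; by [exact: continuous_cos_lin | exact: cvg_cst].
have dist N : (1 < N)%N -> `|f x - fejer_mean N f x| <= e / 2 + C / N.+1%:R.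
  move=> N0; rewrite distrC fejer_meanE//.
  have fki : integrable01 (fun y => f y * fejer_kernel N x y).
    by apply: eq_integrable01 (integrable01_mul_continuous (kc N) fi) => y _; rewrite mulrC.
  have -> : int01 (fun y => f y * fejer_kernel N x y) - f x =
      int01 (fun y => (f y - f x) * fejer_kernel N x y).
    have cK c : int01 (fun y => c * fejer_kernel N x y) = c.
      by rewrite int01Z// int01_fejer_kernel mulr1.
    rewrite -{1}[f x]cK -int01B//; last exact: integrable01Z.
    by apply: eq_int01 => y _; rewrite mulrBl.
  have -> : e / 2 + C / N.+1%:R = int01 (fun y => e / 2 * fejer_kernel N x y +
      C * ((cos (pi * y) - cos (pi * x)) ^+ 2 * fejer_kernel N x y)).
    rewrite int01D; try exact: integrable01Z.
    by rewrite !int01Z// int01_fejer_kernel mulr1 fejer_moment2.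
  apply: int01_norm_le.
  - under eq_fun do rewrite mulrBl; apply: integrable01B => //; exact: integrable01Z.
  - by apply: integrable01D; exact: integrable01Z.
  - move=> y y01; rewrite normrM (ger0_norm (fejer_kernel_ge0 _ _ _)) mulrA -mulrDl.
    by rewrite ler_wpM2r ?fejer_kernel_ge0// key.
near=> N; apply: (le_lt_trans (dist N _)); first by near: N; exact: nbhs_infty_gt.
rewrite [ltRHS](splitr e) ltrD2l ltr_pdivrMr// -ltr_pdivrMl//.
rewrite (lt_trans (_ : _ < N%:R))// ?ltr_nat//.
by near: N; exact: nbhs_infty_gtr.
Unshelve. all: by end_near. Qed.

End Fejer.

(** * Domination of cosine coefficients *)

Section UniformLimits.
Variables (R : realType) (T : choiceType) (D : set T).

Lemma uniform_cvg_dist (g : nat -> T -> R) (f : T -> R) :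
  {uniform D, g @ \oo --> f} -> forall e : R, 0 < e ->
  exists N, forall m x, (N <= m)%N -> D x -> `|g m x - f x| < e.
Proof.
move=> gf e e0.
have : nbhs (f : {uniform` D -> R}) [set h : T -> R | forall x, D x -> ball (f x) e (h x)].
  apply/uniform_nbhs; exists [set xy | ball xy.1 e xy.2]; split => //.
  exact: (@entourage_ball R R (PosNum e0)).
move=> /gf [N _ h]; exists N => m x Nm Dx; rewrite distrC.
by have := h m Nm x Dx; rewrite /ball /=.
Qed.

End UniformLimits.

Section Domination.
Variable R : realType.
Implicit Types (H : prehilbert R R) (s : nat -> R).

(** Stated with partial sums, so that no convergence enters and each inequality passes to limits.
    Continuity makes the coefficients and point values of a uniform limit the limits of those of the
    approximants. *)
Definition dominates H s : Prop :=
  (forall u : rep H, dom u -> {within `[0, 1], continuous (ev u : R -> R)}) /\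
  forall K : nat, psd (@dom R R H) (fun u v => ip u v -
    \sum_(k < K) s k * (cosine_coef (ev u) k * cosine_coef (ev v) k)).

Lemma dominates_psd H s : dominates H s -> psd (@dom R R H) (@ip R R H).
Proof.
by move=> [_ /(_ 0%N)]; apply: psd_eq => u v _ _; rewrite big_ord0 subr0.
Qed.

Lemma cosine_coef_cvg (g : nat -> R -> R) (f : R -> R) (k : nat) :
  (forall m, {within `[0, 1], continuous (g m)}) -> {within `[0, 1], continuous f} ->
  {uniform `[0, 1], g @ \oo --> f} ->
  cosine_coef (g m) k @[m --> \oo] --> cosine_coef f k.
Proof.
move=> gc fc gf; apply/cvgrPdist_le => e e0.
have [N gN] := uniform_cvg_dist gf (divr_gt0 e0 (ltr0n R 2 : 0 < 2%:R)).
exists N => //= m Nm.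
have kc : {within `[0, 1], continuous (@cosine R k)} by exact: continuous_subspaceT (@continuous_cosine R k).
have ci (h : R -> R) : {within `[0, 1], continuous h} -> integrable01 (fun y => h y * cosine k y : R).
  move=> hc; exact: integrable01_mul_continuous hc (continuous01_integrable kc).
have fi := ci f fc; have gi := ci _ (gc m); rewrite /cosine_coef -int01B//.
apply: int01_norm_bound => [|x x01]; first exact: integrable01B.
rewrite -mulrBl normrM distrC.
have c2 : `|cosine k x| <= 2 :> R.
  rewrite cosineE normrM -[leRHS]mulr1 ler_pM ?cos_max//.
  case: eqP; rewrite ?normr1 ?ler1n// => _; rewrite ger0_norm ?sqrtr_ge0//.
  by rewrite -(ler_pXn2r (n := 2)) ?nnegrE ?sqrtr_ge0// sqr_sqrtr// -natrX ler_nat.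
have d := ltW (gN m x Nm (x01 : (`[0, 1]%classic : set R) x)).
by rewrite (le_trans (ler_pM (normr_ge0 _) (normr_ge0 _) d c2))// divfK.
Qed.

Section Completion.
Variables (T : choiceType) (D : set T) (H : prehilbert R T).

(** The sequence that [completion_ip] selects. It depends on the proof [hf], so [completion_ipE]
    appeals to proof irrelevance. *)
Definition picked (f : T -> R) (hf : exists p, approximates D (H := H) p f) : nat -> rep H :=
  projT1 (cid hf).

Lemma picked_approximates f hf : approximates D (@picked f hf) f.
Proof. exact: projT2 (cid hf). Qed.

Lemma completion_ipE f g hf hg :
  completion_ip D H f g = limn (fun m => ip (@picked f hf m) (@picked g hg m)).
Proof.
rewrite /completion_ip; case: pselect => // hf'; case: pselect => // hg'.
by rewrite (Prop_irrelevance hf' hf) (Prop_irrelevance hg' hg).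
Qed.

Lemma cvg_completion_ip f g hf hg : psd (@dom R T H) (@ip R T H) ->
  ip (@picked f hf m) (@picked g hg m) @[m --> \oo] --> completion_ip D H f g.
Proof.
move=> psdH; rewrite (completion_ipE hf hg).
have [pd pc _] := picked_approximates hf; have [qd qc _] := picked_approximates hg.
exact: (cvg_kernel psdH pd qd pc qc).
Qed.

End Completion.

(** Along the picked sequences, inner products converge by [cvg_kernel] and coefficients by uniform
    convergence; a quadratic inequality in finitely many elements passes to the limit. *)
Lemma dominates_completion (H : prehilbert R R) s :
  dominates H s -> dominates (completion (`[0, 1]%classic : set R) H) s.
Proof.
move=> Hs; have psdH := dominates_psd Hs.
have fc f : (exists p, approximates (`[0, 1]%classic : set R) (H := H) p f) ->
    {within `[0, 1], continuous f}.
  move=> [p [dp _ pf]].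
  have near_c : \forall m \near \oo, {within `[0, 1], continuous (ev (p m) : R -> R)}.
    by exists 0%N => // m _; exact: Hs.1.
  exact: uniform_limit_continuous_subspace near_c pf.
split=> [|K]; first exact: fc.
pose Ker (u v : rep H) := ip u v - \sum_(k < K) s k * (cosine_coef (ev u) k * cosine_coef (ev v) k).
have cvgK f g hf hg : Ker (@picked _ (`[0, 1]%classic : set R) H f hf m) (@picked _ (`[0, 1]%classic : set R) H g hg m) @[m --> \oo] -->
    completion_ip (`[0, 1]%classic : set R) H f g -
      \sum_(k < K) s k * (cosine_coef f k * cosine_coef g k).
  apply: cvgB; first exact: (cvg_completion_ip hf hg psdH).
  have cc h hh k : cosine_coef (ev (@picked _ (`[0, 1]%classic : set R) H h hh m)) k @[m --> \oo] --> cosine_coef h k.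
    have [dp _ pf] := picked_approximates hh.
    by apply: cosine_coef_cvg => // [m|]; [exact: Hs.1 | exact: fc].
  apply: cvg_bigsum => k _; apply: cvgM; first exact: cvg_cst.
  by apply: cvgM; exact: cc.
split=> [f g hf hg|n f t hf] /=.
  rewrite -(cvg_lim (@norm_hausdorff _ _) (cvgK f g hf hg)).
  rewrite -(cvg_lim (@norm_hausdorff _ _) (cvgK g f hg hf)); congr (limn _).
  apply/funext => m; have [dp _ _] := picked_approximates hf; have [dq _ _] := picked_approximates hg.
  exact: (Hs.2 K).1.
apply: (@cvgn_ge _ (fun m => \sum_i \sum_j t i * t j * Ker (picked (hf i) m) (picked (hf j) m))).
  apply: cvg_bigsum => i _; apply: cvg_bigsum => j _; apply: cvgM; first exact: cvg_cst.
  exact: cvgK.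
move=> m; apply: (Hs.2 K).2 => i; by have [dp _ _] := picked_approximates (hf i).
Qed.

End Domination.

(** * Iterated integrals over the cube *)

Section CubeIntegral.
Variable R : realType.

Definition slice (d : nat) (F : 'rV[R]_d.+1 -> R) (t : R) : 'rV[R]_d -> R :=
  fun x => F (row_mx (const_mx t : 'rV_1) x).

Lemma cube_intS d (F : 'rV[R]_d.+1 -> R) :
  cube_int F = int01 (fun t => cube_int (slice F t)).
Proof. by []. Qed.

(** Regularity tailored to iterated integrals: it holds for finite sums of products of continuous
    functions, is closed under uniform approximation, and makes [cube_int] Lipschitz for the uniform
    norm. It stands in for joint continuity and Fubini's theorem. *)
Fixpoint cube_integrable (d : nat) : ('rV[R]_d -> R) -> Prop :=
  match d with
  | 0%N => fun=> True
  | d'.+1 => fun F =>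
      (forall t, 0 <= t <= 1 -> cube_integrable (slice F t)) /\
      {within `[0, 1], continuous (fun t => cube_int (slice F t))}
  end.

Lemma row_mx_ord0 d (t : R) (x : 'rV[R]_d) :
  (row_mx (const_mx t : 'rV_1) x : 'rV_d.+1) ord0 ord0 = t.
Proof.
have E := row_mxEl (const_mx t : 'rV_1) x ord0 ord0; rewrite [RHS]mxE in E.
rewrite -[RHS]E; congr (fun_of_matrix _ _ _); exact: val_inj.
Qed.

Lemma row_mx_lift d (t : R) (x : 'rV[R]_d) (j : 'I_d) :
  (row_mx (const_mx t : 'rV_1) x : 'rV_d.+1) ord0 (lift ord0 j) = x ord0 j.
Proof.
rewrite -(row_mxEr (const_mx t : 'rV_1) x ord0 j).
congr (fun_of_matrix _ _ _); exact: val_inj.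
Qed.

Lemma cube_row_mx d (t : R) (x : 'rV[R]_d) : 0 <= t <= 1 -> cube (R := R) (d := d) x ->
  cube (R := R) (d := d.+1) (row_mx (const_mx t : 'rV_1) x).
Proof.
move=> t01 xc j; case: (unliftP ord0 j) => [i ->|->]; last by rewrite row_mx_ord0.
by rewrite row_mx_lift; exact: xc.
Qed.

Lemma cube_int_dist d (F G : 'rV[R]_d -> R) (e : R) :
  cube_integrable F -> cube_integrable G ->
  (forall x, cube (R := R) (d := d) x -> `|F x - G x| <= e) -> `|cube_int F - cube_int G| <= e.
Proof.
elim: d F G => [|d IH] F G.
  by move=> _ _ /= h; apply: h => -[].
move=> [Fs Fc] [Gs Gc] FG; rewrite !cube_intS -int01B; try exact: continuous01_integrable.
apply: int01_norm_bound => [|t t01].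
  by apply: integrable01B; exact: continuous01_integrable.
apply: IH => [||x xc]; [exact: Fs | exact: Gs |].
by apply: FG; exact: cube_row_mx.
Qed.

Lemma continuous01_approx (f : R -> R) :
  (forall e : R, 0 < e -> exists2 g : R -> R, {within `[0, 1], continuous g} &
     forall x, 0 <= x <= 1 -> `|g x - f x| <= e) ->
  {within `[0, 1], continuous f}.
Proof.
move=> fg; apply/subspace_continuousP => x; rewrite /= in_itv /= => x01.
apply/cvgrPdist_lt => e e0.
have e4 : 0 < e / 4 by rewrite divr_gt0.
have [g gc gf] := fg _ e4.
have [d d0 gd] := continuous01_dist gc x01 e4.
rewrite /within /=; apply/nbhs_ballP; exists d => //= y; rewrite /ball /= => xy.
rewrite in_itv /= => y01; have := gd y y01; rewrite distrC => /(_ xy).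
have := gf x x01; have := gf y y01.
move=> gyf gxf gyx; rewrite (_ : f x - f y = (g y - f y) - (g x - f x) - (g y - g x)); last ring.
rewrite (le_lt_trans (ler_normB _ _))// (@le_lt_trans _ _ (e / 4 + e / 4 + e / 4))//.
  by rewrite lerD ?(ltW gyx)// (le_trans (ler_normB _ _))// lerD.
by rewrite -!mulrDl ltr_pdivrMr//; move: (e : R) (e0 : 0 < (e : R)) => r r0; lra.
Qed.

Lemma cube_integrable_approx d (F : 'rV[R]_d -> R) :
  (forall e : R, 0 < e -> exists2 G : 'rV[R]_d -> R, cube_integrable G &
     forall x, cube (R := R) (d := d) x -> `|G x - F x| <= e) ->
  cube_integrable F.
Proof.
elim: d F => [//|d IH] F FG; have Fs t : 0 <= t <= 1 -> cube_integrable (slice F t).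
  move=> t01; apply: IH => e e0; have [G [Gs _] GF] := FG e e0.
  exists (slice G t); first exact: Gs.
  by move=> x xc; apply: GF; exact: cube_row_mx.
split=> //; apply: continuous01_approx => e e0; have [G [Gs Gc] GF] := FG e e0.
exists (fun t => cube_int (slice G t)) => // t t01.
apply: cube_int_dist => [||x xc]; [exact: Gs | exact: Fs |].
by apply: GF; exact: cube_row_mx.
Qed.

Lemma continuous01_sum (I : Type) (r : seq I) (f : I -> R -> R) :
  (forall i, {within `[0, 1], continuous (f i)}) ->
  {within `[0, 1], continuous (fun x => \sum_(i <- r) f i x)}.
Proof. by move=> fc x; apply: cvg_bigsum => i _; exact: fc. Qed.

(** The coefficients [a k] make the induction work: slicing at [t] absorbs the first factor
    [f k ord0 t] into them. *)
Lemma cube_int_sum_prod d (m : nat) (a : 'I_m -> R) (f : 'I_m -> 'I_d -> R -> R) :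
  (forall k j, {within `[0, 1], continuous (f k j)}) ->
  let F := fun x : 'rV[R]_d => \sum_(k < m) a k * \prod_(j < d) f k j (x ord0 j) in
  cube_integrable F /\ cube_int F = \sum_(k < m) a k * \prod_(j < d) int01 (f k j).
Proof.
elim: d a f => [|d IH] a f fc F.
  by split=> //; apply: eq_bigr => k _; rewrite !big_ord0.
have sliceE t : slice F t = fun x => \sum_(k < m) (a k * f k ord0 t) *
    \prod_(j < d) f k (lift ord0 j) (x ord0 j).
  apply/funext => x; apply: eq_bigr => k _; rewrite big_ord_recl row_mx_ord0 mulrA.
  by congr (_ * _); apply: eq_bigr => j _; rewrite row_mx_lift.
have H t := IH (fun k => a k * f k ord0 t) (fun k j => f k (lift ord0 j))
  (fun k j => fc k (lift ord0 j)).
have intE : (fun t => cube_int (slice F t)) = fun t => \sum_(k < m)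
    (a k * \prod_(j < d) int01 (f k (lift ord0 j))) * f k ord0 t.
  by apply/funext => t; rewrite sliceE (H t).2; apply: eq_bigr => k _; rewrite mulrAC.
split.
  split=> [t _|]; first by rewrite sliceE; exact: (H t).1.
  rewrite intE; apply: continuous01_sum => k x; apply: cvgM; first exact: cvg_cst.
  exact: fc.
have fi k j : integrable01 (f k j) by exact: continuous01_integrable.
rewrite cube_intS intE int01_sum => [|k]; last exact: integrable01Z.
by apply: eq_bigr => k _; rewrite int01Z// big_ord_recl mulrAC mulrA.
Qed.

End CubeIntegral.

(** * Quadrature error on the algebraic tensor product *)

Section TensorError.
Variables (R : realType) (n d : nat) (a : R) (Gamma : 'I_d -> R) (z : 'I_d -> nat).
Variables (H : 'I_d -> prehilbert R R).
Hypotheses (n_prime : prime n) (a_gt : 1 / 2 < a) (Gamma_gt0 : forall j, 0 < Gamma j).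

(** The square of r for smoothness [a] and weight [G] in the half-period cosine space. *)
Definition sobolev_weight (G : R) (k : nat) : R :=
  if k == 0%N then 1 else (G ^+ 2)^-1 * k%:R `^ (2 * a).

Hypothesis H_dom : forall j, dominates (H j) (sobolev_weight (Gamma j)).

Let mult (k : nat) : R := if k == 0%N then 1 else 2.

Lemma sobolev_weight_gt0 (G : R) k : 0 < G -> 0 < sobolev_weight G k.
Proof.
move=> G0; rewrite /sobolev_weight; case: eqP => // /eqP k0.
by rewrite mulr_gt0 ?invr_gt0 ?exprn_gt0 ?powR_gt0// ltr0n lt0n.
Qed.

Lemma tent_lattice_in01 i j : 0 <= tent_lattice R n z i ord0 j <= 1.
Proof.
have n0 := prime_gt0 n_prime; rewrite mxE /tent fracpart_div//.
have : 0 <= ((i * z j) %% n)%:R / n%:R :> R by rewrite divr_ge0.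
have : ((i * z j) %% n)%:R / n%:R <= 1 :> R.
  by rewrite ler_pdivrMr ?ltr0n// mul1r ler_nat ltnW// ltn_mod.
move: (_ / _) => y y1 y0; have : `|2 * y - 1| <= 1 by rewrite ler_norml; apply/andP; split; lra.
by have := normr_ge0 (2 * y - 1) => ? ?; apply/andP; split; lra.
Qed.

Lemma cosine_tent i j (k : nat) : cosine k (tent_lattice R n z i ord0 j) =
  Num.sqrt (mult k) * cosF R (k%:R * (i * z j)%:R : 'F_n).
Proof.
have n0 := prime_gt0 n_prime; have nR : n%:R != 0 :> R by rewrite pnatr_eq0 -lt0n.
rewrite cosineE mxE fracpart_div// -(Fp_nat_mod n_prime (i * z j)) -natrM cosF_nat//.
congr (_ * _).
  by rewrite /mult; case: eqP => //; rewrite sqrtr1.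
set m := ((i * z j) %% n)%N; rewrite natrM /tent.
set y : R := m%:R / n%:R; have -> : 2 * pi * (k%:R * m%:R) / n%:R = 2 * pi * k%:R * y :> R.
  by rewrite /y; field.
have [y2|y2] := leP (2 * y) 1.
  by rewrite ler0_norm; [congr cos; ring | rewrite subr_le0].
(* On the second half the tent is 2 - 2y, and cos (k pi (2 - 2y)) = cos (2 pi k y) by evenness and
   periodicity. *)
rewrite gtr0_norm ?subr_gt0// -cosN -(cosDnat k); congr cos; ring.
Qed.

Definition freq N := {ffun 'I_d -> 'I_N.+1}.

Let zero N : freq N := [ffun=> ord0].

Definition lattice_cos N (l : freq N) : R :=
  wavg (fun i : 'F_n => \prod_(j < d) cosF R (i * ((l j : nat)%:R * (z j)%:R))) 0.

Lemma quadrature_cosine N (l : freq N) :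
  quadrature n (tent_lattice R n z) (fun x => \prod_(j < d) cosine (l j) (x ord0 j)) =
  (\prod_(j < d) Num.sqrt (mult (l j))) * lattice_cos l.
Proof.
rewrite /quadrature /lattice_cos (sum_Fp n_prime) wavg0 mulrCA; congr (_ * _).
rewrite mulr_sumr; apply: eq_bigr => i _; rewrite -big_split; apply: eq_bigr => j _ /=.
by rewrite cosine_tent natrM natr_Zp mulrCA.
Qed.

Lemma lattice_cos_zero N : lattice_cos (zero N) = 1.
Proof.
rewrite /lattice_cos (eq_wavg (h := fun=> 1)) => [|i]; first by rewrite wavg1 ?eqxx.
by rewrite big1// => j _; rewrite ffunE mul0r mulr0 cosF0.
Qed.

(** Expanding the truncated product by distributivity over the components yields every frequency
    vector of the box once; taking out the zero vector accounts for the [-1]. *)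
Lemma sum_lattice_cos N :
  \sum_(l : freq N | l != zero N)
     (\prod_(j < d) (mult (l j) / sobolev_weight (Gamma j) (l j))) * lattice_cos l =
  -1 + wavg (cbc_prod_sum a Gamma N d z : 'F_n -> R) 0.
Proof.
have all : \sum_(l : freq N)
    (\prod_(j < d) (mult (l j) / sobolev_weight (Gamma j) (l j))) * lattice_cos l =
    wavg (cbc_prod_sum a Gamma N d z : 'F_n -> R) 0.
  rewrite wavg0; under eq_bigr do rewrite /lattice_cos wavg0 mulrCA mulr_sumr.
  rewrite -mulr_sumr exchange_big /=; congr (_ * _); apply: eq_bigr => i _.
  under eq_bigr do rewrite -big_split /=.
  rewrite -(bigA_distr_bigA (fun j (k : 'I_N.+1) => mult k / sobolev_weight (Gamma j) k *
     cosF R (i * ((k : nat)%:R * (z j)%:R)))).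
  rewrite /cbc_prod_sum; under [RHS]eq_bigl do rewrite ltn_ord.
  apply: eq_bigr => j _; rewrite big_ord_recl /= /mult /sobolev_weight /= divr1 mul1r mul0r mulr0 cosF0.
  rewrite /omega_sum big_add1 /= big_mkord mulr_sumr; congr (_ + _); apply: eq_bigr => k _.
  rewrite /bump /= add1n natrM natr_Zp powRN invfM invrK (mulrCA i).
  by rewrite !mulrA; congr (_ * _); ring.
have p1 : \prod_(j < d) (mult (zero N j) / sobolev_weight (Gamma j) (zero N j)) = 1.
  by apply: big1 => j _; rewrite ffunE /mult /sobolev_weight /= divr1.
rewrite -all [in RHS](bigD1 (zero N))// lattice_cos_zero p1.
set S := (X in X = _); set S' := (X in _ = -1 + _ X).
rewrite -[RHS]/(-1 + (1 * 1 + S')); rewrite mulr1 addKr //.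
Qed.

Lemma quadrature_sum (I : finType) (F : I -> 'rV[R]_d -> R) x :
  quadrature n x (fun y => \sum_i F i y) = \sum_i quadrature n x (F i).
Proof. by rewrite /quadrature exchange_big mulr_sumr. Qed.

Lemma quadratureZ (c : R) (F : 'rV[R]_d -> R) x :
  quadrature n x (fun y => c * F y) = c * quadrature n x F.
Proof. by rewrite /quadrature -mulr_sumr mulrCA. Qed.

Variable u : tensor_sum H.
Hypothesis u_dom : dom (p := alg_tensor H) u.

Let f (k : 'I_(tag u)) (j : 'I_d) : R -> R := ev (tagged u k j).

Let fc k j : {within `[0, 1], continuous (f k j)}.
Proof. exact: (H_dom j).1. Qed.

Definition tensor_coef N (l : freq N) : R :=
  \sum_(k < tag u) \prod_(j < d) cosine_coef (f k j) (l j).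

(** Componentwise domination multiplies by [psd_prod_sub]. Evaluating the resulting form on the pure
    tensors of [u], all with coefficient 1, gives Bessel's inequality in the tensor product. *)
Lemma tensor_bessel N :
  \sum_(l : freq N) (\prod_(j < d) sobolev_weight (Gamma j) (l j)) * tensor_coef l ^+ 2 <=
  @ip _ _ (alg_tensor H) u u.
Proof.
pose T := forall j, rep (H j); pose P : set T := [set x : T | forall j, dom (x j)].
pose L (j : 'I_d) (x y : T) := \sum_(k < N.+1) sobolev_weight (Gamma j) k *
  (cosine_coef (ev (x j)) k * cosine_coef (ev (y j)) k).
have psdL j : psd P (L j).
  by apply: psd_sum => k; apply: psd_rank1; rewrite ltW// sobolev_weight_gt0.
have psdHL j : psd P (fun x y => ip (x j) (y j) - L j x y).
  apply: (psd_comp (f := fun x : T => x j) _ ((H_dom j).2 N.+1)).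
  by move=> x; exact.
have := (psd_prod_sub (index_enum 'I_d) psdL psdHL).2 (tag u) (tagged u) (fun=> 1) u_dom.
under eq_bigr do under eq_bigr do rewrite !mul1r.
under eq_bigr do rewrite sumrB.
rewrite sumrB subr_ge0; apply: le_trans; rewrite le_eqVlt; apply/orP; left; apply/eqP.
transitivity (\sum_(k < tag u) \sum_(k' < tag u) \sum_(l : freq N)
   (\prod_(j < d) sobolev_weight (Gamma j) (l j)) *
   ((\prod_(j < d) cosine_coef (f k j) (l j)) * \prod_(j < d) cosine_coef (f k' j) (l j))).
  under [RHS]eq_bigr do rewrite exchange_big /=.
  rewrite [RHS]exchange_big /=; apply: eq_bigr => l _.
  rewrite expr2 /tensor_coef mulr_suml mulr_sumr; apply: eq_bigr => k _.
  by rewrite !mulr_sumr.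
apply: eq_bigr => k _; apply: eq_bigr => k' _; rewrite /L bigA_distr_bigA.
by apply: eq_bigr => l _; rewrite -!big_split.
Qed.

Definition fejer_tensor N (x : 'rV[R]_d) : R :=
  \sum_(k < tag u) \prod_(j < d) fejer_mean N (f k j) (x ord0 j).

Lemma fejer_tensorE N : fejer_tensor N = fun x => \sum_(l : freq N)
  ((\prod_(j < d) fejer_weight R N (l j)) * tensor_coef l) * \prod_(j < d) cosine (l j) (x ord0 j).
Proof.
apply/funext => x; rewrite /fejer_tensor; under eq_bigr do rewrite /fejer_mean bigA_distr_bigA.
rewrite exchange_big /=; apply: eq_bigr => l _.
rewrite /tensor_coef mulr_sumr mulr_suml; apply: eq_bigr => k _.
by rewrite !big_split.
Qed.

Lemma fejer_tensor_error N :
  (\sum_(k < tag u) \prod_(j < d) int01 (f k j) -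
     quadrature n (tent_lattice R n z) (fejer_tensor N)) ^+ 2 <=
  @ip _ _ (alg_tensor H) u u * (-1 + wavg (cbc_prod_sum a Gamma N d z : 'F_n -> R) 0).
Proof.
pose S (l : freq N) := \prod_(j < d) sobolev_weight (Gamma j) (l j).
have S0 l : 0 < S l by apply: prodr_gt0 => j _; exact: sobolev_weight_gt0.
pose W (l : freq N) := \prod_(j < d) fejer_weight R N (l j).
pose A (l : freq N) := (\prod_(j < d) Num.sqrt (mult (l j))) * lattice_cos l.
have W01 l : 0 <= W l <= 1.
  apply/andP; split; first by apply: prodr_ge0 => j _; exact: fejer_weight_ge0.
  by apply: prodr_ile1 => j _; rewrite fejer_weight_ge0 fejer_weight_le1.
have int0 : \sum_(k < tag u) \prod_(j < d) int01 (f k j) = tensor_coef (zero N).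
  apply: eq_bigr => k _; apply: eq_bigr => j _; rewrite ffunE.
  by apply: eq_int01 => y _; rewrite /= mulr1.
have A0 : A (zero N) = 1.
  by rewrite /A lattice_cos_zero big1 ?mulr1// => j _; rewrite ffunE /mult /= sqrtr1.
have W0 : W (zero N) = 1 by apply: big1 => j _; rewrite ffunE fejer_weight0.
have -> : \sum_(k < tag u) \prod_(j < d) int01 (f k j) -
    quadrature n (tent_lattice R n z) (fejer_tensor N) =
    - \sum_(l : freq N | l != zero N) S l * (tensor_coef l * (W l * A l / S l)).
  rewrite fejer_tensorE quadrature_sum int0.
  under eq_bigr do rewrite quadratureZ quadrature_cosine -/(A _) -/(W _).
  (* Fejer weight and quadrature value are both 1 at the zero frequency, so that term is the exact
     integral and cancels. *)
  rewrite (bigD1 (zero N))//= A0 W0 mul1r mulr1 opprD addrA subrr add0r; congr (- _).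
  by apply: eq_bigr => l _; field; rewrite gt_eqF.
rewrite sqrrN.
(* Cauchy-Schwarz is used for this diagonal kernel; the weight 0 at the zero vector restricts both
   sums to the nonzero frequencies. *)
have psdS : psd [set: freq N -> R] (fun v w => \sum_(l <- index_enum (freq N)) (if l != zero N then S l else 0) * (v l * w l)).
  by apply: psd_sum => l; apply: psd_rank1; case: ifP => // _; exact: ltW.
have := @psd_cauchy_schwarz _ _ _ _ (@tensor_coef N) (fun l : freq N => W l * A l / S l) psdS I I.
have nz (F G : freq N -> R) : \sum_(l <- index_enum (freq N)) (if l != zero N then F l else 0) * G l =
    \sum_(l : freq N | l != zero N) F l * G l.
  by rewrite [RHS]big_mkcond; apply: eq_bigr => l _; case: ifP; rewrite ?mul0r.
rewrite !nz => h; apply: (le_trans h).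
apply: ler_pM.
- by apply: sumr_ge0 => l _; rewrite mulr_ge0 ?(ltW (S0 l))// -expr2 sqr_ge0.
- by apply: sumr_ge0 => l _; rewrite mulr_ge0 ?(ltW (S0 l))// -expr2 sqr_ge0.
- apply: le_trans (tensor_bessel N); rewrite [leLHS]big_mkcond; apply: ler_sum => l _.
  by case: ifP => _; [rewrite -expr2 | apply: mulr_ge0; [exact: ltW (S0 _) | exact: sqr_ge0]].
rewrite -sum_lattice_cos; apply: ler_sum => l _.
have /andP[a0 a1] : 0 <= lattice_cos l <= 1.
  rewrite /lattice_cos (eq_wavg (h := fun i => \prod_(j <- index_enum 'I_d) cosF R (i * ((l j : nat)%:R * (z j)%:R))))//.
  exact: wavg_cos_prod.
rewrite (_ : S l * _ = (W l ^+ 2 * A l ^+ 2) / S l); last by field; rewrite gt_eqF.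
have -> : \prod_(j < d) (mult (l j) / sobolev_weight (Gamma j) (l j)) = (\prod_(j < d) mult (l j)) / S l.
  by rewrite prodf_div.
rewrite [leRHS]mulrAC ler_wpM2r ?invr_ge0 ?(ltW (S0 l))//.
have -> : A l ^+ 2 = (\prod_(j < d) mult (l j)) * lattice_cos l ^+ 2.
  rewrite /A exprMn -prodrXl; congr (_ * _); apply: eq_bigr => j _.
  by rewrite sqr_sqrtr// /mult; case: ifP.
have m0 : 0 <= \prod_(j < d) mult (l j) by apply: prodr_ge0 => j _; rewrite /mult; case: ifP.
have W2 : W l ^+ 2 <= 1 by have /andP[? ?] := W01 l; rewrite expr_le1.
rewrite (@le_trans _ _ (1 * (\prod_(j < d) mult (l j) * lattice_cos l ^+ 2)))//.
  by rewrite ler_wpM2r// mulr_ge0// sqr_ge0.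
by rewrite mul1r ler_wpM2l// expr2 ler_piMl.
Qed.

(** The limit of [fejer_tensor_error] in [N]: Fejer means converge at the lattice points, which lie
    in the closed cube, and the truncated criterion converges to [cbc_E2]. *)
Lemma tensor_error :
  (cube_int (@ev _ _ (alg_tensor H) u) -
     quadrature n (tent_lattice R n z) (@ev _ _ (alg_tensor H) u)) ^+ 2 <=
  @ip _ _ (alg_tensor H) u u * cbc_E2 n a Gamma d z.
Proof.
have evE : @ev _ _ (alg_tensor H) u = fun x : 'rV[R]_d => \sum_(k < tag u) 1 * \prod_(j < d) f k j (x ord0 j).
  by apply/funext => x /=; apply: eq_bigr => k _; rewrite mul1r.
rewrite {1}evE (cube_int_sum_prod (fun=> 1) fc).2.
under eq_bigr do rewrite mul1r.
rewrite -subr_ge0.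
apply: (@cvgn_ge _ (fun N => @ip _ _ (alg_tensor H) u u * (-1 + wavg (cbc_prod_sum a Gamma N d z : 'F_n -> R) 0) -
  (\sum_(k < tag u) \prod_(j < d) int01 (f k j) -
     quadrature n (tent_lattice R n z) (fejer_tensor N)) ^+ 2)); last first.
  by move=> N; rewrite subr_ge0 fejer_tensor_error.
apply: cvgB.
  apply: cvgM; first exact: cvg_cst.
  rewrite cbc_E2_wavg//; apply: cvgD; first exact: cvg_cst.
  by apply: cvg_wavg => i; exact: cvg_cbc_prod_sum.
have qc : quadrature n (tent_lattice R n z) (fejer_tensor N) @[N --> \oo] -->
    quadrature n (tent_lattice R n z) (@ev _ _ (alg_tensor H) u).
  apply: cvgM; first exact: cvg_cst.
  apply: cvg_bigsum => i _; apply: cvg_bigsum => k _; apply: cvg_bigprod => j _.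
  by apply: cvg_fejer_mean; [exact: fc | exact: tent_lattice_in01].
rewrite expr2; under eq_cvg do rewrite expr2.
by apply: cvgM; (apply: cvgB; [exact: cvg_cst | exact: qc]).
Qed.

End TensorError.

(** * Worst-case error on the Hilbert tensor product *)

Section WorstCaseError.
Variables (R : realType) (n d : nat) (a : R) (Gamma : 'I_d -> R) (z : 'I_d -> nat).
Variables (H : 'I_d -> prehilbert R R).
Hypotheses (n_prime : prime n) (a_gt : 1 / 2 < a) (Gamma_gt0 : forall j, 0 < Gamma j).
Hypothesis H_dom : forall j, dominates (H j) (sobolev_weight a (Gamma j)).

Let D : set 'rV[R]_d := cube (R := R) (d := d).

Lemma alg_tensor_psd : psd (@dom _ _ (alg_tensor H)) (@ip _ _ (alg_tensor H)).
Proof.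
pose T := forall j, rep (H j); pose P : set T := [set x : T | forall j, dom (x j)].
have psdP : psd P (fun x y : T => \prod_(j < d) ip (x j) (y j)).
  apply: psd_prod => j; apply: (psd_comp (f := fun x : T => x j) _ (dominates_psd (H_dom j))).
  by move=> x; exact.
have := @psd_combinations R T P _ (tensor_sum H) (@dom _ _ (alg_tensor H)) (fun s => tag s)
  (fun s => tagged s) (fun _ _ => 1) psdP (fun s ds k => ds k).
apply: psd_eq => s t _ _ /=; apply: eq_bigr => k _; apply: eq_bigr => l _.
by rewrite !mul1r.
Qed.

Lemma alg_tensor_cube_integrable (u : rep (alg_tensor H)) : dom u -> cube_integrable (ev u).
Proof.
move=> du; have fc k j : {within `[0, 1], continuous (ev (tagged u k j) : R -> R)}.
  exact: (H_dom j).1.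
have := (cube_int_sum_prod (fun=> 1) fc).1; congr cube_integrable; apply/funext => x /=.
by apply: eq_bigr => k _; rewrite mul1r.
Qed.

(** Integral and quadrature pass to the uniform limit of the picked sequence and the squared norm by
    [cvg_completion_ip]. For the integral, [f] inherits [cube_integrable] from the approximants. *)
Lemma hilbert_tensor_error (f : 'rV[R]_d -> R) :
  dom (p := hilbert_tensor H) f ->
  (cube_int f - quadrature n (tent_lattice R n z) f) ^+ 2 <=
    @ip _ _ (hilbert_tensor H) f f * cbc_E2 n a Gamma d z.
Proof.
move=> hf; pose p := @picked R 'rV[R]_d D (alg_tensor H) f hf.
have [dp pc pf] : approximates D p f by exact: picked_approximates.
have ipc := cvg_completion_ip hf hf alg_tensor_psd.
have fint : cube_integrable f.
  apply: cube_integrable_approx => e e0; have [N pN] := uniform_cvg_dist pf e0.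
  exists (ev (p N)); first exact: alg_tensor_cube_integrable.
  by move=> x xc; rewrite ltW// pN.
have intc : cube_int (ev (p m)) @[m --> \oo] --> cube_int f.
  apply/cvgrPdist_le => e e0; have [N pN] := uniform_cvg_dist pf e0.
  exists N => //= m Nm; rewrite distrC; apply: cube_int_dist => //.
    exact: alg_tensor_cube_integrable.
  by move=> x xc; rewrite ltW// pN.
have evc x : D x -> ev (p m) x @[m --> \oo] --> f x.
  move=> xD; apply/cvgrPdist_lt => e e0; have [N pN] := uniform_cvg_dist pf e0.
  by exists N => //= m Nm; rewrite distrC pN.
have quadc : quadrature n (tent_lattice R n z) (ev (p m)) @[m --> \oo] -->
    quadrature n (tent_lattice R n z) f.
  apply: cvgM; first exact: cvg_cst.
  by apply: cvg_bigsum => i _; apply: evc => j; exact: tent_lattice_in01.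
rewrite -subr_ge0.
apply: (@cvgn_ge _ (fun m => @ip _ _ (alg_tensor H) (p m) (p m) * cbc_E2 n a Gamma d z -
  (cube_int (ev (p m)) - quadrature n (tent_lattice R n z) (ev (p m))) ^+ 2)); last first.
  by move=> m; rewrite subr_ge0 tensor_error.
apply: cvgB; first by apply: cvgM; [exact: ipc | exact: cvg_cst].
rewrite expr2; under eq_cvg do rewrite expr2.
by apply: cvgM; apply: cvgB.
Qed.

Lemma wce_hilbert_tensor (B : R) : 0 <= B -> 0 <= cbc_E2 n a Gamma d z <= B ^+ 2 ->
  (wce (hilbert_tensor H) n (tent_lattice R n z) <= B%:E)%E.
Proof.
move=> B0 /andP[E0 EB]; apply: ub_ereal_sup => _ [f [df f1] <-]; rewrite lee_fin.
rewrite -(ler_pXn2r (n := 2)) ?nnegrE// real_normK ?num_real//.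
apply: (le_trans (hilbert_tensor_error df)); apply: le_trans EB.
rewrite -[leRHS]mul1r ler_wpM2r//.
by move: f1; rewrite /hnorm -{1}sqrtr1 ler_sqrt.
Qed.

End WorstCaseError.

Lemma wce_cbc_le (R : realType) (n d : nat) (a lambda : R) (Gamma : 'I_d -> R) (z : 'I_d -> nat)
    (H : 'I_d -> prehilbert R R) :
  prime n -> 1 / 2 <= lambda < a -> (forall j, 0 < Gamma j) ->
  (forall j, dominates (H j) (sobolev_weight a (Gamma j))) ->
  cbc_vector n a Gamma z ->
  (wce (hilbert_tensor H) n (tent_lattice R n z) <=
    (((\prod_(j < d) (1 + 2 * Gamma j `^ lambda^-1 * zeta (a / lambda)) - 1) /
      (n%:R - 1)) `^ lambda)%:E)%E.
Proof.
move=> n_prime /andP[l12 la] Gamma0 Hdom cbc.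
have l0 : 0 < lambda by rewrite (lt_le_trans _ l12)// divr_gt0.
have a12 : 1 / 2 < a := le_lt_trans l12 la.
(* From [1 / 2 <= lambda] follows [q <= 1], from [lambda < a] follows [2 * a * q = a / lambda > 1].
   Moreover [Gamma j ^+ 2] to the power [q] is [Gamma j] to the power [lambda^-1], and the power
   [2 * lambda] undoes [q]. *)
pose q := (2 * lambda)^-1.
have q01 : 0 < q <= 1.
  by rewrite invr_gt0 mulr_gt0//= invf_le1 ?mulr_gt0// mulrC -ler_pdivrMr.
have q0 := (andP q01).1.
have aqE : 2 * a * q = a / lambda by rewrite /q; field; rewrite gt_eqF.
have aq : 1 < 2 * a * q by rewrite aqE ltr_pdivlMr// mul1r.
have G0 j : 0 <= Gamma j by exact: ltW.
have bound := cbc_error_bound n_prime a12 q01 aq cbc (leqnn d).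
have E0 := cbc_E2_ge0 Gamma n_prime a12 z (leqnn d).
have VE : cbc_volume a Gamma q d = \prod_(j < d) (1 + 2 * Gamma j `^ lambda^-1 * zeta (a / lambda)).
  rewrite /cbc_volume; apply: eq_big => [j|j _]; first by rewrite ltn_ord.
  rewrite aqE -powR_mulrn// -powRrM; congr (1 + 2 * _ `^ _ * _).
  by rewrite /q; field; rewrite gt_eqF.
rewrite -VE; set B := (_ / _) in bound *.
have B0 : 0 <= B by exact: le_trans (powR_ge0 _ _) bound.
apply: (wce_hilbert_tensor n_prime a12 Gamma0 Hdom); first exact: powR_ge0.
rewrite E0 /= -powR_mulrn ?powR_ge0// -powRrM.
have qE : q * (lambda * 2) = 1 by rewrite /q; field; rewrite gt_eqF.
have EE : cbc_E2 n a Gamma d z = (cbc_E2 n a Gamma d z `^ q) `^ (lambda * 2).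
  by rewrite -powRrM qE powRr1.
by rewrite EE ge0_ler_powR ?nnegrE ?powR_ge0// mulr_ge0// ltW.
Qed.

(** * Affine changes of variables and singular powers *)

Section AffineChange.
Variable R : realType.
Local Notation mu := (@lebesgue_measure R).
Variables (c s : R).
Hypothesis c0 : c != 0.

Let phi : measurableTypeR R -> measurableTypeR R := fun x => c * x + s.

Let mphi : measurable_fun [set: measurableTypeR R] phi.
Proof.
apply: continuous_measurable_fun => x; apply: cvgD; last exact: cvg_cst.
exact: continuous_mull.
Qed.

(** By uniqueness of Lebesgue measure it is enough to compare half-open intervals; a negative [c]
    swaps the closed end, which does not change the length. *)
Lemma affine_preimage_measure (A : set R) : measurable A ->
  mu A = ((`|c|)%:E * mu (phi @^-1` A))%E.
Proof.
have c0' : 0 <= `|c| by [].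
move=> mA; have := @lebesgue_measure_unique R
  (mscale (NngNum c0') (pushforward mu phi) : measure (measurableTypeR R) R) _ A mA.
rewrite /mscale /= /pushforward; apply => _ [[a b] _ <-] /=.
rewrite -[LHS]/(mu `]a, b]%classic) lebesgue_measure_itv /= lte_fin.
have [cp|cn] := ltP 0 c.
  rewrite [X in _ = (_ * lebesgue_measure X)%E](_ : _ = `](a - s) / c, (b - s) / c]%classic); last first.
    apply/seteqP; split => x /=; rewrite !in_itv /= /phi ltr_pdivrMr// ler_pdivlMr//;
      by rewrite (mulrC x) ltrBlDr lerBrDr.
  rewrite lebesgue_measure_itv /= lte_fin ltr_pM2r ?invr_gt0// ltrD2r gtr0_norm//.
  case: ifP => _; last by rewrite mule0.
  by rewrite -!EFinB -EFinM; congr (_%:E); field.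
have cn' : c < 0 by rewrite lt_neqAle c0.
rewrite [X in _ = (_ * lebesgue_measure X)%E](_ : _ = `[(b - s) / c, (a - s) / c[%classic); last first.
  apply/seteqP; split => x /=; rewrite !in_itv /= /phi ltr_ndivlMr// ler_ndivrMr//;
    by rewrite (mulrC x) ltrBlDr lerBrDr andbC.
rewrite lebesgue_measure_itv /= lte_fin ltr_nM2r ?invr_lt0// ltrD2r ltr0_norm//.
case: ifP => _; last by rewrite mule0.
by rewrite -!EFinB -EFinM; congr (_%:E); field.
Qed.

Lemma ge0_integral_affine (D : set R) (f : R -> \bar R) : measurable D ->
  measurable_fun [set: R] f -> (forall x, 0 <= f x)%E ->
  (\int[mu]_(x in D) f x = (`|c|)%:E * \int[mu]_(x in phi @^-1` D) f (c * x + s)%R)%E.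
Proof.
move=> mD mf f0; have c0' : 0 <= `|c| by [].
have mfD : measurable_fun D f by exact: measurable_funS mf.
rewrite -[X in _ = (_ * X)%E](@ge0_integral_pushforward _ _ (measurableTypeR R) (measurableTypeR R) R phi mphi mu D f)//.
rewrite -(@ge0_integral_mscale _ _ _ (pushforward mu phi) D mD (NngNum c0'))//.
apply: eq_measure_integral => A mA _; exact: affine_preimage_measure.
Qed.

End AffineChange.

(** * Reflections, translations and periodic integrands *)

Section Isometries.
Variable R : realType.
Local Notation mu := (@lebesgue_measure R).

Lemma integral_isometry (c s : R) (D : set R) (f : R -> \bar R) : `|c| = 1 -> measurable D ->
  measurable_fun [set: R] f ->
  (\int[mu]_(x in [set x | D (c * x + s)%R]) f (c * x + s)%R = \int[mu]_(x in D) f x)%E.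
Proof.
move=> c1 mD mf; have c0 : c != 0 by rewrite -normr_eq0 c1 oner_neq0.
have aff (g : R -> \bar R) : measurable_fun [set: R] g -> (forall x, 0 <= g x)%E ->
    (\int[mu]_(x in [set x | D (c * x + s)%R]) g (c * x + s)%R = \int[mu]_(x in D) g x)%E.
  by move=> mg g0; rewrite [RHS](ge0_integral_affine s c0 mD mg g0) c1 mul1e.
rewrite integralE [RHS]integralE; congr (_ - _)%E.
  rewrite -(aff _ (measurable_funepos mf) (funepos_ge0 f)).
  by apply: eq_integral => x _; rewrite !funeposE.
rewrite -(aff _ (measurable_funeneg mf) (funeneg_ge0 f)).
by apply: eq_integral => x _; rewrite !funenegE.
Qed.

Lemma integrable_isometry (c s : R) (D : set R) (f : R -> R) : `|c| = 1 -> measurable D ->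
  measurable_fun [set: R] f -> mu.-integrable D (EFin \o f) ->
  mu.-integrable [set x | D (c * x + s)] (fun x => (f (c * x + s))%:E).
Proof.
move=> c1 mD mf /integrableP[_ fi].
have mphi : measurable_fun [set: R] (fun x : R => c * x + s).
  apply: continuous_measurable_fun => x; apply: cvgD; last exact: cvg_cst.
  exact: continuous_mull.
apply/integrableP; split.
  apply/measurable_EFinP; apply: (@measurable_funS _ _ _ _ [set: R]) => //.
  exact: measurableT_comp.
have mabs : measurable_fun [set: R] (fun x => `|(f x)%:E|%E).
  by apply: measurableT_comp => //; exact/measurable_EFinP.
by rewrite (integral_isometry s c1 mD mabs).
Qed.

Lemma Rintegral_add (f : R -> R) (a b c : R) : a <= b -> b <= c ->
  mu.-integrable `[a, c] (EFin \o f) ->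
  \int[mu]_(x in `[a, c]) f x = \int[mu]_(x in `[a, b]) f x + \int[mu]_(x in `[b, c]) f x.
Proof.
move=> ab bc fi.
have /= := Rintegral_itvB fi _ _ => /(_ b).
rewrite !bnd_simp => /(_ ab bc); rewrite Rintegral_itv_obnd_cbnd.
  by move=> <-; rewrite addrC subrK.
apply: integrableS fi => // x /=; rewrite !in_itv /= => /andP[bx ->].
by rewrite andbT ltW// (le_lt_trans ab).
Qed.

Lemma ge0_integral_split (g : R -> \bar R) (a b c : R) : a <= b -> b <= c ->
  measurable_fun [set: R] g -> (forall y, 0 <= g y)%E ->
  (\int[mu]_(y in `[a, c]) g y = \int[mu]_(y in `[a, b]) g y + \int[mu]_(y in `[b, c]) g y)%E.
Proof.
move=> ab bc mg g0; rewrite -(integral_itv_obnd_cbnd (r := b)); last exact: measurable_funTS.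
rewrite -ge0_integral_setU//; [|exact: measurable_funTS|].
  congr (integral _ _ _); apply/seteqP; split => y /=; rewrite !in_itv /=.
    by move=> /andP[-> ->]; rewrite andbT /=; case: leP => h; [left|right].
  move=> [/andP[-> yb]|/andP[by_ ->]]; first by rewrite (le_trans yb bc).
  by rewrite andbT (le_trans ab)// ltW.
apply/disj_setPS => y /=; rewrite !in_itv /= => -[/andP[_ yb] /andP[by_ _]].
by have := lt_le_trans by_ yb; rewrite ltxx.
Qed.

Lemma integrable_cat (f : R -> R) (a b c : R) : a <= b -> b <= c -> measurable_fun [set: R] f ->
  mu.-integrable `[a, b] (EFin \o f) -> mu.-integrable `[b, c] (EFin \o f) ->
  mu.-integrable `[a, c] (EFin \o f).
Proof.
move=> ab bc mf /integrableP[_ fab] /integrableP[_ fbc]; apply/integrableP; split.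
  by apply/measurable_EFinP; exact: measurable_funTS.
rewrite (ge0_integral_split ab bc)//; first exact: lte_add_pinfty.
by apply: measurableT_comp => //; exact/measurable_EFinP.
Qed.

(* The nonnegative case needs no integrability; the general case follows by
   splitting into positive and negative parts. *)
Lemma ge0_integral_periodic (g : R -> \bar R) (x : R) : 0 <= x <= 1 ->
  measurable_fun [set: R] g -> (forall y, 0 <= g y)%E -> (forall y, g (y + 2) = g y) ->
  (\int[mu]_(y in `[(-1)%R, 1%R]) g y = \int[mu]_(y in `[(x - 1)%R, (x + 1)%R]) g y)%E.
Proof.
move=> /andP[x0 x1] mg g0 per.
have [l1 l2 l3] : [/\ -1 <= x - 1, x - 1 <= 1 & 1 <= x + 1] by split; lra.
rewrite (ge0_integral_split l1 l2 mg g0) (ge0_integral_split l2 l3 mg g0).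
rewrite addeC; congr (_ + _)%E.
(* The piece over [-1, x - 1] is translated by one period onto [1, x + 1]. *)
have := @integral_isometry 1 2 `[1, x + 1]%classic g (normr1 _) (measurable_itv _) mg.
move=> <-; under [RHS]eq_integral do rewrite mul1r per.
congr (integral _ _ _); apply/seteqP; split => y /=; rewrite !in_itv /= mul1r => /andP[? ?];
  by apply/andP; split; lra.
Qed.

Lemma integral_periodic (g : R -> \bar R) (x : R) : 0 <= x <= 1 ->
  measurable_fun [set: R] g -> (forall y, g (y + 2) = g y) ->
  (\int[mu]_(y in `[(-1)%R, 1%R]) g y = \int[mu]_(y in `[(x - 1)%R, (x + 1)%R]) g y)%E.
Proof.
move=> x01 mg per; rewrite integralE [RHS]integralE; congr (_ - _)%E.
  apply: ge0_integral_periodic => //; first exact: measurable_funepos.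
  by move=> y; rewrite !funeposE per.
apply: ge0_integral_periodic => //; first exact: measurable_funeneg.
by move=> y; rewrite !funenegE per.
Qed.

Lemma integral_reflect (f : R -> R) (s a b : R) : measurable_fun [set: R] f ->
  \int[mu]_(t in `[a, b]) f (s - t) = \int[mu]_(y in `[s - b, s - a]) f y.
Proof.
move=> mf; have mfE : measurable_fun [set: R] (EFin \o f) by exact/measurable_EFinP.
rewrite /Rintegral; congr fine.
have := @integral_isometry (-1) s `[s - b, s - a]%classic _ (normrN1 _) (measurable_itv _) mfE.
move=> <-; rewrite (_ : [set x | _] = `[a, b]%classic).
  by apply: eq_integral => t _ /=; rewrite mulN1r addrC.
by apply/seteqP; split => y /=; rewrite !in_itv /= mulN1r => /andP[? ?]; apply/andP; split; lra.
Qed.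

Lemma integral_shift (f : R -> R) (s a b : R) : measurable_fun [set: R] f ->
  \int[mu]_(t in `[a, b]) f (s + t) = \int[mu]_(y in `[s + a, s + b]) f y.
Proof.
move=> mf; have mfE : measurable_fun [set: R] (EFin \o f) by exact/measurable_EFinP.
rewrite /Rintegral; congr fine.
have := @integral_isometry 1 s `[s + a, s + b]%classic _ (normr1 _) (measurable_itv _) mfE.
move=> <-; rewrite (_ : [set x | _] = `[a, b]%classic).
  by apply: eq_integral => t _ /=; rewrite mul1r addrC.
by apply/seteqP; split => y /=; rewrite !in_itv /= mul1r => /andP[? ?]; apply/andP; split; lra.
Qed.

Lemma integrable_reflect (f : R -> R) (s a b : R) : measurable_fun [set: R] f ->
  mu.-integrable `[s - b, s - a] (EFin \o f) ->
  mu.-integrable `[a, b] (fun t => (f (s - t))%:E).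
Proof.
move=> mf fi; have := @integrable_isometry (-1) s `[s - b, s - a]%classic f (normrN1 _) (measurable_itv _) mf fi.
rewrite (_ : [set x | _] = `[a, b]%classic).
  by congr (is_true (integrable _ _ _)); apply/funext => t /=; rewrite mulN1r addrC.
by apply/seteqP; split => y /=; rewrite !in_itv /= mulN1r => /andP[? ?]; apply/andP; split; lra.
Qed.

(** Both sides are the integral of [G] over one period, unfolded around 0 on the left and around [x]
    on the right. Integrability is assumed around [x], where the singularity of the later integrands
    sits at [t = 0], and carried over by reflection and periodicity. *)
Lemma int01_periodic_shift (G : R -> R) (x : R) : 0 <= x <= 1 ->
  measurable_fun [set: R] G -> (forall y, G (y + 2) = G y) ->
  integrable01 (fun t => G (x - t)) -> integrable01 (fun t => G (x + t)) ->
  int01 (fun y => G y + G (- y)) = int01 (fun t => G (x - t) + G (x + t)).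
Proof.
move=> x01 mG per minusi plusi; have mGx : measurable_fun [set: R] (fun t => G (x - t)).
  apply: (measurableT_comp mG); apply: continuous_measurable_fun => t.
  by apply: cvgB; [exact: cvg_cst | exact: cvg_id].
have sub (a b c e : R) (f : R -> \bar R) : a <= c -> e <= b -> mu.-integrable `[a, b] f -> mu.-integrable `[c, e] f.
  move=> ac eb; apply: integrableS => // y /=; rewrite !in_itv /= => /andP[cy ye].
  by rewrite (le_trans ac cy) (le_trans ye eb).
have Gi : mu.-integrable `[-1, 1] (EFin \o (fun t => G (x - t))).
  apply: (@integrable_cat _ (-1) 0 1) => //.
  have mGp : measurable_fun [set: R] (fun t => G (x + t)).
    apply: (measurableT_comp mG); apply: continuous_measurable_fun => t.
    by apply: cvgD; [exact: cvg_cst | exact: cvg_id].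
  have := @integrable_reflect _ 0 (-1) 0 mGp; rewrite subr0 opprK add0r.
  move=> /(_ plusi); congr (is_true (integrable _ _ _)); apply/funext => t /=.
  by rewrite sub0r.
have Gix : mu.-integrable `[x - 1, x + 1] (EFin \o G).
  have := @integrable_reflect _ x (x - 1) (x + 1) mGx.
  have -> : x - (x + 1) = -1 by ring.
  have -> : x - (x - 1) = 1 by ring.
  move=> /(_ Gi); congr (is_true (integrable _ _ _)); apply/funext => t /=.
  by rewrite subKr.
have GiE : mu.-integrable `[-1, 1] (EFin \o G).
  have /integrableP[_ fin] := Gix; apply/integrableP; split.
    by apply/measurable_EFinP; exact: measurable_funTS.
  rewrite (integral_periodic x01)//.
    by apply: measurableT_comp => //; exact/measurable_EFinP.
  by move=> y /=; rewrite per.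
have mfE : measurable_fun [set: R] (EFin \o G) by exact/measurable_EFinP.
have negi : integrable01 (fun y => G (- y)).
  have := @integrable_reflect G 0 0 1 mG; rewrite !sub0r oppr0 => h.
  have := h (sub _ _ _ _ _ _ _ GiE); rewrite lexx ler01 => /(_ isT isT).
  by congr (is_true (integrable _ _ _)); apply/funext => t /=; rewrite sub0r.
have posi : integrable01 G by apply: sub GiE => //; rewrite lerN10.
rewrite int01D// [RHS]int01D// /int01.
rewrite (@integral_reflect G x) ?(@integral_shift G x)// !addr0 subr0.
rewrite -Rintegral_add ?lerBlDr ?lerDl//.
have -> : \int[mu]_(y in `[0, 1]) G (- y) = \int[mu]_(y in `[-1, 0]) G y.
  have := @integral_reflect G 0 0 1 mG; rewrite !sub0r oppr0 => <-.
  by under [RHS]eq_Rintegral do rewrite sub0r.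
rewrite addrC -Rintegral_add ?lerN10//.
by rewrite /Rintegral; congr fine; apply: integral_periodic => // y /=; rewrite per.
Qed.

(** The intervals [1/(n + 1), 1] exhaust ]0, 1]; on each, the explicit antiderivative bounds the
    integral by 1/(q + 1), and monotone convergence concludes. *)
Lemma integrable01_powR (q : R) : -1 < q -> integrable01 (fun t => t `^ q).
Proof.
move=> q1; have mp : measurable_fun [set: R] (fun t : R => t `^ q) by exact: measurable_powR.
have mpE : measurable_fun [set: R] (fun t : R => (t `^ q)%:E) by exact/measurable_EFinP.
have q10 : 0 < q + 1 by lra.
apply/integrableP; split; first by apply: measurable_funTS.
under eq_integral do rewrite gee0_abs ?lee_fin ?powR_ge0//.
rewrite -integral_itv_obnd_cbnd; last exact: measurable_funTS.
pose F (n : nat) : set R := `[n.+1%:R^-1, 1]%classic.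
have FU : \bigcup_n F n = `]0, 1]%classic.
  apply/seteqP; split => x /=.
    by move=> [n _]; rewrite /F /= !in_itv /= => /andP[nx ->]; rewrite andbT (lt_le_trans _ nx).
  rewrite in_itv /= => /andP[x0 x1]; exists (Num.trunc x^-1) => //.
  rewrite /F /= in_itv /= x1 andbT -[leRHS]invrK lef_pV2 ?posrE ?invr_gt0 ?ltr0n//.
  by rewrite ltW// truncnS_gt.
have cvgF := @ge0_nondecreasing_set_cvg_integral _ (measurableTypeR R) R F (fun t => (t `^ q)%:E) mu.
rewrite -FU; apply: (@le_lt_trans _ _ ((q + 1)^-1)%:E); last by rewrite ltry.
have {}cvgF : (\int[mu]_(t in F i) (t `^ q)%:E)%E @[i --> \oo] --> (\int[mu]_(t in \bigcup_i F i) (t `^ q)%:E)%E.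
  apply: cvgF.
  - move=> m n mn; apply/subsetPset => x; rewrite /F /= !in_itv /= => /andP[mx ->].
    by rewrite andbT (le_trans _ mx)// lef_pV2 ?posrE// ler_nat ltnS.
  - by move=> i; exact: measurable_itv.
  - by move=> i; exact: measurable_funTS.
  - by move=> i x _; rewrite lee_fin powR_ge0.
rewrite -(cvg_lim _ cvgF)//; apply: lime_le; first by apply/cvg_ex; eexists; exact: cvgF.
near=> n; rewrite /F.
have dF (x : R) : 0 < x -> is_derive x 1 (fun x : R => (q + 1)^-1 * x `^ (q + 1)) (x `^ q).
  move=> x0; have dx : derivable (fun x : R => x `^ (q + 1)) x 1.
    by apply: derivable_powR; rewrite in_itv /= andbT.
  have d1 : is_derive x 1 (fun x : R => x `^ (q + 1)) ((q + 1) * x `^ q).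
    apply: DeriveDef => //; rewrite -derive1E powR_derive1 ?in_itv /= ?andbT//.
    by rewrite addrK.
  apply: is_derive_eq (is_deriveZ (q + 1)^-1 d1) _.
  by rewrite /GRing.scale /= mulrA mulVf ?mul1r// gt_eqF.
have n0 : 0 < n.+1%:R^-1 :> R by rewrite invr_gt0.
have cont (x : R) : 0 < x -> {for x, continuous (fun t : R => t `^ q)}.
  move=> x0; apply: differentiable_continuous; apply/derivable1_diffP.
  by apply: derivable_powR; rewrite in_itv /= andbT.
have contF (x : R) : 0 < x -> {for x, continuous (fun t : R => (q + 1)^-1 * t `^ (q + 1))}.
  move=> x0; apply: differentiable_continuous; apply/derivable1_diffP.
  exact: (@ex_derive _ _ _ _ _ _ _ (dF x x0)).
have n1 : n.+1%:R^-1 < 1 :> R.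
  rewrite invf_lt1 ?ltr0n// ltr1n ltnS; near: n; exact: nbhs_infty_gt.
rewrite (@continuous_FTC2 _ (fun t => t `^ q) (fun x : R => (q + 1)^-1 * x `^ (q + 1)))//.
- rewrite -EFinB lee_fin powR1 mulr1 lerBlDr lerDl mulr_ge0 ?powR_ge0// invr_ge0 ltW//.
- apply: continuous_in_subspaceT => x; rewrite inE /= in_itv /= => /andP[nx _].
  exact: cont (lt_le_trans n0 nx).
- split => [x||].
  + by rewrite in_itv /= => /andP[nx _]; exact: (@ex_derive _ _ _ _ _ _ _ (dF x (lt_trans n0 nx))).
  + by apply: cvg_at_right_filter; exact: contF.
  + by apply: cvg_at_left_filter; exact: contF.
- move=> x; rewrite in_itv /= => /andP[nx _]; rewrite derive1E.
  exact: (@derive_val _ _ _ _ _ _ _ (dF x (lt_trans n0 nx))).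
Unshelve. all: by end_near. Qed.

End Isometries.

(** * The singular kernel of the fractional seminorms *)

Section SingularKernel.
Variables (R : realType) (p : R).
Hypotheses (p1 : 1 < p) (p3 : p < 3).
Local Notation mu := (@lebesgue_measure R).

(** The exponent [p] is 2a + 1 below order one and 2a - 1 above it. At even [t] the value is 0,
    because 0 to a nonzero power is 0 by convention. *)
Definition sin_kernel (t : R) : R := `|sin (pi * t / 2)| `^ (- p).

Let p0 : - p != 0. Proof. by rewrite oppr_eq0 gt_eqF// (lt_trans ltr01). Qed.

Lemma sin_kernel_ge0 t : 0 <= sin_kernel t. Proof. exact: powR_ge0. Qed.

Lemma sin_kernelN t : sin_kernel (- t) = sin_kernel t.
Proof. by rewrite /sin_kernel mulrN mulNr sinN normrN. Qed.

Lemma sin_kernel_periodic t : sin_kernel (t + 2) = sin_kernel t.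
Proof.
rewrite /sin_kernel (_ : pi * (t + 2) / 2 = pi * t / 2 + pi); last by field.
by rewrite sinDpi normrN.
Qed.

Lemma measurable_sin_kernel : measurable_fun [set: R] sin_kernel.
Proof.
apply: (@measurableT_comp _ _ _ _ _ _ (fun x : R => x `^ (- p))); first exact: measurable_powR.
apply: measurableT_comp => //; apply: continuous_measurable_fun => t.
apply: (@continuous_comp _ _ _ (fun t : R => pi * t / 2) (@sin R)); last exact: continuous_sin.
by apply: cvgM; [exact: continuous_mull | exact: cvg_cst].
Qed.

(** The last premise deals with the convention that 0 to the power [- p] is 0, under which the
    inequality fails for [x = 0 < y]. *)
Lemma powRN_le (x y : R) : 0 <= x -> x <= y -> (x = 0 -> y = 0) -> y `^ (- p) <= x `^ (- p).
Proof.
move=> x0 xy xy0; have [x00|xn] := eqVneq x 0; first by rewrite xy0// x00.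
have xp : 0 < x by rewrite lt_def xn.
rewrite !powRN lef_pV2 ?posrE ?powR_gt0 ?(lt_le_trans xp)//.
have pge0 : 0 <= p by rewrite ltW// (lt_trans ltr01).
by rewrite ge0_ler_powR ?nnegrE // (le_trans x0).
Qed.

Lemma sin_kernel_le t : 0 <= t <= 1 -> sin_kernel t <= (t / 2) `^ (- p).
Proof.
move=> t01; have st := sin_half_pi_ge t01; have /andP[t0 t1] := t01.
have h0 : 0 <= t / 2 by rewrite divr_ge0.
rewrite /sin_kernel ger0_norm ?(le_trans h0)//; apply: powRN_le => // /eqP.
by rewrite mulf_eq0 invr_eq0 pnatr_eq0 orbF => /eqP ->; rewrite mulr0 mul0r sin0.
Qed.

Lemma sin_kernel_ge t : 0 <= t <= 1 -> (pi * t / 2) `^ (- p) <= sin_kernel t.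
Proof.
move=> t01; have st := sin_half_pi_ge t01; have /andP[t0 t1] := t01.
have h0 : 0 <= t / 2 by rewrite divr_ge0.
have u0 : 0 <= pi * t / 2 by rewrite divr_ge0// mulr_ge0// pi_ge0.
rewrite /sin_kernel; apply: powRN_le => //.
  by rewrite (le_trans (norm_sin_le _))// ger0_norm.
move=> /eqP; rewrite normr_eq0 => /eqP s0.
have t00 : t = 0 by apply/eqP; rewrite eq_le t0 andbT; move: st; rewrite s0; lra.
by rewrite t00 mulr0 mul0r.
Qed.

Lemma powR_sqr_mul t : 0 <= t -> t ^+ 2 * (t / 2) `^ (- p) <= 2 `^ p * t `^ (2 - p).
Proof.
move=> t0; rewrite powRM ?invr_ge0//.
have -> : 2^-1 `^ (- p) = 2 `^ p :> R.
  by rewrite -powR_inv1// -powRrM mulN1r opprK.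
rewrite mulrA mulrC ler_wpM2l ?powR_ge0//.
have [->|tn] := eqVneq t 0; first by rewrite expr0n mul0r powR_ge0.
by rewrite -powR_mulrn// -powRD ?tn ?implybT.
Qed.

(** A double zero at the origin leaves a multiple of t^(2 - p), whose exponent exceeds -1 because
    [p < 3]. *)
Lemma integrable01_quadratic_kernel (h : R -> R) (C : R) : measurable_fun [set: R] h ->
  (forall t, 0 <= t <= 1 -> `|h t| <= C * t ^+ 2) -> integrable01 (fun t => h t * sin_kernel t).
Proof.
move=> mh hC; have qi : integrable01 (fun t => C * (2 `^ p * t `^ (2 - p))).
  do 2 apply: integrable01Z; apply: integrable01_powR; have -> : -1 = 2 - 3 :> R by ring.
  by rewrite ltrD2l ltrN2.
apply: le_integrable qi => //.
  apply/measurable_EFinP; apply: measurable_funTS; apply: measurable_funM => //.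
  exact: measurable_sin_kernel.
move=> t; rewrite /= in_itv /= => t01; rewrite lee_fin.
have /andP[t0 _] := t01.
rewrite normrM (ger0_norm (sin_kernel_ge0 t)).
rewrite (le_trans _ (ler_norm _))//.
apply: (@le_trans _ _ (C * t ^+ 2 * (t / 2) `^ (- p))).
  by apply: ler_pM => //; [exact: sin_kernel_ge0 | exact: hC | exact: sin_kernel_le].
have C0 : 0 <= C.
  have := hC 1; rewrite expr1n mulr1 ler01 lexx => /(_ isT); exact: le_trans.
by rewrite -mulrA ler_wpM2l// powR_sqr_mul.
Qed.

Lemma integrable01_kernel (u v : R -> R) (U V : R) : continuous u -> continuous v ->
  (forall t, 0 <= t <= 1 -> `|u t| <= U * t) -> (forall t, 0 <= t <= 1 -> `|v t| <= V * t) ->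
  integrable01 (fun t => u t * v t * sin_kernel t).
Proof.
move=> uc vc uU vV; apply: (@integrable01_quadratic_kernel _ (U * V)).
  by apply: measurable_funM; exact: continuous_measurable_fun.
move=> t t01; rewrite normrM (_ : U * V * t ^+ 2 = (U * t) * (V * t)); last ring.
by rewrite ler_pM// ?uU ?vV.
Qed.

End SingularKernel.

(** * Diagonalization of the singular double integral *)

Section TrigonometricFamilies.
Variable R : realType.
Implicit Types (x y t : R) (k l : nat) (b : bool).

(** The boolean lets one computation serve cosine polynomials, for order below one, and their
    derivatives, which are sine polynomials, for order above one. *)
Definition trig b k x : R := if b then cos (k%:R * pi * x) else sin (k%:R * pi * x).

Lemma continuous_trig b k : continuous (trig b k).
Proof. by case: b; [exact: continuous_cos_lin | exact: continuous_sin_lin]. Qed.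

Lemma trig_periodic b k x : trig b k (x + 2) = trig b k x.
Proof.
rewrite /trig (_ : k%:R * pi * (x + 2) = k%:R * pi * x + 2 * pi * k%:R); last ring.
by rewrite cosDnat sinDnat.
Qed.

Lemma cosB_le x y : `|cos x - cos y| <= `|x - y|.
Proof.
have := sinM2 ((y + x) / 2) ((y - x) / 2).
rewrite (_ : (y + x) / 2 - (y - x) / 2 = x); last by field.
rewrite (_ : (y + x) / 2 + (y - x) / 2 = y); last by field.
move=> <-; rewrite !normrM (ger0_norm (ler0n R 2)) distrC.
have := norm_sin_le ((y - x) / 2); rewrite normrM (ger0_norm (_ : 0 <= 2^-1))// => h.
rewrite mulrA (@le_trans _ _ (2 * `|sin ((y - x) / 2)|)) ?ler_wpM2r//; last by lra.
by rewrite ler_piMr// sin_max.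
Qed.

Lemma sinB_le x y : `|sin x - sin y| <= `|x - y|.
Proof.
by have := cosB_le (x - pi / 2) (y - pi / 2); rewrite !cosBpihalf opprB addrA subrK.
Qed.

Lemma trig_lipschitz b k x y : `|trig b k x - trig b k y| <= k%:R * pi * `|x - y|.
Proof.
have -> : k%:R * pi * `|x - y| = `|k%:R * pi * x - k%:R * pi * y|.
  by rewrite -mulrBr normrM ger0_norm// mulr_ge0// pi_ge0.
by case: b; [exact: cosB_le | exact: sinB_le].
Qed.

(** Each difference splits into a part even in [t] and a part odd in [t]; adding the contributions
    of [t] and [- t] cancels the mixed products and separates [x] from [t]. *)
Lemma trig_product_identity b k l x t :
  (trig b k x - trig b k (x - t)) * (trig b l x - trig b l (x - t)) +
  (trig b k x - trig b k (x + t)) * (trig b l x - trig b l (x + t)) =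
  2 * ((1 - trig true k t) * (1 - trig true l t)) * (trig b k x * trig b l x) +
  2 * (trig false k t * trig false l t) * (trig (~~ b) k x * trig (~~ b) l x).
Proof.
case: b; rewrite /trig /= !mulrBr !mulrDr; [rewrite !cosB !cosD | rewrite !sinB !sinD]; ring.
Qed.

Lemma int01_trig b k l : int01 (fun x => trig b k x * trig b l x) =
  2^-1 * ((k == l)%:R + (if b then 1 else -1) * ((k == 0) && (l == 0))%N%:R).
Proof.
case: b; rewrite /trig ?int01_coscos ?int01_sinsin ?mul1r//.
by rewrite mulN1r.
Qed.

End TrigonometricFamilies.

Section DoubleIntegral.
Variables (R : realType) (p : R).
Hypotheses (p1 : 1 < p) (p3 : p < 3).
Variables (b : bool) (N : nat) (c d : 'I_N -> R).
Local Notation ker := (sin_kernel p).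

(** The moment of |1 - exp (i k pi t)|^2, the symbol of the difference operator at frequency [k]. *)
Definition kernel_moment (k : nat) : R :=
  int01 (fun t => ((1 - trig true k t) ^+ 2 + trig false k t ^+ 2) * ker t).

Let f x := \sum_k c k * trig b k x.
Let g x := \sum_k d k * trig b k x.

Let fc (e : 'I_N -> R) : continuous (fun x => \sum_k e k * trig b k x).
Proof.
move=> x; apply: cvg_bigsum => k _; apply: cvgM; first exact: cvg_cst.
exact: continuous_trig.
Qed.

Let lip (e : 'I_N -> R) : exists L : R, forall x y,
  `|\sum_k e k * trig b k x - \sum_k e k * trig b k y| <= L * `|x - y|.
Proof.
exists (\sum_k `|e k| * (k%:R * pi)) => x y; rewrite -sumrB mulr_suml.
rewrite (le_trans (ler_norm_sum _ _ _))// ler_sum// => k _.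
by rewrite -mulrBr normrM -mulrA ler_wpM2l// trig_lipschitz.
Qed.

Let cont_shift (h : R -> R) x (s : bool) : continuous h ->
  continuous (fun t => h x - h (if s then x + t else x - t)).
Proof.
move=> hc t; apply: cvgB; first exact: cvg_cst.
case: s.
  apply: (@continuous_comp _ _ _ (fun t => x + t) h); last exact: hc.
  by apply: cvgD; [exact: cvg_cst | exact: cvg_id].
apply: (@continuous_comp _ _ _ (fun t => x - t) h); last exact: hc.
by apply: cvgB; [exact: cvg_cst | exact: cvg_id].
Qed.

Let shift_integrable x (s : bool) : integrable01 (fun t =>
  (f x - f (if s then x + t else x - t)) * (g x - g (if s then x + t else x - t)) * ker t).
Proof.
have [L fL] := lip c; have [M gM] := lip d.
have abs t : 0 <= t <= 1 -> `|x - (if s then x + t else x - t)| = t.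
  move=> /andP[t0 _]; case: s; first by rewrite opprD addrA subrr sub0r normrN ger0_norm.
  by rewrite opprB addrC subrK ger0_norm.
have cf := @cont_shift f x s (@fc c); have cg := @cont_shift g x s (@fc d).
apply: (integrable01_kernel p1 p3 (U := L) (V := M) cf cg) => t t01.
  by rewrite -[in leRHS](abs t t01); exact: fL.
by rewrite -[in leRHS](abs t t01); exact: gM.
Qed.

Let cos_int k l : integrable01 (fun t => (1 - trig true k t) * (1 - trig true l t) * ker t).
Proof.
have cc m : continuous (fun t => 1 - trig true m t : R).
  by move=> t; apply: cvgB; [exact: cvg_cst | exact: continuous_trig].
have bd m (t : R) : 0 <= t <= 1 -> `|1 - trig true m t| <= m%:R * pi * t.
  move=> /andP[t0 _]; have := trig_lipschitz true m 0 t.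
  by rewrite {1}/trig mulr0 cos0 sub0r normrN (ger0_norm t0).
by apply: (integrable01_kernel p1 p3 (cc k) (cc l)); exact: bd.
Qed.

Let sin_int k l : integrable01 (fun t => trig false k t * trig false l t * ker t).
Proof.
have bd m (t : R) : 0 <= t <= 1 -> `|trig false m t| <= m%:R * pi * t.
  move=> /andP[t0 _]; have := trig_lipschitz false m t 0.
  by rewrite {2}/trig mulr0 sin0 !subr0 (ger0_norm t0).
by apply: (integrable01_kernel p1 p3 (@continuous_trig _ false k) (@continuous_trig _ false l)); exact: bd.
Qed.

(** The integrand is [G y + G (- y)] for a function [G] of period 2, so the integral can be
    recentred at [x]; there the kernel depends on [t] alone and [trig_product_identity] applies. *)
Let inner x : 0 <= x <= 1 ->
  int01 (fun y => (f x - f y) * (g x - g y) * ker (x - y) +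
                  (f x - f (- y)) * (g x - g (- y)) * ker (x + y)) =
  \sum_k \sum_l c k * d l *
    (2 * int01 (fun t => (1 - trig true k t) * (1 - trig true l t) * ker t) * (trig b k x * trig b l x) +
     2 * int01 (fun t => trig false k t * trig false l t * ker t) * (trig (~~ b) k x * trig (~~ b) l x)).
Proof.
move=> x01; pose G y := (f x - f y) * (g x - g y) * ker (x - y).
have per (e : 'I_N -> R) y : \sum_k e k * trig b k (y + 2) = \sum_k e k * trig b k y.
  by apply: eq_bigr => k _; rewrite trig_periodic.
have mG : measurable_fun [set: R] G.
  apply: measurable_funM.
    apply: continuous_measurable_fun => y; apply: cvgM; (apply: cvgB; first exact: cvg_cst); exact: fc.
  apply: (measurableT_comp (measurable_sin_kernel p)); apply: continuous_measurable_fun => y.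
  by apply: cvgB; [exact: cvg_cst | exact: cvg_id].
have perG y : G (y + 2) = G y.
  rewrite /G /f /g !per -(sin_kernelN p (x - y)) -(sin_kernelN p (x - (y + 2))) !opprB.
  by rewrite -addrA (addrC 2) addrA sin_kernel_periodic.
have kp t : G (x + t) = (f x - f (x + t)) * (g x - g (x + t)) * ker t.
  by rewrite /G opprD addrA subrr sub0r sin_kernelN.
have km t : G (x - t) = (f x - f (x - t)) * (g x - g (x - t)) * ker t.
  by rewrite /G subKr.
have ip : integrable01 (fun t => G (x + t)).
  by under eq_fun do rewrite kp; exact: shift_integrable true.
have im : integrable01 (fun t => G (x - t)).
  by under eq_fun do rewrite km; exact: shift_integrable false.
rewrite (@eq_int01 _ _ (fun y => G y + G (- y))); last by move=> y _; rewrite /G opprK.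
rewrite (int01_periodic_shift x01 mG perG im ip).
rewrite (@eq_int01 _ _ (fun t => \sum_k \sum_l c k * d l *
   (2 * (trig b k x * trig b l x) * ((1 - trig true k t) * (1 - trig true l t) * ker t) +
    2 * (trig (~~ b) k x * trig (~~ b) l x) * (trig false k t * trig false l t * ker t)))); last first.
  have dist (e : 'I_N -> R) y : \sum_k e k * trig b k x - \sum_k e k * trig b k y =
      \sum_k e k * (trig b k x - trig b k y).
    by rewrite -sumrB; apply: eq_bigr => k _; rewrite mulrBr.
  move=> t _; rewrite km kp /f /g !dist !big_distrlr /= !mulr_suml -big_split /=.
  apply: eq_bigr => k _; rewrite !mulr_suml -big_split /=; apply: eq_bigr => l _.
  have E := trig_product_identity b k l x t.
  transitivity (c k * d l * ker t * (
     (trig b k x - trig b k (x - t)) * (trig b l x - trig b l (x - t)) +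
     (trig b k x - trig b k (x + t)) * (trig b l x - trig b l (x + t)))); first by ring.
  rewrite E /=; ring.
rewrite int01_sum => [|k]; last first.
  by apply: integrable01_sum => l; apply: integrable01Z; apply: integrable01D; exact: integrable01Z.
apply: eq_bigr => k _; rewrite int01_sum => [|l]; last first.
  by apply: integrable01Z; apply: integrable01D; exact: integrable01Z.
apply: eq_bigr => l _; rewrite int01Z; last by apply: integrable01D; exact: integrable01Z.
rewrite int01D; try exact: integrable01Z.
by rewrite !int01Z//; ring.
Qed.

Lemma double_integral_trig :
  int01 (fun x => int01 (fun y => (f x - f y) * (g x - g y) * ker (x - y) +
    (f x - f (- y)) * (g x - g (- y)) * ker (x + y))) =
  \sum_k c k * d k * kernel_moment k.
Proof.
rewrite (eq_int01 inner).
have ti b' (k l : nat) : integrable01 (fun x => trig b' k x * trig b' l x : R).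
  by apply: continuous_integrable01 => x; apply: cvgM; exact: continuous_trig.
rewrite int01_sum => [|k]; last first.
  by apply: integrable01_sum => l; apply: integrable01Z; apply: integrable01D; exact: integrable01Z.
apply: eq_bigr => k _; rewrite int01_sum => [|l]; last first.
  by apply: integrable01Z; apply: integrable01D; exact: integrable01Z.
pose A (l : 'I_N) : R := int01 (fun t => (1 - trig true k t) * (1 - trig true l t) * ker t).
pose B (l : 'I_N) : R := int01 (fun t => trig false k t * trig false l t * ker t).
have term l : int01 (fun x => c k * d l * (2 * A l * (trig b k x * trig b l x) +
    2 * B l * (trig (~~ b) k x * trig (~~ b) l x))) = c k * d l * ((A l + B l) * (k == l)%:R).
  rewrite int01Z; last by apply: integrable01D; exact: integrable01Z.
  rewrite int01D; try exact: integrable01Z.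
  rewrite !int01Z// !int01_trig; congr (_ * _).
  (* At [k = l = 0] the constant cosine has norm 1 and the sine vanishes, unlike the common value
     1/2 elsewhere; but there both moments are 0. *)
  have AB : (A l - B l) * ((k == 0%N :> nat) && (l == 0%N :> nat))%:R = 0.
    case: (eqVneq (nat_of_ord k) 0%N) => [k0|]; last by rewrite mulr0.
    have -> : A l = 0.
      rewrite -[RHS](int01_cst 0); apply: eq_int01 => t _.
      by rewrite k0 /trig mul0r mul0r cos0 subrr !mul0r.
    have -> : B l = 0.
      rewrite -[RHS](int01_cst 0); apply: eq_int01 => t _.
      by rewrite k0 /trig mul0r mul0r sin0 !mul0r.
    by rewrite subrr mul0r.
  rewrite val_eqE; move: AB; set e := ((_ && _)%:R : R); set dl := ((k == l)%:R : R) => AB.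
  transitivity ((A l + B l) * dl + (if b then 1 else -1) * ((A l - B l) * e)).
    by case: b => /=; field.
  by rewrite AB mulr0 addr0.
rewrite (eq_bigr _ (fun l _ => term l)) (bigD1 k)//= eqxx mulr1 big1 ?addr0 => [|l /negPf lk]; last first.
  by rewrite eq_sym lk !mulr0.
congr (_ * _); rewrite /A /B -int01D//; apply: eq_int01 => t _; ring.
Qed.

End DoubleIntegral.

(** * Lower bounds for the kernel moments *)

Section KernelMoments.
Variables (R : realType) (p : R).
Hypotheses (p1 : 1 < p) (p3 : p < 3).
Local Notation mu := (@lebesgue_measure R).

Lemma continuous_sqr (f : R -> R) : continuous f -> continuous (fun t => f t ^+ 2).
Proof. by move=> fc t; exact: cvgM (fc t) (fc t). Qed.

Definition sin_moment : R := \int[mu]_(t in `[0, 1/2]) (sin (pi * t) ^+ 2 / t `^ p).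

Lemma integrable01_sin_moment : integrable01 (fun t => sin (pi * t) ^+ 2 / t `^ p).
Proof.
have qi : integrable01 (fun t => pi ^+ 2 * t `^ (2 - p)).
  apply: integrable01Z; apply: integrable01_powR; have -> : -1 = 2 - 3 :> R by ring.
  by rewrite ltrD2l ltrN2.
apply: le_integrable qi => //.
  apply/measurable_EFinP; apply: measurable_funTS.
  under eq_fun do rewrite -powRN; apply: measurable_funM; last exact: measurable_powR.
  by apply: continuous_measurable_fun; apply: continuous_sqr; exact: continuous_sin_lin.
move=> t; rewrite /= in_itv /= => /andP[t0 t1]; rewrite lee_fin -powRN.
rewrite (ger0_norm (mulr_ge0 (sqr_ge0 _) (powR_ge0 _ _))).
rewrite (ger0_norm (mulr_ge0 (sqr_ge0 _) (powR_ge0 _ _))).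
have [->|tn] := eqVneq t 0.
  by rewrite mulr0 sin0 expr0n mul0r mulr_ge0 ?sqr_ge0 ?powR_ge0.
rewrite powRD ?tn ?implybT// powR_mulrn// mulrA ler_wpM2r ?powR_ge0// -exprMn.
have pt0 : 0 <= pi * t by rewrite mulr_ge0// pi_ge0.
by rewrite -[leLHS]real_normK ?num_real// ler_pXn2r ?nnegrE// (le_trans (norm_sin_le _))// ger0_norm.
Qed.

Let sub_integrable (f : R -> R) (a b : R) : 0 <= a -> b <= 1 -> integrable01 f ->
  mu.-integrable `[a, b] (EFin \o f).
Proof.
move=> a0 b1; apply: integrableS => // y /=; rewrite !in_itv /= => /andP[ay yb].
by rewrite (le_trans a0 ay) (le_trans yb b1).
Qed.

(** On [1/4, 1/2] the integrand is at least 1/16, as sin (pi t) >= t and t^(-p) >= 1. Positivity of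
    kappa rests on this. *)
Lemma sin_moment_gt0 : 0 < sin_moment.
Proof.
have i01 := integrable01_sin_moment.
have q0 : 0 <= 4^-1 :> R by lra.
have q2 : 4^-1 <= 1/2 :> R by lra.
have q1 : 1/2 <= 1 :> R by lra.
rewrite /sin_moment (Rintegral_add q0 q2 (sub_integrable (lexx 0) q1 i01)).
apply: ltr_wpDl; first by apply: Rintegral_ge0 => t _; rewrite divr_ge0 ?sqr_ge0 ?powR_ge0.
have cst_int : mu.-integrable `[4^-1, 1/2] (EFin \o (fun=> 16^-1 : R)).
  exact: sub_integrable q0 q1 (integrable01_cst _).
apply: (@lt_le_trans _ _ (\int[mu]_(t in `[4^-1, 1/2]) 16^-1)).
  rewrite Rintegral_cst// mulr_gt0 ?invr_gt0//.
  have := @lebesgue_measure_itv R `[4^-1, 1/2]; rewrite /= lte_fin => e.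
  rewrite -[X in 0 < X]/(fine (mu `[4^-1, 1/2]%classic)) e ifT; last by lra.
  by rewrite /=; lra.
apply: le_Rintegral => //; first exact: sub_integrable q0 q1 i01.
move=> t; rewrite /= in_itv /= => /andP[t4 t2].
have t0 : 0 < t by rewrite (lt_le_trans _ t4)// invr_gt0.
have s4 : 4^-1 <= sin (pi * t).
  have := @sin_half_pi_ge R (2 * t); rewrite (_ : pi * (2 * t) / 2 = pi * t); last by field.
  by move=> h; apply: le_trans (h _); [lra | apply/andP; split; lra].
have s16 : 16^-1 <= sin (pi * t) ^+ 2 by nra.
rewrite (le_trans s16)// ler_peMr ?sqr_ge0// -powRN -(powRr0 t) ger_powR//.
  by rewrite t0 /=; lra.
by rewrite oppr_le0 ltW// (lt_trans ltr01).
Qed.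

(** In the infinite cases both sides are 0, since [fine] maps the infinities to 0. *)
Lemma fine_mulEFin (r : R) (x : \bar R) : 0 < r -> fine (r%:E * x)%E = r * fine x.
Proof.
by move=> r0; case: x => [x||] //=; rewrite ?gt0_muley ?gt0_muleNy ?lte_fin//= mulr0.
Qed.

Lemma kernel_moment0 : kernel_moment p 0 = 0.
Proof.
rewrite -[RHS](int01_cst 0); apply: eq_int01 => t _.
by rewrite /trig !mul0r cos0 sin0 subrr expr0n addr0 mul0r.
Qed.

(** The symbol is 4 sin^2 (k pi t / 2) and the kernel is at least (pi t / 2)^(-p). Keeping only t <=
    1/k and substituting t = (2/k) s turns the integral into [sin_moment], with factor 4 pi^(-p) k^p
    * (2/k). *)
Lemma kernel_moment_ge k : (0 < k)%N ->
  8 * pi `^ (- p) * k%:R `^ (p - 1) * sin_moment <= kernel_moment p k.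
Proof.
move=> k0; have kR : 0 < k%:R :> R by rewrite ltr0n.
have kn : k%:R != 0 :> R by rewrite gt_eqF.
pose h (t : R) : R := 4 * sin (k%:R * pi * t / 2) ^+ 2.
have hc : continuous h.
  move=> t; apply: cvgM; first exact: cvg_cst.
  have sc : continuous (fun t : R => sin (k%:R * pi * t / 2)).
    move=> u; apply: (@continuous_comp _ _ _ (fun t : R => k%:R * pi * t / 2) (@sin R)); last exact: continuous_sin.
    by apply: cvgM; [exact: continuous_mull | exact: cvg_cst].
  exact: continuous_sqr sc _.
have h0 t : 0 <= h t by rewrite mulr_ge0// sqr_ge0.
have mE : kernel_moment p k = int01 (fun t => h t * sin_kernel p t).
  apply: eq_int01 => t _; congr (_ * _); rewrite /trig /h.
  have -> : k%:R * pi * t = (k%:R * pi * t / 2) *+ 2 by rewrite -[RHS]mulr_natr divfK.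
  rewrite (_ : (k%:R * pi * t / 2) *+ 2 / 2 = k%:R * pi * t / 2); last by rewrite -[X in X / _ = _]mulr_natr mulfK.
  have := cos2Dsin2 (k%:R * pi * t / 2); rewrite cos_mulr2n sin_mulr2n.
  move: (cos _) (sin _) => C S cs; have S2 : S ^+ 2 = 1 - C ^+ 2 by rewrite -cs; ring.
  transitivity (4 * (1 - C ^+ 2) ^+ 2 + 4 * C ^+ 2 * S ^+ 2); first by ring.
  by rewrite S2; ring.
pose H t := h t * (pi * t / 2) `^ (- p).
have mpow : measurable_fun [set: R] (fun t : R => (pi * t / 2) `^ (- p)).
  apply: (@measurableT_comp _ _ _ _ _ _ (fun x : R => x `^ (- p))); first exact: measurable_powR.
  by apply: continuous_measurable_fun => t; apply: cvgM; [exact: continuous_mull | exact: cvg_cst].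
have mH : measurable_fun [set: R] H by apply: measurable_funM => //; exact: continuous_measurable_fun.
have H0 t : 0 <= H t by rewrite mulr_ge0 ?powR_ge0.
have ki : integrable01 (fun t => h t * sin_kernel p t).
  apply: (integrable01_quadratic_kernel p1 p3 (C := (k%:R * pi) ^+ 2)); first exact: continuous_measurable_fun.
  move=> t /andP[t0 _]; rewrite ger0_norm// /h -exprMn.
  have := norm_sin_le (k%:R * pi * t / 2); set u := k%:R * pi * t / 2 => su.
  have -> : k%:R * pi * t = 2 * u by rewrite /u; field.
  rewrite exprMn -natrX ler_wpM2l// -[leLHS]real_normK ?num_real// -[leRHS]real_normK ?num_real//.
  by rewrite ler_pXn2r ?nnegrE.
have Hker t : 0 <= t <= 1 -> H t <= h t * sin_kernel p t.
  by move=> t01; rewrite ler_wpM2l//; exact: sin_kernel_ge.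
have Hi : integrable01 H.
  apply: le_integrable ki => //; first by apply/measurable_EFinP; exact: measurable_funTS.
  move=> t; rewrite /= in_itv /= => t01; rewrite lee_fin !ger0_norm ?Hker//.
  by rewrite mulr_ge0// sin_kernel_ge0.
rewrite mE; apply: (@le_trans _ _ (int01 H)); last exact: ler_int01.
have k1 : k%:R^-1 <= 1 :> R by rewrite invf_le1// ler1n.
have ki0 : 0 <= k%:R^-1 :> R by rewrite invr_ge0 ltW.
rewrite /int01 (Rintegral_add ki0 k1 Hi).
apply: ler_wpDr; first by apply: Rintegral_ge0.
have c0 : 2 / k%:R != 0 :> R by rewrite mulf_neq0// invr_eq0.
have cp : 0 < 2 / k%:R :> R by rewrite divr_gt0.
have kc : 2 / k%:R * (1 / 2) = k%:R^-1 :> R by field.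
have mHE : measurable_fun [set: R] (EFin \o H) by exact/measurable_EFinP.
rewrite [leRHS]/Rintegral.
rewrite (ge0_integral_affine 0 c0 (measurable_itv _) mHE); last by move=> t; rewrite lee_fin.
rewrite fine_mulEFin ?normr_gt0// (gtr0_norm cp).
rewrite (_ : _ @^-1` _ = `[0, 1/2]%classic); last first.
  apply/seteqP; split => t /=; rewrite !in_itv /= addr0.
    move=> /andP[t0 t1]; rewrite -(pmulr_rge0 _ cp) t0 /= -(ler_pM2l cp).
    by rewrite (le_trans t1)// kc.
  move=> /andP[t0 t1]; rewrite mulr_ge0 ?(ltW cp)//=.
  by rewrite -[leRHS]kc ler_wpM2l ?(ltW cp).
rewrite -[X in _ <= _ * X]/(\int[mu]_(t in `[0, 1/2]) H (2 / k%:R * t + 0)).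
rewrite (@eq_Rintegral _ _ _ mu _ (fun t => (4 * pi `^ (- p) * k%:R `^ p) * (sin (pi * t) ^+ 2 / t `^ p))); last first.
  move=> t; rewrite inE /= in_itv /= => /andP[t0 _]; rewrite /H /h addr0.
  rewrite (_ : k%:R * pi * (2 / k%:R * t) / 2 = pi * t); last by field.
  rewrite (_ : pi * (2 / k%:R * t) / 2 = pi * (k%:R^-1 * t)); last by field.
  rewrite powRM ?pi_ge0 ?mulr_ge0 ?invr_ge0// powRM ?invr_ge0//.
  have -> : k%:R^-1 `^ (- p) = k%:R `^ p :> R by rewrite -powR_inv1// -powRrM mulN1r opprK.
  by rewrite !powRN; ring.
rewrite RintegralZl//; last by apply: sub_integrable; [by [] | lra | exact: integrable01_sin_moment].
rewrite -/sin_moment mulrA ler_wpM2r ?(ltW sin_moment_gt0)//.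
have -> : k%:R `^ (p - 1) = k%:R `^ p / k%:R :> R.
  by rewrite powRB ?kn ?implybT// powRr1.
by rewrite le_eqVlt; apply/orP; left; apply/eqP; field.
Qed.

End KernelMoments.

(** * Cosine polynomials *)

Section CosinePolynomials.
Variable R : realType.
Implicit Types (f g : R -> R) (N k : nat) (s lam : nat -> R).

(** Degree at most [N], phrased as equality with the own cosine expansion: the coefficients are then
    determined by [f], and polynomials of different degrees embed into a common set. *)
Definition cosine_poly N : set (R -> R) :=
  [set f : R -> R | f = fun x => \sum_(k < N.+1) cosine_coef f k * cosine k x].

Lemma cosine_coef_sum N (c : nat -> R) l :
  cosine_coef (fun x => \sum_(k < N) c k * cosine k x) l = if (l < N)%N then c l else 0.
Proof.
have ci k : integrable01 (fun y => cosine k y * cosine l y : R).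
  by apply: continuous_integrable01 => y; apply: cvgM; exact: continuous_cosine.
rewrite /cosine_coef (@eq_int01 _ _ (fun y => \sum_(k < N) c k * (cosine k y * cosine l y))); last first.
  by move=> y _; rewrite mulr_suml; apply: eq_bigr => k _; rewrite mulrA.
rewrite int01_sum => [|k]; last exact: integrable01Z.
under eq_bigr do rewrite int01Z// int01_cosine2.
case: ifP => lN.
  rewrite (bigD1 (Ordinal lN))//= eqxx mulr1 big1 ?addr0// => k.
  by rewrite -val_eqE /= => /negPf ->; rewrite mulr0.
rewrite big1// => k _; case: eqP => [kl|]; last by rewrite mulr0.
by move: (ltn_ord k); rewrite kl lN.
Qed.

Lemma cosine_poly_mono N M : (N <= M)%N -> cosine_poly N `<=` cosine_poly M.
Proof.
move=> NM f fN; rewrite /cosine_poly /= {1}fN; apply/funext => x.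
rewrite -!(big_mkord xpredT (fun k => cosine_coef f k * cosine k x)).
rewrite [RHS](big_cat_nat (n := N.+1))//= [X in _ = _ + X]big_nat_cond [X in _ = _ + X]big1 ?addr0//.
move=> k /andP[/andP[Nk _] _]; rewrite fN cosine_coef_sum.
by rewrite ltnNge Nk /= mul0r.
Qed.

Lemma cosine_span_poly f : cosine_span f -> exists N, cosine_poly N f.
Proof.
move=> [N [c ->]]; exists N; rewrite /cosine_poly /=; apply/funext => x.
rewrite big_ord_recr /= cosine_coef_sum ltnn mul0r addr0.
by apply: eq_bigr => k _; rewrite cosine_coef_sum ltn_ord.
Qed.

Lemma continuous_cosine_poly N f : cosine_poly N f -> continuous f.
Proof.
move=> ->; move=> x; apply: cvg_bigsum => k _; apply: cvgM; first exact: cvg_cst.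
exact: continuous_cosine.
Qed.

(** Finitely many cosine polynomials share a degree bound [N >= K], where the excess is diagonal
    with entries [lam k - s k] for [k < K] and [lam k] beyond. *)
Lemma cosine_span_psd (ip : (R -> R) -> (R -> R) -> R) s lam (K : nat) :
  (forall N f g, cosine_poly N f -> cosine_poly N g ->
     ip f g = \sum_(k < N.+1) lam k * (cosine_coef f k * cosine_coef g k)) ->
  (forall k, 0 <= s k) -> (forall k, s k <= lam k) ->
  psd (@cosine_span R) (fun f g => ip f g -
    \sum_(k < K) s k * (cosine_coef f k * cosine_coef g k)).
Proof.
move=> ipE s0 slam.
have psdN N : (K <= N)%N -> psd (cosine_poly N) (fun f g => ip f g -
    \sum_(k < K) s k * (cosine_coef f k * cosine_coef g k)).
  move=> KN; pose w k := lam k - (if (k < K)%N then s k else 0).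
  have w0 k : 0 <= w k.
    by rewrite /w; case: ifP => _; rewrite ?subr0 ?subr_ge0// (le_trans (s0 k)).
  have := @psd_sum R _ (cosine_poly N) _ (index_enum 'I_N.+1)
    (fun (k : 'I_N.+1) f g => w k * (cosine_coef f k * cosine_coef g k))
    (fun k : 'I_N.+1 => psd_rank1 _ (fun f => cosine_coef f k) (w0 k)).
  apply: psd_eq => f g fN gN; rewrite (ipE N)//.
  rewrite -!(big_mkord xpredT (fun k => _ k * (cosine_coef f k * cosine_coef g k))).
  rewrite [in RHS](big_cat_nat (n := K) (p := N.+1))//=; last exact: leqW.
  rewrite (big_cat_nat (n := K) (p := N.+1))//=; last exact: leqW.
  rewrite addrAC -sumrB; congr (_ + _).
    apply: eq_big_nat => k /andP[_ kK]; rewrite /w kK; ring.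
  by apply: eq_big_nat => k /andP[Kk _]; rewrite /w ltnNge Kk /= subr0.
split=> [f g /cosine_span_poly[N fN] /cosine_span_poly[M gM]|n x t dx].
  have NM : (K <= maxn K (maxn N M))%N by exact: leq_maxl.
  apply: (psdN _ NM).1.
    by apply: cosine_poly_mono fN; rewrite !leq_max leqnn orbT.
  by apply: cosine_poly_mono gM; rewrite !leq_max leqnn !orbT.
have [N xN] := choice (fun i => cosine_span_poly (dx i)).
apply: (psdN (maxn K (\max_i N i)) (leq_maxl _ _)).2 => i.
by apply: cosine_poly_mono (xN i); rewrite leq_max leq_bigmax orbT.
Qed.

Lemma dominates_sob_span a gamma s lam :
  (forall N f g, cosine_poly N f -> cosine_poly N g ->
     @ip _ _ (sob_span a gamma) f g = \sum_(k < N.+1) lam k * (cosine_coef f k * cosine_coef g k)) ->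
  (forall k, 0 <= s k) -> (forall k, s k <= lam k) ->
  dominates (sob_span a gamma) s.
Proof.
move=> ipE s0 slam; split=> [f /cosine_span_poly[N fN]|K].
  by apply: continuous_subspaceT; exact: continuous_cosine_poly fN.
exact: cosine_span_psd ipE s0 slam.
Qed.

Definition cosine_norm k : R := if k == 0%N then 1 else Num.sqrt 2.

Lemma cosine_norm2 k : cosine_norm k ^+ 2 = if k == 0%N then 1 else 2.
Proof. by rewrite /cosine_norm; case: ifP => _; rewrite ?expr1n ?sqr_sqrtr. Qed.

Lemma cosine_poly_trig N f : cosine_poly N f ->
  f = fun x => \sum_(k < N.+1) (cosine_coef f k * cosine_norm k) * trig true k x.
Proof.
move=> fN; rewrite {1}fN; apply/funext => x; apply: eq_bigr => k _.
by rewrite cosineE mulrA.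
Qed.

Lemma cosine_poly_int01 f : int01 f = cosine_coef f 0.
Proof. by apply: eq_int01 => x _; rewrite /= mulr1. Qed.

Section BelowOne.
Variables (a gamma : R).
Hypothesis a1 : 1 / 2 < a < 1.

Definition lt1_eigenvalue k : R := (if k == 0%N then 1 else 0) +
  (gamma ^+ 2)^-1 * ((1 - a) * pi ^+ 3 / 8) * cosine_norm k ^+ 2 * kernel_moment (2 * a + 1) k.

(** Cosine polynomials are even, so [f y] next to the kernel at [x + y] can be read as [f (- y)];
    this is the form that [double_integral_trig] diagonalizes. *)
Lemma sob_ip_lt1_poly N f g : cosine_poly N f -> cosine_poly N g ->
  sob_ip_lt1 a gamma f g = \sum_(k < N.+1) lt1_eigenvalue k * (cosine_coef f k * cosine_coef g k).
Proof.
have [a0 a2] := andP a1.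
have p1 : 1 < 2 * a + 1 by lra.
have p3 : 2 * a + 1 < 3 by lra.
move=> /[dup] /cosine_poly_trig fE fN /[dup] /cosine_poly_trig gE gN.
have even h : cosine_poly N h -> forall y, h (- y) = h y.
  move=> /cosine_poly_trig -> y; apply: eq_bigr => k _.
  by rewrite /trig mulrN cosN.
have := double_integral_trig p1 p3 true (fun k : 'I_N.+1 => cosine_coef f k * cosine_norm k)
  (fun k : 'I_N.+1 => cosine_coef g k * cosine_norm k).
have Ef x : \sum_(k < N.+1) (cosine_coef f k * cosine_norm k) * trig true k x = f x.
  by rewrite [in RHS]fE.
have Eg x : \sum_(k < N.+1) (cosine_coef g k * cosine_norm k) * trig true k x = g x.
  by rewrite [in RHS]gE.
move=> D; rewrite /sob_ip_lt1.
have -> : int01 (fun x => int01 (fun y => (f x - f y) * (g x - g y) *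
    ((`|sin (pi * (x - y) / 2)| `^ (2 * a + 1))^-1 + (`|sin (pi * (x + y) / 2)| `^ (2 * a + 1))^-1))) =
  \sum_(k < N.+1) (cosine_coef f k * cosine_norm k) * (cosine_coef g k * cosine_norm k) * kernel_moment (2 * a + 1) k.
  rewrite -D; apply: eq_int01 => x _; apply: eq_int01 => y _.
  by rewrite !Ef !Eg (even _ fN) (even _ gN) /sin_kernel !powRN -mulrDr.
rewrite !cosine_poly_int01 mulr_sumr big_ord_recl [in RHS]big_ord_recl addrA; congr (_ + _).
  by rewrite /lt1_eigenvalue /cosine_norm /=; ring.
by apply: eq_bigr => k _; rewrite /lt1_eigenvalue /= add0r; ring.
Qed.

End BelowOne.

Section AboveOne.
Variables (a gamma : R).
Hypothesis a1 : 1 < a < 2.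

Definition sine_freq k : R := cosine_norm k * (k%:R * pi).

Definition gt1_eigenvalue k : R := (if k == 0%N then 1 else 0) +
  (gamma ^+ 2)^-1 * ((k%:R * pi) ^+ 2 +
    ((a - 1) * (2 - a) * pi ^+ 3 / 8) * sine_freq k ^+ 2 * kernel_moment (2 * a - 1) k).

Lemma derive_cosine_poly N f : cosine_poly N f ->
  derive1 f = fun x => \sum_(k < N.+1) - (cosine_coef f k * sine_freq k) * trig false k x.
Proof.
move=> fN; pose c k := cosine_coef f k.
have D n (x : R) : is_derive x 1 (fun x => \sum_(k < n) (c k * cosine_norm k) * trig true k x)
    (\sum_(k < n) - (c k * sine_freq k) * trig false k x).
  elim: n => [|n IH].
    rewrite big_ord0 (_ : (fun x => _) = cst 0); first exact: is_derive_cst.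
    by apply/funext => y; rewrite big_ord0.
  rewrite big_ord_recr /= (_ : (fun x => _) = (fun x => \sum_(k < n) (c k * cosine_norm k) * trig true k x) +
    (c n * cosine_norm n) \*: trig true n); last by apply/funext => y; rewrite big_ord_recr.
  apply: is_derive_eq (is_deriveD IH (is_deriveZ (c n * cosine_norm n) (is_derive_cos_lin (n%:R * pi) x))) _.
  by congr (_ + _); rewrite /GRing.scale /= /sine_freq; ring.
rewrite [in LHS](cosine_poly_trig fN); apply/funext => x.
by rewrite derive1E; exact: (@derive_val _ _ _ _ _ _ _ (D N.+1 x)).
Qed.

(** The derivatives are sine polynomials, hence odd, so the sums paired with the kernel at [x + y]
    are differences between the values at [x] and [- y], and the same diagonalization applies. *)
Lemma sob_ip_gt1_poly N f g : cosine_poly N f -> cosine_poly N g ->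
  sob_ip_gt1 a gamma f g = \sum_(k < N.+1) gt1_eigenvalue k * (cosine_coef f k * cosine_coef g k).
Proof.
have [a0 a2] := andP a1.
have p1 : 1 < 2 * a - 1 by lra.
have p3 : 2 * a - 1 < 3 by lra.
move=> /derive_cosine_poly fE /derive_cosine_poly gE.
pose cf (k : 'I_N.+1) := - (cosine_coef f k * sine_freq k).
pose cg (k : 'I_N.+1) := - (cosine_coef g k * sine_freq k).
have D := double_integral_trig p1 p3 false cf cg.
have odd (c : 'I_N.+1 -> R) y : \sum_k c k * trig false k (- y) = - \sum_k c k * trig false k y.
  by rewrite -sumrN; apply: eq_bigr => k _; rewrite /trig mulrN sinN mulrN.
rewrite /sob_ip_gt1 fE gE /sob_B.
have -> : int01 (fun x => int01 (fun y =>
    (\sum_(k < N.+1) cf k * trig false k x - \sum_(k < N.+1) cf k * trig false k y) *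
    (\sum_(k < N.+1) cg k * trig false k x - \sum_(k < N.+1) cg k * trig false k y) /
      `|sin (pi * (x - y) / 2)| `^ (2 * a - 1) +
    (\sum_(k < N.+1) cf k * trig false k x + \sum_(k < N.+1) cf k * trig false k y) *
    (\sum_(k < N.+1) cg k * trig false k x + \sum_(k < N.+1) cg k * trig false k y) /
      `|sin (pi * (x + y) / 2)| `^ (2 * a - 1))) =
   \sum_k cf k * cg k * kernel_moment (2 * a - 1) k.
  rewrite -D; apply: eq_int01 => x _; apply: eq_int01 => y _.
  by rewrite !odd !opprK /sin_kernel !powRN.
have ti (k l : nat) : integrable01 (fun x => trig false k x * trig false l x : R).
  by apply: continuous_integrable01 => x; apply: cvgM; exact: continuous_trig.
have -> : int01 (fun x => (\sum_(k < N.+1) cf k * trig false k x) * (\sum_(k < N.+1) cg k * trig false k x)) =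
    \sum_(k < N.+1) (k%:R * pi) ^+ 2 * (cosine_coef f k * cosine_coef g k).
  rewrite (@eq_int01 _ _ (fun x => \sum_(k < N.+1) \sum_(l < N.+1) cf k * cg l * (trig false k x * trig false l x))); last first.
    move=> x _; rewrite big_distrlr; apply: eq_bigr => k _; apply: eq_bigr => l _ /=; ring.
  rewrite int01_sum => [|k]; last by apply: integrable01_sum => l; exact: integrable01Z.
  apply: eq_bigr => k _; rewrite int01_sum => [|l]; last exact: integrable01Z.
  rewrite (bigD1 k)//= big1 => [|l lk]; last first.
    rewrite int01Z ?int01_sinsin; last exact: ti.
    rewrite val_eqE eq_sym (negPf lk) add0r /cf.
    case: (eqVneq (nat_of_ord k) 0%N) => [k0|]; last by rewrite /= oppr0 !mulr0.
    by rewrite /sine_freq k0 mul0r !mulr0 oppr0 !mul0r.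
  rewrite addr0 int01Z ?int01_sinsin; last exact: ti.
  rewrite eqxx andbb /cf /cg /sine_freq.
  have := cosine_norm2 k; move: (cosine_norm k) => m; case: (eqVneq (nat_of_ord k) 0%N) => [->|k0] m2.
    by rewrite mul0r !mulr0 oppr0 mul0r expr0n !mul0r.
  rewrite /= subr0 mulr1; transitivity (cosine_coef f k * cosine_coef g k * (k%:R * pi) ^+ 2 * (m ^+ 2 * 2^-1)); first by ring.
  by rewrite m2 mulfV//; ring.
rewrite !cosine_poly_int01 mulr_sumr -big_split mulr_sumr big_ord_recl [in RHS]big_ord_recl /= addrA; congr (_ + _).
  by rewrite /gt1_eigenvalue /cf /cg /=; ring.
by apply: eq_bigr => k _; rewrite /gt1_eigenvalue /cf /cg /= add0r; ring.
Qed.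

End AboveOne.

End CosinePolynomials.

(** * Eigenvalues compared with the rescaled weights *)

Section FractionalDomination.
Variables (R : realType) (a gamma : R).
Hypothesis gamma0 : 0 < gamma.

Lemma rescaled_weight_gt0 : 0 < kappa a -> 0 < rescaled_weight a gamma.
Proof. by move=> k0; rewrite mulr_gt0// powR_gt0. Qed.

Lemma sobolev_weight_rescaled k : 0 < kappa a ->
  sobolev_weight a (rescaled_weight a gamma) k =
  if k == 0%N then 1 else (gamma ^+ 2)^-1 * (kappa a * k%:R `^ (2 * a)).
Proof.
move=> k0; rewrite /sobolev_weight; case: ifP => // _.
have E : (kappa a `^ (- (1 / 2))) ^+ 2 = (kappa a)^-1.
  rewrite -powR_mulrn ?powR_ge0// -powRrM (_ : - (1 / 2) * 2 = -1); last by field.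
  by rewrite powR_inv1// ltW.
by rewrite /rescaled_weight exprMn E invfM invrK (mulrC (kappa a)) mulrA.
Qed.

Lemma powR_pi3 (q : R) : pi ^+ 3 * pi `^ (- q) = pi `^ (3 - q) :> R.
Proof.
by rewrite -powR_mulrn ?pi_ge0// -powRD// (gt_eqF (pi_gt0 R)) implybT.
Qed.

Lemma kappa_lt1_gt0 : 1 / 2 < a < 1 -> kappa a = 2 * (1 - a) * pi `^ (2 - 2 * a) * sin_moment (2 * a + 1) /\ 0 < kappa a.
Proof.
move=> /andP[a0 a1]; have kE : kappa a = 2 * (1 - a) * pi `^ (2 - 2 * a) * sin_moment (2 * a + 1).
  by rewrite /kappa a1.
split=> //; rewrite kE mulr_gt0 ?sin_moment_gt0//; try lra.
by rewrite mulr_gt0 ?powR_gt0 ?pi_gt0//; lra.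
Qed.

Lemma kappa_gt1_gt0 : 1 < a < 2 ->
  kappa a = 2 * (a - 1) * (2 - a) * pi `^ (6 - 2 * a) * sin_moment (2 * a - 1) /\ 0 < kappa a.
Proof.
move=> /andP[a0 a1].
have kE : kappa a = 2 * (a - 1) * (2 - a) * pi `^ (6 - 2 * a) * sin_moment (2 * a - 1).
  by rewrite /kappa ltNge (ltW a0) /= gt_eqF.
split=> //; rewrite kE mulr_gt0 ?sin_moment_gt0//; try lra.
by rewrite mulr_gt0 ?powR_gt0 ?pi_gt0// mulr_gt0//; lra.
Qed.

Lemma dominates_sob_span_lt1 : 1 / 2 < a < 1 ->
  dominates (sob_span a gamma) (sobolev_weight a (rescaled_weight a gamma)).
Proof.
move=> a01; have [kE k0] := kappa_lt1_gt0 a01; have [a0 a1] := andP a01.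
have p1 : 1 < 2 * a + 1 by lra.
have p3 : 2 * a + 1 < 3 by lra.
apply: (@dominates_sob_span _ _ _ _ (lt1_eigenvalue a gamma)).
- by move=> N f g fN gN; rewrite /= a1 (sob_ip_lt1_poly gamma a01 fN gN).
- by move=> k; rewrite ltW// sobolev_weight_gt0// rescaled_weight_gt0.
move=> k; rewrite sobolev_weight_rescaled// /lt1_eigenvalue cosine_norm2; case: eqP => [->|/eqP kn].
  by rewrite kernel_moment0 mulr0 addr0.
rewrite add0r -!mulrA ler_wpM2l ?invr_ge0 ?sqr_ge0//.
have := kernel_moment_ge p1 p3 (_ : 0 < k)%N; rewrite lt0n => /(_ kn) h.
have c0 : 0 <= (1 - a) * pi ^+ 3 / 8 * 2 :> R.
  by rewrite mulr_ge0// divr_ge0// mulr_ge0 ?exprn_ge0 ?pi_ge0// subr_ge0 ltW.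
have := ler_wpM2l c0 h; rewrite !mulrA; apply: le_trans.
(* The constants match: (1 - a) pi^3 / 8, times 2 from the normalization of the cosines, times 8
   pi^(-p) from the moment bound, is 2 (1 - a) pi^(2 - 2a) at p = 2a + 1. *)
rewrite kE (_ : 2 - 2 * a = 3 - (2 * a + 1)); last ring.
rewrite -powR_pi3 (_ : 2 * a + 1 - 1 = 2 * a); last ring.
by rewrite le_eqVlt; apply/orP; left; apply/eqP; field.
Qed.

Lemma dominates_sob_span_gt1 : 1 < a < 2 ->
  dominates (sob_span a gamma) (sobolev_weight a (rescaled_weight a gamma)).
Proof.
move=> a01; have [kE k0] := kappa_gt1_gt0 a01; have [a0 a1] := andP a01.
have p1 : 1 < 2 * a - 1 by lra.
have p3 : 2 * a - 1 < 3 by lra.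
apply: (@dominates_sob_span _ _ _ _ (gt1_eigenvalue a gamma)).
- by move=> N f g fN gN; rewrite /= ltNge (ltW a0) /= (sob_ip_gt1_poly gamma a01 fN gN).
- by move=> k; rewrite ltW// sobolev_weight_gt0// rescaled_weight_gt0.
move=> k; rewrite sobolev_weight_rescaled// /gt1_eigenvalue; case: eqP => [->|/eqP kn].
  by rewrite kernel_moment0 mulr0 mul0r expr0n !addr0 mulr0 addr0.
rewrite add0r ler_wpM2l ?invr_ge0 ?sqr_ge0//.
have -> : sine_freq R k ^+ 2 = 2 * (k%:R * pi) ^+ 2 by rewrite exprMn cosine_norm2 (negPf kn).
have := kernel_moment_ge p1 p3 (_ : 0 < k)%N; rewrite lt0n => /(_ kn) h.
(* The part coming from the integral of the product of the derivatives is discarded; kappa stems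
   from the singular form. Two powers of [k] and of pi come from differentiation, the others from
   the moment bound. *)
apply: ler_wpDl; first exact: sqr_ge0.
have kR : k%:R != 0 :> R by rewrite pnatr_eq0.
have c0 : 0 <= (a - 1) * (2 - a) * pi ^+ 3 / 8 * (2 * (k%:R * pi) ^+ 2) :> R.
  by rewrite !mulr_ge0 ?sqr_ge0 ?exprn_ge0 ?pi_ge0 ?invr_ge0// subr_ge0 ltW.
have := ler_wpM2l c0 h; rewrite !mulrA; apply: le_trans.
rewrite kE.
have -> : k%:R `^ (2 * a) = k%:R ^+ 2 * k%:R `^ (2 * a - 1 - 1) :> R.
  rewrite -powR_mulrn// -powRD ?kR ?implybT//; congr (_ `^ _); ring.
have -> : pi `^ (6 - 2 * a) = pi ^+ 2 * (pi ^+ 3 * pi `^ (- (2 * a - 1))) :> R.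
  rewrite powR_pi3 -powR_mulrn ?pi_ge0// -powRD ?(gt_eqF (pi_gt0 R)) ?implybT//; congr (_ `^ _); ring.
by rewrite le_eqVlt; apply/orP; left; apply/eqP; field.
Qed.

End FractionalDomination.

(** * Smooth cutoff functions *)

Section SmoothCutoff.
Variable R : realType.
Implicit Types (n : nat) (u x : R).

(** The powers u^(-n) exp (-1/u), extended by 0: a family closed under differentiation up to linear
    combinations, containing the standard flat function at [n = 0]. *)
Definition flat_exp n u : R := if 0 < u then (u^-1) ^+ n * expR (- u^-1) else 0.

Lemma flat_exp_ge0 n u : 0 <= flat_exp n u.
Proof.
by rewrite /flat_exp; case: ltP => // u0; rewrite mulr_ge0 ?expR_ge0// exprn_ge0// invr_ge0 ltW.
Qed.

(** One Taylor term, exp y >= y^(n+2) / (n+2)! at y = 1/u. The quadratic bound makes the derivative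
    at the junction point 0 vanish. *)
Lemma flat_exp_quadratic n u : 0 < u -> flat_exp n u <= (n.+2)`!%:R * u ^+ 2.
Proof.
move=> u0; rewrite /flat_exp u0; have y0 : 0 < u^-1 by rewrite invr_gt0.
rewrite expRN ler_pdivrMr ?expR_gt0//.
have h := @expR_ge1Dxn R u^-1 n.+1 (ltW y0).
have f0 : 0 < (n.+2)`!%:R :> R by rewrite ltr0n fact_gt0.
apply: (@le_trans _ _ ((n.+2)`!%:R * u ^+ 2 * (u^-1 ^+ n.+2 / (n.+2)`!%:R))); last first.
  apply: ler_wpM2l; first exact: mulr_ge0 (ltW f0) (sqr_ge0 _).
  by rewrite (le_trans _ h)// lerDr.
rewrite le_eqVlt; apply/orP; left; apply/eqP.
by rewrite -addn2 exprD; field; rewrite gt_eqF//= gt_eqF.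
Qed.

Lemma is_derive_flat_exp n u :
  is_derive u 1 (flat_exp n) (- n%:R * flat_exp n.+1 u + flat_exp n.+2 u).
Proof.
have [u0|u0|u0] := ltgtP 0 u.
- have un : u != 0 by rewrite gt_eqF.
  have dinv : is_derive u 1 (fun x : R => x^-1) (- u ^- 2).
    have := @is_deriveV R id u 1 1 un (is_derive_id _ _).
    by move=> d; apply: is_derive_eq d _; rewrite /GRing.scale /= mulr1.
  have dneg : is_derive u 1 (fun x : R => - x^-1) (u ^- 2).
    by have := is_deriveN dinv; rewrite opprK.
  have dexp := @is_derive1_comp R expR (fun x => - x^-1) u _ _ (is_derive_expR _) dneg.
  have dpow := is_deriveX n dinv.
  have dm := is_deriveM dpow dexp.
  have du : is_derive u 1 (fun x : R => (x^-1) ^+ n * expR (- x^-1)) (- n%:R * flat_exp n.+1 u + flat_exp n.+2 u).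
    rewrite (_ : (fun x : R => _) = (fun x : R => x^-1) ^+ n * (expR \o (fun x : R => - x^-1))); last first.
      by apply/funext => x; rewrite [RHS]/GRing.mul /= exprfctE.
    apply: is_derive_eq dm _; rewrite /GRing.scale /= exprfctE /flat_exp u0.
    have -> : (u ^+ 2)^-1 = u^-1 ^+ 2 by rewrite exprVn.
    clear dpow; case: n => [|n] /=.
      by rewrite mulr0n !mul0r oppr0 mul0r; ring.
    by rewrite -mulr_natl !exprS; ring.
  apply: near_eq_is_derive du.
  by near=> x; rewrite /flat_exp ifT//; near: x; exact: lt_nbhsr.
- have -> : - n%:R * flat_exp n.+1 u + flat_exp n.+2 u = 0.
    by rewrite /flat_exp ltNge (ltW u0) /= mulr0 addr0.
  have d0 : is_derive u 1 (cst 0 : R -> R) 0 by exact: is_derive_cst.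
  apply: near_eq_is_derive d0.
  near=> x; rewrite /flat_exp ltNge ifF//; apply/negbF; apply: ltW.
  by near: x; exact: lt_nbhsl.
- rewrite -u0 /flat_exp ltxx mulr0 addr0 -/(flat_exp n).
  have c0 : h^-1 *: ((flat_exp n \o shift 0) (h *: 1) - flat_exp n 0) @[h --> 0^'] --> (0 : R).
    apply/cvgrPdist_lt => e e0; pose C : R := (n.+2)`!%:R.
    have C0 : 0 < C by rewrite ltr0n fact_gt0.
    near=> h; rewrite sub0r normrN /= /GRing.scale /= mulr1 addr0 [flat_exp n 0]/flat_exp ltxx subr0.
    have [hp|hn] := ltP 0 h; last by rewrite /flat_exp [0 < h]ltNge hn mulr0 normr0.
    rewrite ger0_norm; last by rewrite mulr_ge0 ?flat_exp_ge0// invr_ge0 ltW.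
    rewrite mulrC ltr_pdivrMr//.
    rewrite (le_lt_trans (flat_exp_quadratic n hp))// -/C expr2 mulrA ltr_pM2r//.
    rewrite mulrC -ltr_pdivlMr//.
    rewrite (le_lt_trans (ler_norm _))//; near: h; apply: dnbhs0_lt.
    by rewrite divr_gt0.
  apply: DeriveDef; first by apply/cvg_ex; exists 0.
  exact: (cvg_lim (@norm_hausdorff _ _) c0).
Unshelve. all: by end_near. Qed.

(** A syntactic class stable under differentiation, which yields derivatives of all orders by
    induction. *)
Inductive smooth_expr : (R -> R) -> Prop :=
| smooth_cst c : smooth_expr (fun=> c)
| smooth_id : smooth_expr (fun x => x)
| smooth_sin c : smooth_expr (fun x => sin (c * x))
| smooth_cos c : smooth_expr (fun x => cos (c * x))
| smooth_add f g : smooth_expr f -> smooth_expr g -> smooth_expr (fun x => f x + g x)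
| smooth_mul f g : smooth_expr f -> smooth_expr g -> smooth_expr (fun x => f x * g x)
| smooth_flat_exp n f : smooth_expr f -> smooth_expr (fun x => flat_exp n (f x)).

Lemma smooth_expr_derive f : smooth_expr f ->
  exists2 f', smooth_expr f' & forall x : R, is_derive x 1 f (f' x).
Proof.
elim=> [c||c|c|{}f g _ [f' sf df] _ [g' sg dg]|{}f g sf0 [f' sf df] sg0 [g' sg dg]|n {}f sf0 [f' sf df]].
- by exists (fun=> 0) => [|x]; [exact: smooth_cst | exact: is_derive_cst].
- by exists (fun=> 1) => [|x]; [exact: smooth_cst | exact: is_derive_id].
- exists (fun x => c * cos (c * x)) => [|x]; last exact: is_derive_sin_lin.
  by apply: smooth_mul; [exact: smooth_cst | exact: smooth_cos].
- exists (fun x => (- c) * sin (c * x)) => [|x].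
    by apply: smooth_mul; [exact: smooth_cst | exact: smooth_sin].
  by apply: is_derive_eq (is_derive_cos_lin c x) _; rewrite mulNr.
- by exists (fun x => f' x + g' x) => [|x]; [exact: smooth_add | exact: is_deriveD].
- exists (fun x => f x * g' x + g x * f' x) => [|x].
    by apply: smooth_add; exact: smooth_mul.
  exact: is_deriveM.
- exists (fun x => ((- n%:R) * flat_exp n.+1 (f x) + flat_exp n.+2 (f x)) * f' x) => [|x].
    apply: smooth_mul => //; apply: smooth_add; last exact: smooth_flat_exp.
    by apply: smooth_mul; [exact: smooth_cst | exact: smooth_flat_exp].
  exact: is_derive1_comp (is_derive_flat_exp n (f x)) (df x).
Qed.

Lemma smooth_expr_derive1 f : smooth_expr f -> smooth_expr (derive1 f).
Proof.
move=> /smooth_expr_derive[f' sf df]; suff -> : derive1 f = f' by [].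
by apply/funext => x; rewrite derive1E; exact: (@derive_val _ _ _ _ _ _ _ (df x)).
Qed.

Lemma smooth_expr_derivable f : smooth_expr f ->
  forall n (x : R), derivable (derive1n n f) x 1.
Proof.
move=> sf; have sn n : smooth_expr (derive1n n f).
  by elim: n => // n IH; rewrite derive1nS; exact: smooth_expr_derive1.
move=> n x; have [f' _ df] := smooth_expr_derive (sn n).
exact: (@ex_derive _ _ _ _ _ _ _ (df x)).
Qed.

Lemma smooth_expr_continuous f : smooth_expr f -> continuous f.
Proof.
move=> /smooth_expr_derive[f' _ df] x; apply: differentiable_continuous.
by apply/derivable1_diffP; exact: (@ex_derive _ _ _ _ _ _ _ (df x)).
Qed.

(* [sin (k pi x)] is not supported away from 0 and 1; this is its smooth truncation. *)
Definition sine_cutoff (k m : nat) x : R :=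
  sin (k%:R * pi * x) * flat_exp 0 (m.+1%:R * (x * (1 - x)) - 1).

Definition sine_cutoff' (k m : nat) x : R :=
  k%:R * pi * cos (k%:R * pi * x) * flat_exp 0 (m.+1%:R * (x * (1 - x)) - 1) +
  sin (k%:R * pi * x) * (flat_exp 2 (m.+1%:R * (x * (1 - x)) - 1) * (m.+1%:R * (1 - 2 * x))).

Lemma smooth_sine_cutoff k m : smooth_expr (sine_cutoff k m).
Proof.
apply: smooth_mul; first exact: smooth_sin.
apply: smooth_flat_exp; apply: smooth_add; last exact: smooth_cst.
apply: smooth_mul; first exact: smooth_cst.
apply: smooth_mul; first exact: smooth_id.
apply: smooth_add; first exact: smooth_cst.
have -> : -%R = (fun x : R => (-1) * x) by apply/funext => x; rewrite mulN1r.
by apply: smooth_mul; [exact: smooth_cst | exact: smooth_id].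
Qed.

Lemma derive_sine_cutoff k m : derive1 (sine_cutoff k m) = sine_cutoff' k m.
Proof.
apply/funext => x; rewrite derive1E.
have du : is_derive x 1 (fun x : R => m.+1%:R * (x * (1 - x)) - 1) (m.+1%:R * (1 - 2 * x)).
  have d1 : is_derive x 1 (fun x : R => 1 - x) (-1).
    apply: is_derive_eq (is_deriveB (is_derive_cst (1 : R) x 1) (is_derive_id x 1)) _.
    by rewrite sub0r.
  have d2 := is_deriveZ m.+1%:R (is_deriveM (is_derive_id x 1) d1).
  apply: is_derive_eq (is_deriveB d2 (is_derive_cst (1 : R) x 1)) _.
  by rewrite /GRing.scale /=; ring.
have dE := @is_derive1_comp R (flat_exp 0) (fun x => m.+1%:R * (x * (1 - x)) - 1) x _ _
  (is_derive_flat_exp 0 _) du.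
have := is_deriveM (is_derive_sin_lin (k%:R * pi) x) dE.
move=> D; rewrite (@derive_val _ _ _ _ _ _ _ D) /sine_cutoff' /GRing.scale /=; ring.
Qed.

Lemma test_sine_cutoff k m : test_function (sine_cutoff k m).
Proof.
split; first exact: smooth_expr_derivable (smooth_sine_cutoff k m).
have m0 : 0 < m.+1%:R :> R by rewrite ltr0n.
exists m.+1%:R^-1, (1 - m.+1%:R^-1); split; first by rewrite invr_gt0.
  by rewrite gtrBl invr_gt0.
move=> x; rewrite /sine_cutoff /flat_exp; case: ifP => [|_]; last by rewrite mulr0 eqxx.
rewrite subr_gt0 => h _; have q0 : 0 < x * (1 - x).
  by rewrite -(pmulr_rgt0 _ m0) (lt_trans ltr01).
have x01 : 0 < x < 1 by apply/andP; split; nra.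
have [x0 x1] := andP x01; rewrite lerBrDr addrC -lerBrDr.
have qinv : m.+1%:R^-1 < x * (1 - x) by rewrite -[ltLHS]mulr1 ltr_pdivrMl.
by apply/andP; split; apply: (le_trans (ltW qinv)); nra.
Qed.

Lemma flat_exp0_le1 u : flat_exp 0 u <= 1.
Proof.
rewrite /flat_exp; case: ltP => // u0; rewrite expr0 mul1r expR_le1 oppr_le0 invr_ge0 ltW//.
Qed.

Lemma flat_exp2_le u : 0 < u -> (u + 1) * flat_exp 2 u <= u^-1 + u^-1 ^+ 2.
Proof.
move=> u0; rewrite /flat_exp u0.
have -> : (u + 1) * (u^-1 ^+ 2 * expR (- u^-1)) = (u^-1 + u^-1 ^+ 2) * expR (- u^-1).
  by field; rewrite gt_eqF.
by rewrite ler_piMr ?addr_ge0 ?sqr_ge0 ?invr_ge0 ?(ltW u0)// expR_le1 oppr_le0 invr_ge0 ltW.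
Qed.

(** With y = 1/u the quantity is (y + y^2) exp (-y), and 3 comes from y <= exp y - 1 and y^2 / 2 <=
    exp y - 1. *)
Lemma flat_exp2_le3 u : -1 <= u -> (u + 1) * flat_exp 2 u <= 3.
Proof.
move=> u1; have [u0|u0] := ltP 0 u; last first.
  by rewrite /flat_exp ltNge u0 /= mulr0.
rewrite /flat_exp u0; have y0 : 0 < u^-1 by rewrite invr_gt0.
have -> : (u + 1) * (u^-1 ^+ 2 * expR (- u^-1)) = (u^-1 + u^-1 ^+ 2) * expR (- u^-1).
  by field; rewrite gt_eqF.
rewrite expRN ler_pdivrMr ?expR_gt0//.
have e1 := @expR_ge1Dx R u^-1.
have e2 := @expR_ge1Dxn R u^-1 1 (ltW y0).
have e3 : u^-1 ^+ 2 / 2 <= expR u^-1 - 1 by move: e2; rewrite (_ : (2`! = 2)%N) //; lra.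
by lra.
Qed.

(** The sine vanishes at both ends at the rate x (1 - x), which offsets the factor [m.+1] produced
    by differentiating the cutoff and keeps the derivatives bounded uniformly in [m]. *)
Lemma norm_sin_pi_le k x : 0 <= x <= 1 -> `|sin (k%:R * pi * x)| <= 2 * (k%:R * pi) * (x * (1 - x)).
Proof.
move=> /andP[x0 x1]; have kp : 0 <= k%:R * pi :> R by rewrite mulr_ge0// pi_ge0.
have half (y : R) : 0 <= y -> 2 * y <= 1 -> `|sin (k%:R * pi * y)| <= 2 * (k%:R * pi) * (y * (1 - y)).
  move=> y0 y2; rewrite (le_trans (norm_sin_le _))// ger0_norm ?mulr_ge0 ?pi_ge0//.
  rewrite (_ : 2 * (k%:R * pi) * (y * (1 - y)) = k%:R * pi * (2 * (y * (1 - y)))); last ring.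
  rewrite ler_wpM2l// mulrCA -[leLHS]mulr1 ler_wpM2l//.
  by rewrite mulrBr mulr1 lerBrDr -lerBrDl (le_trans y2)// lerBrDr.
have [x2|x2] := leP (2 * x) 1; first exact: half.
have -> : `|sin (k%:R * pi * x)| = `|sin (k%:R * pi * (1 - x))|.
  rewrite mulrBr mulr1 sinB sin_nat_pi mul0r sub0r normrN normrM.
  have := cos2Dsin2 (k%:R * pi : R); rewrite sin_nat_pi expr0n addr0 => /eqP.
  by rewrite sqrf_eq1 => /orP[] /eqP ->; rewrite ?normrN normr1 mul1r.
have -> : x * (1 - x) = (1 - x) * (1 - (1 - x)) by ring.
apply: half; first by rewrite subr_ge0.
by rewrite mulrBr mulr1 lerBlDr; move: x2 => /ltW; rewrite -(lerD2l 1).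
Qed.

Lemma sine_cutoff_bound k m x : `|sine_cutoff k m x| <= 1.
Proof.
rewrite /sine_cutoff normrM (ger0_norm (flat_exp_ge0 _ _)).
by rewrite -[leRHS]mulr1 ler_pM ?flat_exp_ge0 ?sin_max ?flat_exp0_le1.
Qed.

(** The part of the derivative in which the cutoff itself is differentiated; it must tend to 0
    boundedly. *)
Let defect k m x := sin (k%:R * pi * x) *
  (flat_exp 2 (m.+1%:R * (x * (1 - x)) - 1) * (m.+1%:R * (1 - 2 * x))).

Let defect_le k m x : 0 <= x <= 1 -> `|defect k m x| <= 2 * (k%:R * pi) *
  ((m.+1%:R * (x * (1 - x)) - 1 + 1) * flat_exp 2 (m.+1%:R * (x * (1 - x)) - 1)).
Proof.
move=> x01; have [x0 x1] := andP x01; have m0 : 0 <= m.+1%:R :> R by [].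
have F0 := flat_exp_ge0 2 (m.+1%:R * (x * (1 - x)) - 1).
rewrite subrK /defect; move: (flat_exp _ _) F0 => F F0.
rewrite !normrM (ger0_norm F0) (ger0_norm m0).
have a1 : `|1 - 2 * x| <= 1 by rewrite ler_norml; apply/andP; split; lra.
apply: (@le_trans _ _ (2 * (k%:R * pi) * (x * (1 - x)) * (F * (m.+1%:R * 1)))).
  apply: ler_pM => //; first by rewrite !mulr_ge0.
    exact: norm_sin_pi_le.
  by rewrite ler_wpM2l// ler_wpM2l.
by rewrite le_eqVlt; apply/orP; left; apply/eqP; ring.
Qed.

Lemma sine_cutoff'_bound k m x : 0 <= x <= 1 -> `|sine_cutoff' k m x| <= 7 * (k%:R * pi).
Proof.
move=> x01; have [x0 x1] := andP x01; have kp : 0 <= k%:R * pi :> R by rewrite mulr_ge0// pi_ge0.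
rewrite /sine_cutoff' -/(defect k m x) (le_trans (ler_normD _ _))//.
have d : `|defect k m x| <= 2 * (k%:R * pi) * 3.
  apply: (le_trans (defect_le k m x01)); rewrite ler_wpM2l ?mulr_ge0 ?pi_ge0//.
  apply: flat_exp2_le3; have : 0 <= m.+1%:R * (x * (1 - x)) by rewrite !mulr_ge0// subr_ge0.
  by move: (_ * _) => q; lra.
have c : `|k%:R * pi * cos (k%:R * pi * x) * flat_exp 0 (m.+1%:R * (x * (1 - x)) - 1)| <= k%:R * pi.
  rewrite !normrM -normrM (ger0_norm kp) (ger0_norm (flat_exp_ge0 _ _)) -mulrA.
  rewrite -[leRHS]mulr1 ler_wpM2l// -[leRHS]mulr1 ler_pM ?flat_exp_ge0 ?cos_max ?flat_exp0_le1//.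
by move: d c; move: (k%:R * pi) kp => K kp; lra.
Qed.

Let arg_inv_cvg x : 0 < x < 1 -> (m.+1%:R * (x * (1 - x)) - 1)^-1 @[m --> \oo] --> (0 : R).
Proof.
move=> /andP[x0 x1]; have q0 : 0 < x * (1 - x) by rewrite mulr_gt0// subr_gt0.
apply/cvgrPdist_lt => e e0; near=> m.
rewrite sub0r normrN; have h : 1 + e^-1 < m.+1%:R * (x * (1 - x)).
  rewrite -ltr_pdivrMr//; apply: (@lt_trans _ _ m%:R); last by rewrite ltr_nat.
  by near: m; exact: nbhs_infty_gtr.
have h' : e^-1 < m.+1%:R * (x * (1 - x)) - 1 by rewrite ltrBrDl.
have p0 : 0 < m.+1%:R * (x * (1 - x)) - 1 by apply: lt_trans h'; rewrite invr_gt0.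
by rewrite gtr0_norm ?invr_gt0// invf_plt ?posrE.
Unshelve. all: by end_near. Qed.

Let arg_pos x : 0 < x < 1 -> \forall m \near \oo, 0 < m.+1%:R * (x * (1 - x)) - 1.
Proof.
move=> /andP[x0 x1]; have q0 : 0 < x * (1 - x) by rewrite mulr_gt0// subr_gt0.
near=> m; rewrite subr_gt0 -ltr_pdivrMr//; apply: (@lt_trans _ _ m%:R); last by rewrite ltr_nat.
by near: m; exact: nbhs_infty_gtr.
Unshelve. all: by end_near. Qed.

Let flat_exp0_cvg x : 0 < x < 1 ->
  flat_exp 0 (m.+1%:R * (x * (1 - x)) - 1) @[m --> \oo] --> (1 : R).
Proof.
move=> x01; have c := arg_inv_cvg x01.
have : expR (- (m.+1%:R * (x * (1 - x)) - 1)^-1) @[m --> \oo] --> (1 : R).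
  rewrite -[X in _ --> X]expR0 -oppr0.
  exact: (cvg_comp _ expR (cvgN c) (@continuous_expR R (- 0))).
apply: cvg_trans; apply: near_eq_cvg; near=> m.
rewrite /flat_exp ifT ?expr0 ?mul1r//; near: m; exact: arg_pos.
Unshelve. all: by end_near. Qed.

Lemma cvg_sine_cutoff k x : 0 < x < 1 -> sine_cutoff k m x @[m --> \oo] --> sin (k%:R * pi * x).
Proof.
move=> x01; rewrite -[X in _ --> X]mulr1.
by apply: cvgM; [exact: cvg_cst | exact: flat_exp0_cvg].
Qed.

Lemma cvg_sine_cutoff' k x : 0 < x < 1 ->
  sine_cutoff' k m x @[m --> \oo] --> k%:R * pi * cos (k%:R * pi * x).
Proof.
move=> x01; rewrite -[X in _ --> X]addr0; apply: cvgD.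
  rewrite -[X in _ --> X]mulr1.
  by apply: cvgM; [exact: cvg_cst | exact: flat_exp0_cvg].
have x01' : 0 <= x <= 1 by have /andP[? ?] := x01; apply/andP; split; exact: ltW.
have c := arg_inv_cvg x01.
have up : 2 * (k%:R * pi) * ((m.+1%:R * (x * (1 - x)) - 1)^-1 + (m.+1%:R * (x * (1 - x)) - 1)^-1 ^+ 2)
    @[m --> \oo] --> (0 : R).
  rewrite -[X in _ --> X](mulr0 (2 * (k%:R * pi))); apply: cvgM; first exact: cvg_cst.
  rewrite -[X in _ --> X](_ : 0 + 0 * 0 = 0); last by rewrite mul0r addr0.
  by apply: cvgD => //; exact: (cvgM c c).
have kp : 0 <= 2 * (k%:R * pi) :> R by rewrite !mulr_ge0// pi_ge0.
apply/cvgrPdist_lt => e e0; move/cvgrPdist_lt/(_ e e0): up => up.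
near=> m; rewrite sub0r normrN -/(defect k m x).
have p0 : 0 < m.+1%:R * (x * (1 - x)) - 1 by near: m; exact: arg_pos.
apply: (le_lt_trans (defect_le k m x01')).
apply: (le_lt_trans (ler_wpM2l kp (flat_exp2_le p0))).
rewrite (le_lt_trans (ler_norm _))// -normrN -sub0r.
by near: m.
Unshelve. all: by end_near. Qed.

End SmoothCutoff.

(** * The space of order one *)

Section Bessel.
Variables (R : realType) (T : Type) (P : set T).
Variables (K : T -> T -> R) (e : nat -> T).

(** Each pivot removes one orthonormal direction; orthogonality leaves the later directions
    untouched, with diagonal value 1, so no denominators appear. *)
Lemma psd_bessel : psd P K -> (forall k, P (e k)) ->
  (forall k l, K (e k) (e l) = (k == l)%:R) ->
  forall m, psd P (fun u v => K u v - \sum_(k < m) K (e k) u * K (e k) v).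
Proof.
move=> psdK Pe eK; elim=> [|m IH]; first by apply: psd_eq psdK => u v _ _; rewrite big_ord0 subr0.
have ort u : \sum_(k < m) K (e k) (e m) * K (e k) u = 0.
  by rewrite big1// => k _; rewrite eK ltn_eqF// mul0r.
apply: psd_eq (psd_pivot IH (Pe m)) => u v _ _.
by rewrite !ort !subr0 eK eqxx divr1 big_ord_recr /= opprD addrA.
Qed.

End Bessel.

(** * Square integrable functions and dominated convergence *)

Section SquareIntegrable.
Variable R : realType.
Implicit Types (f g u v w : R -> R) (k : nat) (x : R).
Local Notation mu := (@lebesgue_measure R).

Lemma continuous_square_integrable f : continuous f -> square_integrable01 f.
Proof.
move=> fc; split; first by apply: integrable01_measurable; exact: continuous_integrable01.
by apply: continuous_integrable01 => x; apply: cvgM; exact: fc.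
Qed.

Lemma integrable01_le f g : measurable_fun (`[0, 1] : set R) f -> integrable01 g ->
  (forall x, 0 <= x <= 1 -> `|f x| <= g x) -> integrable01 f.
Proof.
move=> mf ig fg; apply: (le_integrable _ _ _ ig) => //; first exact/measurable_EFinP.
move=> x; rewrite /= in_itv /= => x01; rewrite lee_fin.
exact: le_trans (fg x x01) (ler_norm _).
Qed.

Lemma integrable01M u v : square_integrable01 u -> square_integrable01 v ->
  integrable01 (fun x => u x * v x).
Proof.
move=> [mu' iu] [mv iv]; apply: integrable01_le (integrable01D iu iv) _.
  exact: measurable_funM.
move=> x _; rewrite normrM -(real_normK (num_real (u x))) -(real_normK (num_real (v x))).
move: `|u x| `|v x| => a b; have := sqr_ge0 (a - b); nra.
Qed.

Lemma square_integrable01_integrable u : square_integrable01 u -> integrable01 u.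
Proof.
move=> iu; apply: eq_integrable01 (integrable01M iu (@continuous_square_integrable (fun=> 1) _)).
  by move=> x _; rewrite mulr1.
by move=> x; exact: cvg_cst.
Qed.

Lemma psd_int01M :
  psd (@square_integrable01 R) (fun u v => int01 (fun x => u x * v x)).
Proof.
split=> [u v _ _|n u t iu]; first by apply: eq_int01 => x _; rewrite mulrC.
have ii i j : integrable01 (fun x => t i * t j * (u i x * u j x)).
  by apply: integrable01Z; exact: integrable01M.
have -> : \sum_i \sum_j t i * t j * int01 (fun x => u i x * u j x) =
    int01 (fun x => (\sum_i t i * u i x) ^+ 2).
  transitivity (int01 (fun x => \sum_i \sum_j t i * t j * (u i x * u j x))).
    rewrite int01_sum; last by move=> i; exact: integrable01_sum.
    apply: eq_bigr => i _; rewrite int01_sum//; apply: eq_bigr => j _.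
    by rewrite int01Z//; exact: integrable01M.
  apply: eq_int01 => x _; rewrite expr2 mulr_suml; apply: eq_bigr => i _.
  by rewrite mulr_sumr; apply: eq_bigr => j _; rewrite mulrACA.
by apply: int01_ge0 => x _; exact: sqr_ge0.
Qed.

(** Dominated convergence with majorant [M * |w|], on the open interval because the cutoffs converge
    only there. *)
Lemma cvg_int01_mul w (phi : nat -> R -> R) (psi : R -> R) (M : R) :
  integrable01 w -> (forall m, continuous (phi m)) -> continuous psi ->
  (forall m x, 0 <= x <= 1 -> `|phi m x| <= M) ->
  (forall x, 0 < x < 1 -> phi m x @[m --> \oo] --> psi x) ->
  int01 (fun x => w x * phi m x) @[m --> \oo] --> int01 (fun x => w x * psi x).
Proof.
move=> iw phic psic phiM phipsi.
have iM g : continuous g -> integrable01 (fun x => w x * g x).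
  move=> gc; have := integrable01_mul_continuous (continuous_subspaceT gc) iw.
  by under eq_fun do rewrite mulrC.
have sub : (`]0, 1[ : set R) `<=` (`[0, 1] : set R) by exact: subset_itv_oo_cc.
have oo g : integrable01 g -> mu.-integrable (`]0, 1[ : set R) (EFin \o g).
  by move=> ig; apply: (@integrableS _ _ _ mu `[0, 1]).
have ooE g : integrable01 g -> int01 g = fine (\int[mu]_(x in `]0, 1[) (g x)%:E).
  by move=> ig; rewrite /int01 /Rintegral integral_itv_bndoo//; exact: measurable_int (oo _ ig).
rewrite (ooE _ (iM _ psic)); under eq_fun do rewrite (ooE _ (iM _ (phic _))).
apply: fine_cvg; rewrite fineK; last first.
  by apply: integrable_fin_num => //; exact/oo/iM.
have ig : mu.-integrable (`]0, 1[ : set R) (EFin \o (fun x => M * `|w x|)).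
  by apply: oo; apply: integrable01Z; exact: (integrable_norm iw).
case: (@dominated_convergence _ _ _ mu (`]0, 1[%classic : set R) (measurable_itv _)
  (fun m => EFin \o (fun x => w x * phi m x)) (EFin \o (fun x => w x * psi x)) _ _ _ _ ig _).
- by move=> m; exact: measurable_int (oo _ (iM _ (phic m))).
- exact: measurable_int (oo _ (iM _ psic)).
- apply: aeW => x /=; rewrite in_itv /= => x01; apply: cvg_EFin; first exact: nearW.
  by apply: cvgM; [exact: cvg_cst | exact: phipsi].
- apply: aeW => x m /=; rewrite in_itv /= => /andP[x0 x1]; rewrite lee_fin normrM mulrC.
  by rewrite ler_wpM2r// phiM// (ltW x0) (ltW x1).
- by [].
Qed.

End SquareIntegrable.

Section OrderOne.
Variable R : realType.
Implicit Types (f g w : R -> R) (k : nat) (x gamma : R).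

(** Sines are not admissible test functions, their support reaching the endpoints. The identity is
    the limit of those for [sine_cutoff], and no boundary term arises because the sines vanish at 0
    and 1. *)
Lemma weak_derive_sine f w k : {within `[0, 1], continuous f} -> L2_weak_derivative f w ->
  k%:R * pi * int01 (fun x => f x * cos (k%:R * pi * x)) =
  - int01 (fun x => w x * sin (k%:R * pi * x)).
Proof.
move=> fc [iw fw]; have fi := continuous01_integrable fc.
have sc m : continuous (@sine_cutoff R k m) by exact: smooth_expr_continuous (smooth_sine_cutoff _ _ _).
have sc' m : continuous (@sine_cutoff' R k m).
  by rewrite -derive_sine_cutoff; exact: smooth_expr_continuous (smooth_expr_derive1 (smooth_sine_cutoff _ _ _)).
have kcos : continuous (fun x => k%:R * pi * cos (k%:R * pi * x) : R).
  by move=> x; apply: cvgM; [exact: cvg_cst | exact: continuous_cos_lin].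
have lim1 := cvg_int01_mul fi sc' kcos (sine_cutoff'_bound k) (@cvg_sine_cutoff' R k).
have lim2 := cvg_int01_mul (square_integrable01_integrable iw) sc (@continuous_sin_lin R (k%:R * pi))
  (fun m x _ => sine_cutoff_bound k m x) (@cvg_sine_cutoff R k).
have -> : k%:R * pi * int01 (fun x => f x * cos (k%:R * pi * x)) =
    int01 (fun x => f x * (k%:R * pi * cos (k%:R * pi * x))).
  rewrite -int01Z; last first.
    exact: integrable01_mul_continuous fc (continuous_integrable01 (@continuous_cos_lin R _)).
  by apply: eq_int01 => x _; rewrite mulrCA.
apply: (cvg_unique _ lim1) => //.
have -> : (fun m => int01 (fun x => f x * sine_cutoff' k m x)) =
    (fun m => - int01 (fun x => w x * sine_cutoff k m x)).
  by apply/funext => m; rewrite -fw ?derive_sine_cutoff//; exact: test_sine_cutoff.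
exact: cvgN.
Qed.

(** Shifted so that index 0 has frequency 1, which makes the whole family orthonormal. *)
Let sine k x : R := Num.sqrt 2 * sin (k.+1%:R * pi * x).

Let continuous_sine k : continuous (sine k).
Proof. by move=> x; apply: cvgM; [exact: cvg_cst | exact: continuous_sin_lin]. Qed.

Let int01_sine2 k l : int01 (fun x => sine k x * sine l x) = (k == l)%:R.
Proof.
rewrite (_ : (fun x => _) = fun x => Num.sqrt 2 * Num.sqrt 2 *
    (sin (k.+1%:R * pi * x) * sin (l.+1%:R * pi * x))); last first.
  by apply/funext => x; rewrite /sine mulrACA.
rewrite int01Z ?int01_sinsin; last first.
  by apply: continuous_integrable01 => x; apply: cvgM; exact: continuous_sin_lin.
by rewrite -expr2 sqr_sqrtr// subr0 mulVKf.
Qed.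

Lemma dominates_sob_H1 gamma : 0 < gamma ->
  dominates (sob_H1 gamma) (sobolev_weight 1 (rescaled_weight 1 gamma)).
Proof.
move=> gamma0; have kE : kappa (1 : R) = pi ^+ 2 by rewrite /kappa ltxx eqxx.
have k0 : 0 < kappa (1 : R) by rewrite kE exprn_gt0// pi_gt0.
have wd f : @dom R R (sob_H1 gamma) f -> L2_weak_derivative f (weak_derive f).
  by move=> [_ ex]; exact: xgetPex.
split=> [f []//|K].
have coef f k : @dom R R (sob_H1 gamma) f ->
    int01 (fun x => sine k x * weak_derive f x) = - (k.+1%:R * pi * cosine_coef f k.+1).
  move=> df; have [fc _] := df; have [iw _] := wd f df.
  have -> : int01 (fun x => sine k x * weak_derive f x) =
      Num.sqrt 2 * int01 (fun x => weak_derive f x * sin (k.+1%:R * pi * x)).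
    rewrite -int01Z; first by apply: eq_int01 => x _; rewrite /sine /= [RHS]mulrCA mulrC.
    by apply: integrable01M iw _; apply: continuous_square_integrable; exact: continuous_sin_lin.
  have -> : cosine_coef f k.+1 = Num.sqrt 2 * int01 (fun x => f x * cos (k.+1%:R * pi * x)).
    rewrite -int01Z; first by apply: eq_int01 => x _; rewrite /= mulrCA.
    exact: integrable01_mul_continuous fc (continuous_integrable01 (@continuous_cos_lin R _)).
  by rewrite mulrCA (weak_derive_sine _ fc (wd f df)) mulrN opprK.
have g0 : 0 <= (gamma ^+ 2)^-1 by rewrite invr_ge0 sqr_ge0.
have bessel m := psd_comp (fun f df => (wd f df).1)
  (psd_bessel (@psd_int01M R) (fun k => continuous_square_integrable (@continuous_sine k)) int01_sine2 m).
have sc m := psd_mul (psd_rank1 (@dom R R (sob_H1 gamma)) (fun=> 1) g0) (bessel m).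
(* The frequency 0 term, present from [K = 1] on, cancels the product of means exactly; for [K = 0]
   that product stays as an additional rank-one kernel. *)
case: K => [|m].
  apply: psd_eq (psd_add (psd_rank1 _ (fun f => int01 f) ler01) (sc 0%N)) => f g _ _ /=.
  by rewrite !big_ord0 !subr0 !mul1r !mulr1.
apply: psd_eq (sc m) => f g df dg; rewrite big_ord_recl /= sobolev_weight_rescaled//=.
have c0 h : cosine_coef h 0 = int01 h by apply: eq_int01 => x _; rewrite /= mulr1.
rewrite !c0 !mul1r !mulr1 opprD addrACA subrr add0r mulrBr; congr (_ - _).
rewrite mulr_sumr; apply: eq_bigr => k _.
rewrite !coef// sobolev_weight_rescaled//= kE mulr1 powR_mulrn// /bump /= add1n; ring.
Qed.

End OrderOne.

Theorem theorem4p1 (R : realType) (alpha : R) (d : nat) (gamma : 'I_d -> R)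
    (n : nat) (z : 'I_d -> nat) :
  let Gamma := fun j => rescaled_weight alpha (gamma j) in
  1 / 2 < alpha < 2 ->
  (0 < d)%N ->
  (forall j, 0 < gamma j) ->
  prime n ->
  cbc_vector n alpha Gamma z ->
  forall lambda : R, 1 / 2 <= lambda < alpha ->
  let V := \prod_(j < d)
    (1 + 2 * Gamma j `^ lambda^-1 * zeta (alpha / lambda)) in
  (wce (sob alpha gamma) n (tent_lattice R n z)
     <= (((V - 1) / (n%:R - 1)) `^ lambda)%:E)%E.
Proof.
move=> Gamma /andP[a12 a2] _ gamma0 n_prime cbc lambda lambda_a.
have kappa0 : 0 < kappa alpha.
  case: (ltgtP alpha 1) => [a1|a1|->]; last by rewrite /kappa ltxx eqxx exprn_gt0// pi_gt0.
    by apply: (kappa_lt1_gt0 _).2; rewrite a12.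
  by apply: (kappa_gt1_gt0 _).2; rewrite a1.
apply: wce_cbc_le n_prime lambda_a _ _ cbc => j; first exact: rescaled_weight_gt0.
rewrite /sob1; case: (ltgtP alpha 1) => [a1|a1|a1].
- by apply: dominates_completion; apply: dominates_sob_span_lt1 => //; rewrite a12.
- by apply: dominates_completion; apply: dominates_sob_span_gt1 => //; rewrite a1.
- by rewrite /Gamma a1; exact: dominates_sob_H1.
Qed.
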